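(* Let $k$ be a commutative ring, let $\mathcal C$ and $\mathcal D$ be $k$-linear Frobenius categories, and let $L:\mathcal D\to\mathcal C$ and $R:\mathcal C\to\mathcal D$ be exact functors with $L$ left adjoint to $R$, unit $\eta_N:N\to RLN$ and counit $\delta_M:LRM\to M$. Assume that $R(\delta_M)$ has injective kernel for each object $M$ of $\mathcal C$ and that $L(\eta_N)$ has projective cokernel for each object $N$ of $\mathcal D$. Let $\mathcal W_{\mathcal C}$ be the class of morphisms $f$ of $\mathcal C$ such that $R(f)$ is a stable isomorphism, and $\mathcal W_{\mathcal D}$ the class of morphisms $g$ of $\mathcal D$ such that $L(g)$ is a stable isomorphism; endow $\mathcal C$ and $\mathcal D$ with the model structures described in the context. Then: 1) The functors $L$ and $R$ induce mutually quasi-inverse triangle equivalences between $\mathcal C[\mathcal W_{\mathcal C}^{-1}]$ and $\mathcal D[\mathcal W_{\mathcal D}^{-1}]$. 2) If both $\mathcal C$ and $\mathcal D$ have finite direct and inverse limits (i.e. finite colimits and limits), then they are model categories and the pair $(L,R)$ is a Quillen equivalence between $\mathcal C$ and $\mathcal D$. 3) If $\mathcal C$ has kernels and $\mathcal D$ has cokernels, then they are relevant derivable categories and the functors $L$ and $R$ induce mutually quasi-inverse equivalences $\mathbb L L:\mathbb D\mathcal D\to\mathbb D\mathcal C$ and $\mathbb R R:\mathbb D\mathcal C\to\mathbb D\mathcal D$ between the corresponding derivators.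
   Context: An exact category (Quillen) is an additive category with a class of kernel-cokernel pairs $X\xrightarrow{i}Y\xrightarrow{p}Z$ called conflations ($i$ inflation, $p$ deflation) satisfying the usual axioms. A functor is exact if it is additive and preserves conflations. A Frobenius category is an exact category with enough injectives and projectives (relative to conflations) in which these coincide; its stable category (quotient by morphisms factoring through projective-injectives) is triangulated. For each $X$ fix conflations $X\to IX\to SX$ and $S^{-1}X\to PX\to X$ with $IX$ injective, $PX$ projective; $S$ is the shift of the stable category. A stable isomorphism is a morphism invertible in the stable category. A model structure on a category consists of weak equivalences, cofibrations and fibrations satisfying 2-out-of-3 for weak equivalences, closure of the three classes under retracts, the two usual lifting axioms and the two usual factorization axioms (no functoriality and no (co)limits required). A model category is a category with finite limits and colimits endowed with a model structure. Model structure on $\mathcal C$: weak equivalences $\mathcal W_{\mathcal C}$; cofibrations: inflations with cokernel of the form $LN$, $N\in\mathcal D$, and their retracts; fibrations: morphisms with the right lifting property with respect to $0\to PLN$ for all $N\in\mathcal D$. Model structure on $\mathcal D$ (the dual one): weak equivalences $\mathcal W_{\mathcal D}$; fibrations: deflations with kernel of the form $RM$, $M\in\mathcal C$, and their retracts; cofibrations: morphisms with the left lifting property with respect to $IRM\to 0$ for all $M\in\mathcal C$. The localizations $\mathcal C[\mathcal W_{\mathcal C}^{-1}]$, $\mathcal D[\mathcal W_{\mathcal D}^{-1}]$ are triangle quotients of the stable categories and are regarded as triangulated categories in this way. Derivable categories (Cisinski). A category with classes $\mathcal W$ (weak equivalences) and $\mathcal Fib$ (fibrations) is left derivable if: (D0)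 it has a final object, which is fibrant, and fibrant objects ($X$ with $X\to *$ in $\mathcal Fib$) are closed under isomorphism; (D1) isomorphisms are weak equivalences and $\mathcal W$ satisfies 2-out-of-3; (D2) isomorphisms between fibrant objects are fibrations, fibrations between fibrant objects are closed under composition, and pullbacks of fibrations between fibrant objects along morphisms from fibrant objects exist and are fibrations; (D3) the same base changes of trivial fibrations between fibrant objects are trivial fibrations; (D4) every morphism with fibrant target factors as a weak equivalence followed by a fibration. Right derivable, with a class of cofibrations, is the dual notion. A derivable category has classes $\mathcal W,\mathcal Cof,\mathcal Fib$ making it left and right derivable. It is relevant if moreover it has the lifting property: in every commutative square whose left side is a cofibration with cofibrant source and whose right side is a fibration with fibrant target, one of them being a weak equivalence, there is a diagonal lifting. For a derivable category $\mathcal E$, the associated derivator $\mathbb D\mathcal E$ assigns to each finite direct category $I$ (a category whose nerve has finitely many nondegenerate simplices) the localization of the functor category $\mathrm{Fun}(I^{op},\mathcal E)$ at the objectwise weak equivalences; $\mathbb R R$ and $\mathbb L L$ are the total right and left derived functors of $R$ and $L$ at the level of these derivators.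
   Formalization: In 2) it is additionally assumed that the fixed conflations are chosen so that each PLN is a direct summand of some LN' and each IRM of some RM'; for arbitrary choices 2) fails (e.g. D = 0 and P0 nonzero). *)

(* Defs.v *)
From Stdlib Require Import Setoid Morphisms.
From mathcomp Require Import all_boot all_algebra.
From mathcomp Require Import boolp.

Set Implicit Arguments.
Unset Strict Implicit.
Unset Printing Implicit Defensive.

Import GRing.Theory.

(** * Categories *)

(* Morphisms are compared by an equivalence relation carried by the category,
   so that quotients (stable categories, localizations) keep representatives.
   A localization has the objects of the original category; objects and
   morphisms live in one common universe. *)
Record Category := {
  obj :> Type;
  hom : obj -> obj -> Type;
  heq : forall X Y, hom X Y -> hom X Y -> Prop;
  idm : forall X, hom X X;
  comp : forall X Y Z, hom Y Z -> hom X Y -> hom X Z;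
  heq_equiv : forall X Y, Equivalence (@heq X Y);
  comp_heq : forall X Y Z (g g' : hom Y Z) (f f' : hom X Y),
    heq g g' -> heq f f' -> heq (comp g f) (comp g' f');
  compA : forall W X Y Z (h : hom Y Z) (g : hom X Y) (f : hom W X),
    heq (comp h (comp g f)) (comp (comp h g) f);
  comp1f : forall X Y (f : hom X Y), heq (comp (idm Y) f) f;
  compf1 : forall X Y (f : hom X Y), heq (comp f (idm X)) f }.

Arguments hom {c} X Y.
Arguments heq {c X Y} f g.
Arguments idm {c} X.
Arguments comp {c X Y Z} g f.

Declare Scope cat_scope.
Delimit Scope cat_scope with cat.
Notation "f ≈ g" := (heq f g) (at level 70, no associativity) : cat_scope.
Notation "g ∘ f" := (comp g f) (at level 40, left associativity) : cat_scope.
Local Open Scope cat_scope.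

#[global] Existing Instance heq_equiv.

#[global] Instance comp_Proper (C : Category) (X Y Z : C) :
  Proper (respectful heq (respectful heq heq)) (@comp C X Y Z).
Proof. by move=> g g' Hg f f' Hf; exact: comp_heq. Qed.

Lemma hrefl (C : Category) (X Y : C) (f : hom X Y) : f ≈ f.
Proof. reflexivity. Qed.
#[global] Hint Resolve hrefl : core.

Lemma hsym (C : Category) (X Y : C) (f g : hom X Y) : f ≈ g -> g ≈ f.
Proof. by move=> H; symmetry. Qed.

Lemma htrans (C : Category) (X Y : C) (g f h : hom X Y) :
  f ≈ g -> g ≈ h -> f ≈ h.
Proof. by move=> H K; transitivity g. Qed.

Definition op (C : Category) : Category := {|
  obj := C;
  hom X Y := @hom C Y X;
  heq X Y f g := @heq C Y X f g;
  idm X := @idm C X;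
  comp X Y Z g f := @comp C Z Y X f g;
  heq_equiv X Y := heq_equiv Y X;
  comp_heq X Y Z g g' f f' Hg Hf := comp_heq Hf Hg;
  compA W X Y Z h g f := hsym (compA f g h);
  comp1f X Y f := compf1 f;
  compf1 X Y f := comp1f f |}.

Definition is_iso (C : Category) (X Y : C) (f : hom X Y) : Prop :=
  exists g : hom Y X, g ∘ f ≈ idm X /\ f ∘ g ≈ idm Y.

Record Functor (C D : Category) := {
  fobj :> C -> D;
  fmap : forall X Y, hom X Y -> hom (fobj X) (fobj Y);
  fmap_heq : forall X Y (f g : hom X Y), f ≈ g -> fmap f ≈ fmap g;
  fmap_id : forall X, fmap (idm X) ≈ idm (fobj X);
  fmap_comp : forall X Y Z (g : hom Y Z) (f : hom X Y),
    fmap (g ∘ f) ≈ fmap g ∘ fmap f }.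

Arguments fmap {C D} F {X Y} f : rename.

#[global] Instance fmap_Proper (C D : Category) (F : Functor C D) (X Y : C) :
  Proper (respectful heq heq) (@fmap C D F X Y).
Proof. by move=> f g; exact: fmap_heq. Qed.

Definition Fid (C : Category) : Functor C C := {|
  fobj X := X;
  fmap X Y f := f;
  fmap_heq X Y f g H := H;
  fmap_id X := hrefl (idm X);
  fmap_comp X Y Z g f := hrefl (g ∘ f) |}.

Definition Fcomp (A B C : Category) (G : Functor B C) (F : Functor A B) :
  Functor A C.
Proof.
refine {| fobj X := G (F X); fmap X Y f := fmap G (fmap F f) |}.
- abstract (by move=> X Y f g H; do 2!apply: fmap_heq).
- abstract (by move=> X; rewrite fmap_id fmap_id).
- abstract (by move=> X Y Z g f; rewrite fmap_comp fmap_comp).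
Defined.
Notation "G ∘F F" := (Fcomp G F) (at level 40, left associativity) : cat_scope.

Definition Fop (C D : Category) (F : Functor C D) : Functor (op C) (op D) := {|
  fobj := F : op C -> op D;
  fmap X Y f := @fmap C D F Y X f;
  fmap_heq X Y f g H := fmap_heq F H;
  fmap_id X := fmap_id F X;
  fmap_comp X Y Z g f := fmap_comp F f g |}.

Record NatTrans (C D : Category) (F G : Functor C D) := {
  nt :> forall X, hom (F X) (G X);
  nt_nat : forall X Y (f : hom X Y), nt Y ∘ fmap F f ≈ fmap G f ∘ nt X }.

Record NatIso (C D : Category) (F G : Functor C D) := {
  ni_nt :> NatTrans F G;
  ni_iso : forall X, is_iso (ni_nt X) }.

Definition nt_id (C D : Category) (F : Functor C D) : NatTrans F F.
Proof.
refine {| nt X := idm (F X) |}.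
abstract (by move=> X Y f; rewrite comp1f compf1).
Defined.

Definition nt_comp (C D : Category) (F G H : Functor C D)
  (b : NatTrans G H) (a : NatTrans F G) : NatTrans F H.
Proof.
refine {| nt X := b X ∘ a X |}.
abstract (by move=> X Y f; rewrite -compA nt_nat compA nt_nat compA).
Defined.

Definition whiskerL (B C D : Category) (K : Functor C D) (F G : Functor B C)
  (a : NatTrans F G) : NatTrans (K ∘F F) (K ∘F G).
Proof.
refine {| nt X := fmap K (a X) : hom ((K ∘F F) X) ((K ∘F G) X) |}.
abstract (by move=> X Y f /=; rewrite -!fmap_comp nt_nat).
Defined.

Definition whiskerR (B C D : Category) (F G : Functor C D) (a : NatTrans F G)
  (H : Functor B C) : NatTrans (F ∘F H) (G ∘F H).
Proof.
refine {| nt X := a (H X) : hom ((F ∘F H) X) ((G ∘F H) X) |}.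
abstract (by move=> X Y f /=; rewrite nt_nat).
Defined.

Definition Fun (A B : Category) : Category.
Proof.
refine {| obj := Functor A B; hom F G := NatTrans F G;
  heq F G a b := forall X, a X ≈ b X;
  idm F := nt_id F; comp F G H b a := nt_comp b a |}.
- abstract (move=> F G; split=> [a X|a b H X|a b c H1 H2 X];
    [by []|by symmetry; apply: H|by transitivity (b X); auto]).
- abstract (by move=> F G H b b' a a' Hb Ha X /=; rewrite (Hb X) (Ha X)).
- abstract (by move=> F G H K c b a X /=; rewrite compA).
- abstract (by move=> F G a X /=; rewrite comp1f).
- abstract (by move=> F G a X /=; rewrite compf1).
Defined.

(* The comparison morphisms between composite functors that agree on objects
   and morphisms. *)
Definition fassoc (A B C D : Category) (H : Functor C D) (G : Functor B C)
  (F : Functor A B) : NatTrans ((H ∘F G) ∘F F) (H ∘F (G ∘F F)).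
Proof.
refine {| nt X := idm _ : hom (((H ∘F G) ∘F F) X) ((H ∘F (G ∘F F)) X) |}.
abstract (by move=> X Y f; rewrite comp1f compf1).
Defined.

Definition flunit (A B : Category) (F : Functor A B) : NatTrans (Fid B ∘F F) F.
Proof.
refine {| nt X := idm _ : hom ((Fid B ∘F F) X) (F X) |}.
abstract (by move=> X Y f; rewrite comp1f compf1).
Defined.

Definition frunit (A B : Category) (F : Functor A B) : NatTrans (F ∘F Fid A) F.
Proof.
refine {| nt X := idm _ : hom ((F ∘F Fid A) X) (F X) |}.
abstract (by move=> X Y f; rewrite comp1f compf1).
Defined.

Record Adjunction (C D : Category) (L : Functor D C) (R : Functor C D) := {
  unit_of : NatTrans (Fid D) (R ∘F L);
  counit_of : NatTrans (L ∘F R) (Fid C);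
  triangle_L : forall N : D,
    counit_of (L N) ∘ fmap L (unit_of N) ≈ idm (L N);
  triangle_R : forall M : C,
    fmap R (counit_of M) ∘ unit_of (R M) ≈ idm (R M) }.

(** ** Limits *)

Definition is_terminal (C : Category) (T : C) : Prop :=
  forall X : C, exists f : hom X T, forall g : hom X T, g ≈ f.

Definition is_initial (C : Category) (T : C) : Prop := is_terminal (T : op C).

Definition is_product (C : Category) (X Y P : C) (p : hom P X) (q : hom P Y)
  : Prop :=
  forall (A : C) (f : hom A X) (g : hom A Y),
    exists h : hom A P, (p ∘ h ≈ f /\ q ∘ h ≈ g) /\
      forall h', p ∘ h' ≈ f -> q ∘ h' ≈ g -> h' ≈ h.

Definition is_pullback (C : Category) (X Y Z P : C) (f : hom X Z) (g : hom Y Z)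
  (p : hom P X) (q : hom P Y) : Prop :=
  f ∘ p ≈ g ∘ q /\
  forall (A : C) (a : hom A X) (b : hom A Y), f ∘ a ≈ g ∘ b ->
    exists h : hom A P, (p ∘ h ≈ a /\ q ∘ h ≈ b) /\
      forall h', p ∘ h' ≈ a -> q ∘ h' ≈ b -> h' ≈ h.

Definition is_pushout (C : Category) (X Y Z P : C) (f : hom Z X) (g : hom Z Y)
  (p : hom X P) (q : hom Y P) : Prop :=
  @is_pullback (op C) X Y Z P f g p q.

Record Cone (J C : Category) (F : Functor J C) := {
  apex :> C;
  leg : forall j, hom apex (F j);
  leg_nat : forall i j (u : hom i j), fmap F u ∘ leg i ≈ leg j }.

Definition is_limit (J C : Category) (F : Functor J C) (c : Cone F) : Prop :=
  forall d : Cone F, exists h : hom d c,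
    (forall j, leg c j ∘ h ≈ leg d j) /\
    forall h' : hom d c, (forall j, leg c j ∘ h' ≈ leg d j) -> h' ≈ h.

Definition finite_category (J : Category) : Prop :=
  exists (n : nat) (s : 'I_n -> {X : J & {Y : J & @hom J X Y}}),
    forall (X Y : J) (f : hom X Y), exists i (f' : hom X Y),
      s i = existT _ X (existT _ Y f') /\ f ≈ f'.

Definition has_finite_limits (C : Category) : Prop :=
  forall (J : Category) (F : Functor J C), finite_category J ->
    exists c : Cone F, is_limit c.

Definition has_finite_colimits (C : Category) : Prop :=
  has_finite_limits (op C).

(** * Localization *)

Definition MorClass (C : Category) := forall X Y : C, hom X Y -> Prop.

Definition op_class (C : Category) (W : MorClass C) : MorClass (op C) :=
  fun X Y f => W Y X f.

Section Localization.
Context {C : Category} (W : MorClass C).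

Inductive lhom : C -> C -> Type :=
| lin X Y : hom X Y -> lhom X Y
| linv X Y (w : hom X Y) : W w -> lhom Y X
| lcmp X Y Z : lhom Y Z -> lhom X Y -> lhom X Z.

Inductive leq : forall X Y, lhom X Y -> lhom X Y -> Prop :=
| leq_refl X Y (a : lhom X Y) : leq a a
| leq_sym X Y (a b : lhom X Y) : leq a b -> leq b a
| leq_trans X Y (a b c : lhom X Y) : leq a b -> leq b c -> leq a c
| leq_cmp X Y Z (b b' : lhom Y Z) (a a' : lhom X Y) :
    leq b b' -> leq a a' -> leq (lcmp b a) (lcmp b' a')
| leq_assoc X Y Z T (c : lhom Z T) (b : lhom Y Z) (a : lhom X Y) :
    leq (lcmp c (lcmp b a)) (lcmp (lcmp c b) a)
| leq_idl X Y (a : lhom X Y) : leq (lcmp (lin (idm Y)) a) a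
| leq_idr X Y (a : lhom X Y) : leq (lcmp a (lin (idm X))) a
| leq_heq X Y (f g : hom X Y) : f ≈ g -> leq (lin f) (lin g)
| leq_comp X Y Z (g : hom Y Z) (f : hom X Y) :
    leq (lin (g ∘ f)) (lcmp (lin g) (lin f))
| leq_invl X Y (w : hom X Y) (Ww : W w) :
    leq (lcmp (linv Ww) (lin w)) (lin (idm X))
| leq_invr X Y (w : hom X Y) (Ww : W w) :
    leq (lcmp (lin w) (linv Ww)) (lin (idm Y)).

(* C[W^-1] *)
Definition Loc : Category.
Proof.
refine {| obj := C; hom := lhom; heq := leq;
  idm X := lin (idm X); comp := lcmp |}.
- abstract (by move=> X Y; split;
    [exact: leq_refl|exact: leq_sym|exact: leq_trans]).
- exact: leq_cmp.
- abstract (by move=> *; exact: leq_assoc).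
- exact: leq_idl.
- exact: leq_idr.
Defined.

Definition locQ : Functor C Loc.
Proof.
refine (@Build_Functor C Loc (fun X => X) (fun X Y f => lin f) _ _ _).
- exact: leq_heq.
- abstract (by move=> X).
- exact: leq_comp.
Defined.

Lemma locQ_inverts X Y (w : hom X Y) : W w -> is_iso (fmap locQ w).
Proof.
by move=> Ww; exists (linv Ww); split; [exact: leq_invl|exact: leq_invr].
Qed.

Definition inverts {E : Category} (F : Functor C E) : Prop :=
  forall X Y (w : hom X Y), W w -> is_iso (fmap F w).

Section Lift.
Context {E : Category} (F : Functor C E) (HF : inverts F).

Fixpoint loc_sem X Y (a : lhom X Y) : hom (F X) (F Y) :=
  match a in lhom X Y return hom (F X) (F Y) with
  | lin _ _ f => fmap F f
  | linv _ _ _ Ww => projT1 (cid (HF Ww))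
  | lcmp _ _ _ b a => loc_sem b ∘ loc_sem a
  end.

Lemma loc_sem_leq X Y (a b : lhom X Y) : leq a b -> loc_sem a ≈ loc_sem b.
Proof.
elim=> {X Y a b} //=.
- by move=> X Y a b _; symmetry.
- by move=> X Y a b c _ H _; transitivity (loc_sem b).
- by move=> X Y Z b b' a a' _ Hb _ Ha; rewrite Hb Ha.
- by move=> *; rewrite compA.
- by move=> X Y a; rewrite fmap_id comp1f.
- by move=> X Y a; rewrite fmap_id compf1.
- by move=> X Y f g; exact: fmap_heq.
- by move=> *; exact: fmap_comp.
- by move=> X Y w Ww; case: cid => v [/= H _]; rewrite H fmap_id.
- by move=> X Y w Ww; case: cid => v [/= _ H]; rewrite H fmap_id.
Qed.

(* The functor out of C[W^-1] induced by a functor inverting W. *)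
Definition loc_lift : Functor Loc E.
Proof.
refine (@Build_Functor Loc E (fun X => F X) loc_sem _ _ _).
- exact: loc_sem_leq.
- abstract (by move=> X; exact: (fmap_id F)).
- abstract (by []).
Defined.
End Lift.

Lemma loc_nat_ind {E : Category} (F G : Functor Loc E)
    (t : forall X : C, hom (F X) (G X)) :
  (forall (X Y : C) (f : @hom C X Y),
    t Y ∘ fmap F (fmap locQ f) ≈ fmap G (fmap locQ f) ∘ t X) ->
  forall (X Y : Loc) (a : hom X Y), t Y ∘ fmap F a ≈ fmap G a ∘ t X.
Proof.
move=> Ht X Y; elim=> {X Y} [X Y f|X Y w Ww|X Y Z b IHb a IHa].
- exact: (Ht _ _ f).
- have HF : fmap F (lin w : @hom Loc X Y) ∘ fmap F (linv Ww : @hom Loc Y X)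
      ≈ idm _.
    by rewrite -fmap_comp -fmap_id; apply: fmap_heq; exact: leq_invr.
  have HG : fmap G (linv Ww : @hom Loc Y X) ∘ fmap G (lin w : @hom Loc X Y)
      ≈ idm _.
    by rewrite -fmap_comp -fmap_id; apply: fmap_heq; exact: leq_invl.
  have H := Ht _ _ w; rewrite /= in H.
  rewrite -(comp1f (t X ∘ _)) -{1}HG -compA (compA _ (t X)) -H -compA HF.
  by rewrite compf1.
- rewrite (fmap_comp F (b : @hom Loc Y Z) a) (fmap_comp G (b : @hom Loc Y Z) a).
  by rewrite compA IHb -compA IHa compA.
Qed.

Definition loc_nat {E : Category} (F G : Functor Loc E)
    (t : forall X : C, hom (F X) (G X))
    (Ht : forall (X Y : C) (f : @hom C X Y),
      t Y ∘ fmap F (fmap locQ f) ≈ fmap G (fmap locQ f) ∘ t X) :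
  NatTrans F G := {| nt := t : forall X : Loc, _; nt_nat := loc_nat_ind Ht |}.

End Localization.

Definition preserves_class {C D : Category} (W : MorClass C) (W' : MorClass D)
  (F : Functor C D) : Prop := forall X Y (f : hom X Y), W X Y f -> W' _ _ (fmap F f).

Fixpoint loc_map_hom {C D : Category} {W : MorClass C} {W' : MorClass D}
  (F : Functor C D) (HF : preserves_class W W' F) X Y (a : lhom W X Y) :
  lhom W' (F X) (F Y) :=
  match a in lhom _ X Y return lhom W' (F X) (F Y) with
  | lin _ _ f => lin W' (fmap F f)
  | linv _ _ w Ww => linv (HF _ _ w Ww)
  | lcmp _ _ _ b a => lcmp (loc_map_hom HF b) (loc_map_hom HF a)
  end.

Lemma loc_map_leq {C D : Category} {W : MorClass C} {W' : MorClass D}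
    (F : Functor C D) (HF : preserves_class W W' F) X Y (a b : lhom W X Y) :
  leq a b -> leq (loc_map_hom HF a) (loc_map_hom HF b).
Proof.
elim=> {X Y a b} /=.
- by move=> *; exact: leq_refl.
- by move=> *; exact: leq_sym.
- by move=> X Y a b c _ H _; exact: leq_trans.
- by move=> *; exact: leq_cmp.
- by move=> *; exact: leq_assoc.
- move=> X Y a; apply: leq_trans (leq_idl _).
  by apply: leq_cmp (leq_refl _); apply: leq_heq; exact: fmap_id.
- move=> X Y a; apply: leq_trans (leq_idr _).
  by apply: leq_cmp; [exact: leq_refl|apply: leq_heq; exact: fmap_id].
- by move=> X Y f g H; apply: leq_heq; exact: fmap_heq.
- move=> X Y Z g f; apply: leq_trans (leq_comp _ _ _).
  by apply: leq_heq; exact: fmap_comp.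
- move=> X Y w Ww; apply: leq_trans (leq_invl _) _.
  by apply: leq_heq; rewrite fmap_id.
- move=> X Y w Ww; apply: leq_trans (leq_invr _) _.
  by apply: leq_heq; rewrite fmap_id.
Qed.

(* The functor C[W^-1] -> D[W'^-1] induced by F *)
Definition loc_map {C D : Category} {W : MorClass C} {W' : MorClass D}
  (F : Functor C D) (HF : preserves_class W W' F) : Functor (Loc W) (Loc W').
Proof.
refine (@Build_Functor (Loc W) (Loc W') (fun X => F X) (loc_map_hom HF)
  (loc_map_leq HF) _ _).
- abstract (by move=> X; apply: leq_heq; exact: fmap_id).
- abstract (by move=> X Y Z b a; exact: leq_refl).
Defined.

(** * Exact and Frobenius categories *)

Section Linear.
Local Open Scope ring_scope.

Record AdditiveCat (k : comPzRingType) := {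
  aobj :> Type;
  ahom : aobj -> aobj -> lmodType k;
  aidm : forall X, ahom X X;
  acomp : forall X Y Z, ahom Y Z -> ahom X Y -> ahom X Z;
  acompA : forall W X Y Z (h : ahom Y Z) (g : ahom X Y) (f : ahom W X),
    acomp h (acomp g f) = acomp (acomp h g) f;
  acomp1f : forall X Y (f : ahom X Y), acomp (aidm Y) f = f;
  acompf1 : forall X Y (f : ahom X Y), acomp f (aidm X) = f;
  acomp_linl : forall X Y Z (a : k) (g g' : ahom Y Z) (f : ahom X Y),
    acomp (a *: g + g') f = a *: acomp g f + acomp g' f;
  acomp_linr : forall X Y Z (a : k) (g : ahom Y Z) (f f' : ahom X Y),
    acomp g (a *: f + f') = a *: acomp g f + acomp g f';
  zob : aobj;
  zobP : aidm zob = 0;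
  biprod : forall X Y, exists (B : aobj) (i1 : ahom X B) (i2 : ahom Y B)
      (p1 : ahom B X) (p2 : ahom B Y),
    [/\ acomp p1 i1 = aidm X, acomp p2 i2 = aidm Y, acomp p1 i2 = 0,
        acomp p2 i1 = 0 & acomp i1 p1 + acomp i2 p2 = aidm B] }.
End Linear.

Definition cat_of (k : comPzRingType) (C : AdditiveCat k) : Category := {|
  obj := C;
  hom X Y := @ahom k C X Y;
  heq X Y f g := f = g;
  idm X := @aidm k C X;
  comp X Y Z g f := @acomp k C X Y Z g f;
  heq_equiv X Y := eq_equivalence;
  comp_heq X Y Z g g' f f' Hg Hf := f_equal2 (@acomp k C X Y Z) Hg Hf;
  compA := @acompA k C;
  comp1f := @acomp1f k C;
  compf1 := @acompf1 k C |}.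
Coercion cat_of : AdditiveCat >-> Category.

Arguments ahom {k C} X Y : rename.
Arguments aidm {k C} X : rename.
Arguments acomp {k C X Y Z} g f : rename.
Notation "g ⋅ f" := (acomp g f) (at level 40, left associativity) : cat_scope.

Section AdditiveTheory.
Local Open Scope ring_scope.
Context {k : comPzRingType} {C : AdditiveCat k}.
Implicit Types X Y Z : C.

Lemma acompDl X Y Z (g g' : ahom Y Z) (f : ahom X Y) :
  (g + g') ⋅ f = g ⋅ f + g' ⋅ f.
Proof. by rewrite -[g in LHS]scale1r acomp_linl scale1r. Qed.

Lemma acompDr X Y Z (g : ahom Y Z) (f f' : ahom X Y) :
  g ⋅ (f + f') = g ⋅ f + g ⋅ f'.
Proof. by rewrite -[f in LHS]scale1r acomp_linr scale1r. Qed.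

Lemma acomp0f X Y Z (f : ahom X Y) : (0 : ahom Y Z) ⋅ f = 0.
Proof. by apply: (addrI (0 ⋅ f)); rewrite -acompDl !addr0. Qed.

Lemma acompf0 X Y Z (g : ahom Y Z) : g ⋅ (0 : ahom X Y) = 0.
Proof. by apply: (addrI (g ⋅ 0)); rewrite -acompDr !addr0. Qed.

Lemma acompNl X Y Z (g : ahom Y Z) (f : ahom X Y) : (- g) ⋅ f = - (g ⋅ f).
Proof. by apply: (addrI (g ⋅ f)); rewrite -acompDl !subrr acomp0f. Qed.

Lemma acompNr X Y Z (g : ahom Y Z) (f : ahom X Y) : g ⋅ (- f) = - (g ⋅ f).
Proof. by apply: (addrI (g ⋅ f)); rewrite -acompDr !subrr acompf0. Qed.

Lemma acompBl X Y Z (g g' : ahom Y Z) (f : ahom X Y) :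
  (g - g') ⋅ f = g ⋅ f - g' ⋅ f.
Proof. by rewrite acompDl acompNl. Qed.

Lemma acompBr X Y Z (g : ahom Y Z) (f f' : ahom X Y) :
  g ⋅ (f - f') = g ⋅ f - g ⋅ f'.
Proof. by rewrite acompDr acompNr. Qed.

Definition is_kernel X Y Z (i : ahom X Y) (p : ahom Y Z) : Prop :=
  p ⋅ i = 0 /\
  forall (A : C) (a : ahom A Y), p ⋅ a = 0 ->
    exists b : ahom A X, i ⋅ b = a /\ forall b', i ⋅ b' = a -> b' = b.

Definition is_cokernel X Y Z (i : ahom X Y) (p : ahom Y Z) : Prop :=
  p ⋅ i = 0 /\
  forall (A : C) (a : ahom Y A), a ⋅ i = 0 ->
    exists b : ahom Z A, b ⋅ p = a /\ forall b', b' ⋅ p = a -> b' = b.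

End AdditiveTheory.

Definition has_kernels (k : comPzRingType) (C : AdditiveCat k) : Prop :=
  forall (Y Z : C) (p : ahom Y Z), exists (X : C) (i : ahom X Y), is_kernel i p.

Definition has_cokernels (k : comPzRingType) (C : AdditiveCat k) : Prop :=
  forall (X Y : C) (i : ahom X Y), exists (Z : C) (p : ahom Y Z), is_cokernel i p.

Definition ConflationClass (k : comPzRingType) (C : AdditiveCat k) :=
  forall X Y Z : C, ahom X Y -> ahom Y Z -> Prop.

Definition inflation_of (k : comPzRingType) (C : AdditiveCat k)
  (E : ConflationClass C) (X Y : C) (i : ahom X Y) : Prop :=
  exists (Z : C) (p : ahom Y Z), E X Y Z i p.

Definition deflation_of (k : comPzRingType) (C : AdditiveCat k)
  (E : ConflationClass C) (Y Z : C) (p : ahom Y Z) : Prop :=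
  exists (X : C) (i : ahom X Y), E X Y Z i p.

Record exact_structure (k : comPzRingType) (C : AdditiveCat k)
  (E : ConflationClass C) : Prop := {
  ex_kernel : forall X Y Z (i : ahom X Y) (p : ahom Y Z),
    E X Y Z i p -> is_kernel i p;
  ex_cokernel : forall X Y Z (i : ahom X Y) (p : ahom Y Z),
    E X Y Z i p -> is_cokernel i p;
  ex_iso : forall X Y Z (i : ahom X Y) (p : ahom Y Z)
      X' Y' Z' (i' : ahom X' Y') (p' : ahom Y' Z')
      (x : ahom X X') (y : ahom Y Y') (z : ahom Z Z'),
    E X Y Z i p -> @is_iso C _ _ x -> @is_iso C _ _ y -> @is_iso C _ _ z ->
    y ⋅ i = i' ⋅ x -> z ⋅ p = p' ⋅ y -> E X' Y' Z' i' p';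
  ex_infl_id : forall X : C, inflation_of E (aidm X);
  ex_defl_id : forall X : C, deflation_of E (aidm X);
  ex_infl_comp : forall (X Y Z : C) (j : ahom Y Z) (i : ahom X Y),
    inflation_of E i -> inflation_of E j -> inflation_of E (j ⋅ i);
  ex_defl_comp : forall (X Y Z : C) (q : ahom Y Z) (p : ahom X Y),
    deflation_of E p -> deflation_of E q -> deflation_of E (q ⋅ p);
  ex_infl_pushout : forall (X Y X' : C) (i : ahom X Y) (f : ahom X X'),
    inflation_of E i -> exists (Y' : C) (g : ahom Y Y') (i' : ahom X' Y'),
      @is_pushout C _ _ _ _ i f g i' /\ inflation_of E i';
  ex_defl_pullback : forall (Y Z Z' : C) (p : ahom Y Z) (f : ahom Z' Z),
    deflation_of E p -> exists (Y' : C) (g : ahom Y' Y) (p' : ahom Y' Z'),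
      @is_pullback C _ _ _ _ p f g p' /\ deflation_of E p' }.

Record ExactCat (k : comPzRingType) := {
  ex_add :> AdditiveCat k;
  conflation : ConflationClass ex_add;
  ex_str : exact_structure conflation }.

Arguments conflation {k C X Y Z} i p : rename.

Section ExactTheory.
Context {k : comPzRingType} {C : ExactCat k}.

Definition inflation (X Y : C) (i : ahom X Y) := inflation_of (@conflation k C) i.
Definition deflation (Y Z : C) (p : ahom Y Z) := deflation_of (@conflation k C) p.

Definition injective_obj (J : C) : Prop :=
  forall (X Y : C) (i : ahom X Y), inflation i ->
    forall f : ahom X J, exists g : ahom Y J, g ⋅ i = f.

Definition projective_obj (P : C) : Prop :=
  forall (Y Z : C) (p : ahom Y Z), deflation p ->
    forall f : ahom P Z, exists g : ahom P Y, p ⋅ g = f.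
End ExactTheory.

Record exact_functor (k : comPzRingType) (C D : ExactCat k)
  (F : Functor C D) : Prop := {
  exf_add : forall (X Y : C) (f g : ahom X Y),
    fmap F (f + g)%R = (fmap F f + fmap F g :> @ahom k D (F X) (F Y))%R;
  exf_conflation : forall (X Y Z : C) (i : ahom X Y) (p : ahom Y Z),
    conflation i p -> @conflation k D (F X) (F Y) (F Z) (fmap F i) (fmap F p) }.

Record FrobeniusCat (k : comPzRingType) := {
  fr_ex :> ExactCat k;
  fr_enough_inj : forall X : fr_ex, exists (J : fr_ex) (i : ahom X J),
    injective_obj J /\ inflation i;
  fr_enough_proj : forall X : fr_ex, exists (P : fr_ex) (p : ahom P X),
    projective_obj P /\ deflation p;
  fr_inj_proj : forall X : fr_ex, injective_obj X <-> projective_obj X }.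

(* The fixed conflations X -> IX -> SX and S^-1 X -> PX -> X. *)
Record Resolutions (k : comPzRingType) (C : FrobeniusCat k) := {
  rI : C -> C;
  rS : C -> C;
  rP : C -> C;
  rSV : C -> C;
  rI_in : forall X, ahom X (rI X);
  rI_out : forall X, ahom (rI X) (rS X);
  rP_in : forall X, ahom (rSV X) (rP X);
  rP_out : forall X, ahom (rP X) X;
  rI_conf : forall X, conflation (rI_in X) (rI_out X);
  rP_conf : forall X, conflation (rP_in X) (rP_out X);
  rI_inj : forall X, injective_obj (rI X);
  rP_proj : forall X, projective_obj (rP X) }.

(** ** The stable category *)

Section Stable.
Local Open Scope ring_scope.
Context {k : comPzRingType} (C : FrobeniusCat k).
Implicit Types X Y Z : C.

Definition stably_zero X Y (f : ahom X Y) : Prop :=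
  exists (J : C) (u : ahom X J) (v : ahom J Y),
    (injective_obj J /\ projective_obj J) /\ f = v ⋅ u.

Definition stably_eq X Y (f g : ahom X Y) : Prop := stably_zero (f - g).

Lemma injective_biprod (J J' : C) : injective_obj J -> injective_obj J' ->
  exists (B : C) (i1 : ahom J B) (i2 : ahom J' B) (p1 : ahom B J)
    (p2 : ahom B J'), [/\ injective_obj B, p1 ⋅ i1 = aidm J, p2 ⋅ i2 = aidm J',
      p1 ⋅ i2 = 0 & p2 ⋅ i1 = 0].
Proof.
move=> HJ HJ'; have [B [i1 [i2 [p1 [p2 [E1 E2 E3 E4 E5]]]]]] := biprod J J'.
exists B, i1, i2, p1, p2; split=> // X Y i Hi f.
have [g1 H1] := HJ _ _ _ Hi (p1 ⋅ f); have [g2 H2] := HJ' _ _ _ Hi (p2 ⋅ f).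
exists (i1 ⋅ g1 + i2 ⋅ g2).
by rewrite acompDl -!acompA H1 H2 !acompA -acompDl E5 acomp1f.
Qed.

Lemma stably_zero0 X Y : stably_zero (0 : ahom X Y).
Proof.
have [J [i [HJ _]]] := fr_enough_inj X; exists J, i, 0.
by split; [split=> //; apply/fr_inj_proj|rewrite acomp0f].
Qed.

Lemma stably_zeroD X Y (f g : ahom X Y) :
  stably_zero f -> stably_zero g -> stably_zero (f + g).
Proof.
move=> [J [u [v [[HJ _] ->]]]] [J' [u' [v' [[HJ' _] ->]]]].
have [B [i1 [i2 [p1 [p2 [HB E1 E2 E3 E4]]]]]] := injective_biprod HJ HJ'.
exists B, (i1 ⋅ u + i2 ⋅ u'), (v ⋅ p1 + v' ⋅ p2); split.
  by split=> //; apply/fr_inj_proj.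
rewrite acompDl !acompDr -!acompA !(acompA p1) !(acompA p2) E1 E2 E3 E4.
by rewrite !acomp1f !acomp0f !acompf0 addr0 add0r.
Qed.

Lemma stably_zeroN X Y (f : ahom X Y) : stably_zero f -> stably_zero (- f).
Proof.
by move=> [J [u [v [HJ ->]]]]; exists J, u, (- v); rewrite acompNl.
Qed.

Lemma stably_zeroMl X Y Z (g : ahom Y Z) (f : ahom X Y) :
  stably_zero f -> stably_zero (g ⋅ f).
Proof.
by move=> [J [u [v [HJ ->]]]]; exists J, u, (g ⋅ v); rewrite acompA.
Qed.

Lemma stably_zeroMr X Y Z (g : ahom Y Z) (f : ahom X Y) :
  stably_zero g -> stably_zero (g ⋅ f).
Proof.
by move=> [J [u [v [HJ ->]]]]; exists J, (u ⋅ f), v; rewrite acompA.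
Qed.

Lemma eq_stably_eq X Y (f g : ahom X Y) : f = g -> stably_eq f g.
Proof. by move=> ->; rewrite /stably_eq subrr; exact: stably_zero0. Qed.

Lemma stably_eq_equiv X Y : Equivalence (@stably_eq X Y).
Proof.
split.
- by move=> f; rewrite /stably_eq subrr; exact: stably_zero0.
- by move=> f g H; rewrite /stably_eq -opprB; exact: stably_zeroN.
- move=> f g h H K; rewrite /stably_eq -(subrK g f) -addrA.
  exact: stably_zeroD.
Qed.

Lemma stably_eq_comp X Y Z (g g' : ahom Y Z) (f f' : ahom X Y) :
  stably_eq g g' -> stably_eq f f' -> stably_eq (g ⋅ f) (g' ⋅ f').
Proof.
move=> Hg Hf; rewrite /stably_eq -(subrK (g' ⋅ f) (g ⋅ f)) -addrA.
by rewrite -acompBl -acompBr; apply: stably_zeroD;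
  [exact: stably_zeroMr|exact: stably_zeroMl].
Qed.

Definition Stable : Category.
Proof.
refine {| obj := C; hom X Y := @ahom k C X Y; heq := stably_eq;
  idm X := @aidm k C X; comp X Y Z g f := @acomp k C X Y Z g f |}.
- exact: stably_eq_equiv.
- exact: stably_eq_comp.
- abstract (by move=> W X Y Z h g f; apply: eq_stably_eq; rewrite acompA).
- abstract (by move=> X Y f; apply: eq_stably_eq; rewrite acomp1f).
- abstract (by move=> X Y f; apply: eq_stably_eq; rewrite acompf1).
Defined.

Definition stableQ : Functor C Stable.
Proof.
refine (@Build_Functor C Stable (fun X => X) (fun X Y f => f) _ _ _).
- abstract (by move=> X Y f g; exact: eq_stably_eq).
- abstract (by move=> X; exact: eq_stably_eq).
- abstract (by move=> X Y Z g f; exact: eq_stably_eq).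
Defined.

Definition stable_iso X Y (f : ahom X Y) : Prop := @is_iso Stable X Y f.

(* Two extensions of stably equal morphisms to conflations with injective
   middle terms induce stably equal morphisms on the cokernels. *)
Lemma stable_extension X J Z X' J' Z' (i : ahom X J) (p : ahom J Z)
    (i' : ahom X' J') (p' : ahom J' Z') (a1 a2 : ahom X X') (b1 b2 : ahom J J')
    (c1 c2 : ahom Z Z') :
  conflation i p -> conflation i' p' -> injective_obj J' -> 
  b1 ⋅ i = i' ⋅ a1 -> b2 ⋅ i = i' ⋅ a2 ->
  c1 ⋅ p = p' ⋅ b1 -> c2 ⋅ p = p' ⋅ b2 -> stably_eq a1 a2 -> stably_eq c1 c2.
Proof.
move=> Hc Hc' HJ' Hb1 Hb2 Hc1 Hc2 [T [u [v [[HT HT'] Ha]]]].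
have [K1 K2] := ex_cokernel (ex_str C) Hc.
have [K1' _] := ex_cokernel (ex_str C) Hc'.
have [|w Hw] := HT _ _ i _ u; first by exists Z, p.
have [|d [Hd _]] := K2 _ ((b1 - b2) - i' ⋅ v ⋅ w).
  rewrite !acompBl Hb1 Hb2 -acompBr Ha -!acompA Hw -!acompBr.
  by rewrite subrr !acompf0.
exists J', d, p'; split; first by split=> //; exact: (fr_inj_proj J').1.
have [|e [_ He]] := K2 _ ((c1 - c2) ⋅ p).
  by rewrite -acompA K1 acompf0.
rewrite (He _ erefl); apply/esym/He.
by rewrite -acompA Hd !acompBr !acompA K1' !acomp0f subr0 acompBl Hc1 Hc2.
Qed.

End Stable.

Section Shift.
Local Open Scope ring_scope.
Context {k : comPzRingType} {C : FrobeniusCat k} (r : Resolutions C).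
Implicit Types X Y Z : C.

Definition shift_spec X Y (f : ahom X Y) (g : ahom (rS r X) (rS r Y)) : Prop :=
  exists b : ahom (rI r X) (rI r Y),
    b ⋅ rI_in r X = rI_in r Y ⋅ f /\ g ⋅ rI_out r X = rI_out r Y ⋅ b.

Lemma shift_ex X Y (f : ahom X Y) : exists g, shift_spec f g.
Proof.
have [|b Hb] := @rI_inj _ _ r Y _ _ (rI_in r X) _ (rI_in r Y ⋅ f).
  by exists (rS r X), (rI_out r X); exact: rI_conf.
have [_ K] := ex_cokernel (ex_str C) (rI_conf r X).
have [K' _] := ex_cokernel (ex_str C) (rI_conf r Y).
have [|g [Hg _]] := K _ (rI_out r Y ⋅ b).
  by rewrite -acompA Hb acompA K' acomp0f.
by exists g, b.
Qed.

Definition shift_map X Y (f : ahom X Y) : ahom (rS r X) (rS r Y) :=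
  projT1 (cid (shift_ex f)).

Lemma shift_mapP X Y (f : ahom X Y) : shift_spec f (shift_map f).
Proof. exact: projT2 (cid (shift_ex f)). Qed.

Lemma shift_unique X Y (f f' : ahom X Y) g g' :
  shift_spec f g -> shift_spec f' g' -> stably_eq f f' -> stably_eq g g'.
Proof.
move=> [b [H1 H2]] [b' [H1' H2']].
by apply: stable_extension H1 H1' H2 H2';
  [exact: rI_conf|exact: rI_conf|exact: rI_inj].
Qed.

Definition shift : Functor (Stable C) (Stable C).
Proof.
refine (@Build_Functor (Stable C) (Stable C) (rS r) shift_map _ _ _).
- abstract (move=> X Y f g;
    exact: shift_unique (shift_mapP f) (shift_mapP g)).
- abstract (move=> X; apply: (shift_unique (shift_mapP _)) (eq_stably_eq erefl);
    by exists (aidm _); rewrite !acomp1f !acompf1).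
- abstract (move=> X Y Z g f;
    apply: (shift_unique (shift_mapP _)) (eq_stably_eq erefl);
    have [b [H1 H2]] := shift_mapP f; have [b' [H1' H2']] := shift_mapP g;
    exists (b' ⋅ b); rewrite -!acompA H1 !acompA H1'; split=> //;
    by rewrite -acompA H2 !acompA H2').
Defined.

End Shift.

(** * Triangulated categories *)

(* The data compared by triangle functors: a shift functor and a class of
   distinguished triangles X -> Y -> Z -> shift X. *)
Record TriCat := {
  tc_cat :> Category;
  tc_shift : Functor tc_cat tc_cat;
  distinguished : forall X Y Z : tc_cat,
    hom X Y -> hom Y Z -> hom Z (tc_shift X) -> Prop;
  distinguished_heq : forall (X Y Z : tc_cat) (f f' : hom X Y) (g g' : hom Y Z)
      (h h' : hom Z (tc_shift X)),
    f ≈ f' -> g ≈ g' -> h ≈ h' -> distinguished f g h -> distinguished f' g' h' }.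

Arguments tc_shift : clear implicits.
Arguments distinguished {t X Y Z} f g h.

Definition preserves_finite_products (C D : Category) (F : Functor C D) : Prop :=
  (forall T : C, is_terminal T -> is_terminal (F T)) /\
  (forall (X Y P : C) (p : hom P X) (q : hom P Y),
    is_product p q -> is_product (fmap F p) (fmap F q)).

(* Between additive categories, additivity amounts to the preservation of
   finite products; in this form it needs no choice of a sum of morphisms. *)
Record TriFunctor (A B : TriCat) (F : Functor A B) := {
  tf_shift :> NatIso (F ∘F tc_shift A) (tc_shift B ∘F F);
  tf_add : preserves_finite_products F;
  tf_distinguished : forall (X Y Z : A) (f : hom X Y) (g : hom Y Z)
      (h : hom Z (tc_shift A X)),
    distinguished f g h ->
    @distinguished B (F X) (F Y) (F Z) (fmap F f) (fmap F g)
      (tf_shift X ∘ fmap F h) }.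

Lemma is_iso_id (C : Category) (X : C) : is_iso (idm X).
Proof. by exists (idm X); rewrite comp1f; split. Qed.

Lemma is_iso_comp (C : Category) (X Y Z : C) (g : hom Y Z) (f : hom X Y) :
  is_iso g -> is_iso f -> is_iso (g ∘ f).
Proof.
move=> [g' [G1 G2]] [f' [F1 F2]]; exists (f' ∘ g'); split.
- by rewrite -compA (compA g') G1 comp1f F1.
- by rewrite -compA (compA f) F2 comp1f G2.
Qed.

Lemma is_iso_fmap (C D : Category) (F : Functor C D) (X Y : C) (f : hom X Y) :
  is_iso f -> is_iso (fmap F f).
Proof.
move=> [g [G1 G2]]; exists (fmap F g).
by rewrite -!fmap_comp -!fmap_id; split; apply: fmap_heq.
Qed.

Definition shift_id (A : TriCat) :
  NatIso (Fid A ∘F tc_shift A) (tc_shift A ∘F Fid A).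
Proof.
refine (@Build_NatIso _ _ _ _ (@Build_NatTrans _ _ (Fid A ∘F tc_shift A)
  (tc_shift A ∘F Fid A) (fun X => idm (tc_shift A X)) _)
  (fun X => is_iso_id (tc_shift A X))).
abstract (by move=> X Y f /=; rewrite comp1f compf1).
Defined.

Definition tri_id (A : TriCat) : TriFunctor (Fid A).
Proof.
refine (@Build_TriFunctor A A (Fid A) (shift_id A) _ _) => //.
by move=> X Y Z f g h; apply: distinguished_heq => //=; rewrite comp1f.
Defined.

Definition shift_comp (A B C : TriCat) (G : Functor B C) (F : Functor A B)
  (tG : TriFunctor G) (tF : TriFunctor F) :
  NatIso ((G ∘F F) ∘F tc_shift A) (tc_shift C ∘F (G ∘F F)).
Proof.
refine (@Build_NatIso _ _ _ _ (@Build_NatTrans _ _ ((G ∘F F) ∘F tc_shift A)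
  (tc_shift C ∘F (G ∘F F)) (fun X => tG (F X) ∘ fmap G (tF X)) _)
  (fun X => is_iso_comp (ni_iso tG (F X)) (is_iso_fmap G (ni_iso tF X)))).
abstract (move=> X Y f; rewrite /= -compA -fmap_comp (nt_nat tF f) fmap_comp;
  by rewrite !compA (nt_nat tG (fmap F f))).
Defined.

Definition tri_comp (A B C : TriCat) (G : Functor B C) (F : Functor A B)
  (tG : TriFunctor G) (tF : TriFunctor F) : TriFunctor (G ∘F F).
Proof.
refine (@Build_TriFunctor A C (G ∘F F) (shift_comp tG tF) _ _).
- have [G1 G2] := tf_add tG; have [F1 F2] := tf_add tF; split.
  + by move=> T HT; apply: G1; exact: F1.
  + by move=> X Y P p q H; apply: G2; exact: F2.
- move=> X Y Z f g h H.
  have := tf_distinguished tG (tf_distinguished tF H).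
  by apply: distinguished_heq => //=; rewrite fmap_comp compA.
Defined.

Record TriNatIso (A B : TriCat) (F G : Functor A B) (tF : TriFunctor F)
  (tG : TriFunctor G) := {
  tn_iso :> NatIso F G;
  tn_shift : forall X,
    fmap (tc_shift B) (tn_iso X) ∘ tF X ≈ tG X ∘ tn_iso (tc_shift A X) }.

Section LocTri.
Local Open Scope ring_scope.
Context {k : comPzRingType} {C : FrobeniusCat k} (r : Resolutions C).
Implicit Types (X Y Z : C) (W : MorClass C).

(* The classes whose localization is a triangle quotient of Stable C. *)
Record stable_class W : Prop := {
  sc_iso : forall X Y (f : ahom X Y), stable_iso f -> W X Y f;
  sc_shift : forall X Y (f : ahom X Y), W X Y f -> W _ _ (shift_map r f) }.

Lemma loc_stably_eq W X Y (f g : ahom X Y) : stable_class W ->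
  stably_eq f g ->
  @fmap _ _ (locQ W) X Y f ≈ @fmap _ _ (locQ W) X Y g.
Proof.
move=> HW [J [u [v [HJ Hfg]]]].
have [B [i1 [i2 [p1 [p2 [E1 E2 E3 E4 E5]]]]]] := biprod X J.
have Wp : W _ _ p1.
  apply: sc_iso => //; exists i1; split; last exact: eq_stably_eq.
  apply: (Equivalence_Symmetric (Equivalence := stably_eq_equiv B B)).
  by exists J, p2, i2; split=> //; rewrite /= -E5 addrC addKr.
have [w [Hw _]] := @locQ_inverts C W B X p1 Wp.
have Hs (s : ahom X B) : p1 ⋅ s = aidm X -> @fmap _ _ (locQ W) X B s ≈ w.
  move=> Hs; rewrite -[X in X ≈ _]comp1f -Hw -compA -fmap_comp.
  by rewrite [X in fmap _ X]/= Hs fmap_id compf1.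
pose h : ahom B Y := g ⋅ p1 + v ⋅ p2.
have Hg : g = h ⋅ i1.
  by rewrite /h acompDl -!acompA E1 E4 acompf1 acompf0 addr0.
have Hf : f = h ⋅ (i1 + i2 ⋅ u).
  rewrite acompDr -Hg /h acompDl -!acompA (acompA p1) E3 acomp0f acompf0.
  by rewrite add0r (acompA p2) E2 acomp1f -Hfg addrC subrK.
rewrite Hf [X in _ ≈ fmap _ X]Hg.
rewrite (@fmap_comp _ _ (locQ W) X B Y h (i1 + i2 ⋅ u)).
rewrite (@fmap_comp _ _ (locQ W) X B Y h i1) !Hs //.
by rewrite acompDr acompA E1 E3 acomp0f addr0.
Qed.

Section Quotient.
Context {W : MorClass C} (HW : stable_class W).

Definition stable_loc : Functor (Stable C) (Loc W).
Proof.
refine (@Build_Functor (Stable C) (Loc W) (fun X => X)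
  (fun X Y f => @fmap _ _ (locQ W) X Y f) _ _ _).
- abstract (by move=> X Y f g; exact: loc_stably_eq).
- abstract (by move=> X; exact: (fmap_id (locQ W) X)).
- abstract (by move=> X Y Z g f; exact: (fmap_comp (locQ W) (g : @hom C Y Z) f)).
Defined.

Lemma shift_inverts : inverts W (stable_loc ∘F (shift r ∘F stableQ C)).
Proof. by move=> X Y w Ww; apply: (locQ_inverts (sc_shift HW Ww)). Qed.

Definition loc_shift : Functor (Loc W) (Loc W) := loc_lift shift_inverts.

(* e is the connecting morphism Z -> SX of the conflation X -i-> Y -p-> Z. *)
Definition connecting X Y Z (i : ahom X Y) (p : ahom Y Z)
  (e : ahom Z (rS r X)) : Prop :=
  exists a : ahom Y (rI r X),
    a ⋅ i = rI_in r X /\ e ⋅ p = rI_out r X ⋅ a.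

(* The triangles isomorphic to the image of a standard triangle. *)
Definition loc_distinguished (X Y Z : Loc W) (f : hom X Y) (g : hom Y Z)
  (h : hom Z (loc_shift X)) : Prop :=
  exists (X' Y' Z' : C) (i : ahom X' Y') (p : ahom Y' Z') (e : ahom Z' (rS r X'))
    (x : hom X (X' : Loc W)) (y : hom Y (Y' : Loc W)) (z : hom Z (Z' : Loc W)),
    [/\ conflation i p /\ connecting i p e,
        [/\ is_iso x, is_iso y & is_iso z],
        y ∘ f ≈ fmap stable_loc (i : @hom (Stable C) X' Y') ∘ x,
        z ∘ g ≈ fmap stable_loc (p : @hom (Stable C) Y' Z') ∘ y &
        fmap loc_shift x ∘ h
          ≈ fmap stable_loc (e : @hom (Stable C) Z' (rS r X')) ∘ z].

Lemma loc_distinguished_heq (X Y Z : Loc W) (f f' : hom X Y) (g g' : hom Y Z)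
    (h h' : hom Z (loc_shift X)) :
  f ≈ f' -> g ≈ g' -> h ≈ h' ->
  loc_distinguished f g h -> loc_distinguished f' g' h'.
Proof.
move=> Hf Hg Hh [X' [Y' [Z' [i [p [e [x [y [z [H1 H2 H3 H4 H5]]]]]]]]]].
exists X', Y', Z', i, p, e, x, y, z; split=> //.
- by rewrite -Hf.
- by rewrite -Hg.
- by rewrite -Hh.
Qed.

(* C[W^-1] as a triangle quotient of the stable category *)
Definition loc_tri : TriCat :=
  {| tc_cat := Loc W; distinguished_heq := loc_distinguished_heq |}.

End Quotient.
End LocTri.

(* The morphisms sent by F to stable isomorphisms: W_C for F := R and W_D for
   F := L. *)
Definition stable_iso_class (k : comPzRingType) (C D : FrobeniusCat k)
  (F : Functor C D) : MorClass C :=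
  fun X Y f => @stable_iso k D (F X) (F Y) (fmap F f).

Section AdjointClasses.
Local Open Scope ring_scope.
Context {k : comPzRingType}.

Lemma exact_functor_sub (C D : FrobeniusCat k) (F : Functor C D) :
  exact_functor F -> forall (X Y : C) (f g : ahom X Y),
  fmap F (f - g) = (fmap F f - fmap F g :> @ahom k D (F X) (F Y)).
Proof.
move=> HF X Y f g; have H := exf_add HF (f - g) g.
by rewrite subrK in H; rewrite H addrK.
Qed.

Lemma stable_iso_extension (C : FrobeniusCat k) (X J Z X' J' Z' : C)
    (i : ahom X J) (p : ahom J Z) (i' : ahom X' J') (p' : ahom J' Z')
    (a : ahom X X') (b : ahom J J') (c : ahom Z Z') :
  conflation i p -> conflation i' p' -> injective_obj J -> injective_obj J' ->
  b ⋅ i = i' ⋅ a -> c ⋅ p = p' ⋅ b -> stable_iso a -> stable_iso c.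
Proof.
move=> Hc Hc' HJ HJ' Hb Hcb [a' [A1 A2]].
have [|b' Hb'] := HJ _ _ i' _ (i ⋅ a'); first by exists Z', p'.
have [K _] := ex_cokernel (ex_str C) Hc.
have [_ K'] := ex_cokernel (ex_str C) Hc'.
have [|c' [Hc1 _]] := K' _ (p ⋅ b').
  by rewrite -acompA Hb' acompA K acomp0f.
exists c'; split.
- apply: (stable_extension Hc Hc HJ _ _ _ _ A1);
    [ | exact: etrans (acomp1f _) (esym (acompf1 _))
      | | exact: etrans (acomp1f _) (esym (acompf1 _)) ].
  + by instantiate (1 := b' ⋅ b); rewrite -acompA Hb acompA Hb' -acompA.
  + by rewrite -acompA Hcb acompA Hc1 -acompA.
- apply: (stable_extension Hc' Hc' HJ' _ _ _ _ A2);
    [ | exact: etrans (acomp1f _) (esym (acompf1 _))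
      | | exact: etrans (acomp1f _) (esym (acompf1 _)) ].
  + by instantiate (1 := b ⋅ b'); rewrite -acompA Hb' acompA Hb -acompA.
  + by rewrite -acompA Hc1 acompA Hcb -acompA.
Qed.

(* An exact functor preserving injective objects defines a class of morphisms
   whose localization is a triangle quotient. *)
Lemma stable_iso_stable_class (C D : FrobeniusCat k) (r : Resolutions C)
    (F : Functor C D) :
  exact_functor F -> (forall J : C, injective_obj J -> @injective_obj k D (F J)) ->
  stable_class r (stable_iso_class F).
Proof.
move=> HF HJ; split=> X Y f.
- have Hz (A B : C) (a b : ahom A B) :
      stably_eq a b -> @stably_eq k D (F A) (F B) (fmap F a) (fmap F b).
    move=> [J [u [v [[HJ1 HJ2] E]]]].
    exists (F J), (fmap F u), (fmap F v); split.
      by split; [|apply/fr_inj_proj]; exact: HJ.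
    rewrite -exact_functor_sub // E.
    exact: (fmap_comp F (v : @hom C J B) (u : @hom C A J)).
  have Hc (A B E : C) (b : ahom B E) (a : ahom A B) :
      @acomp k D _ _ _ (@fmap _ _ F B E b) (@fmap _ _ F A B a)
      = @fmap _ _ F A E (b ⋅ a).
    by symmetry; exact: (fmap_comp F (b : @hom C B E) (a : @hom C A B)).
  have Hi (A : C) : @aidm k D (F A) = @fmap _ _ F A A (aidm A).
    by symmetry; exact: (fmap_id F A).
  move=> [g [G1 G2]]; exists (@fmap _ _ F Y X g); split.
  + by rewrite /= Hc Hi; exact: (Hz _ _ _ _ G1).
  + by rewrite /= Hc Hi; exact: (Hz _ _ _ _ G2).
- have [b [H1 H2]] := shift_mapP r f.
  apply: (@stable_iso_extension D (F X) (F (rI r X)) _ (F Y) (F (rI r Y)) _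
    (fmap F (rI_in r X : @hom C _ _)) (fmap F (rI_out r X : @hom C _ _))
    (fmap F (rI_in r Y : @hom C _ _)) (fmap F (rI_out r Y : @hom C _ _)) _
    (fmap F (b : @hom C _ _)) _ (exf_conflation HF (rI_conf r X))
    (exf_conflation HF (rI_conf r Y))).
  + exact/HJ/rI_inj.
  + exact/HJ/rI_inj.
  + rewrite -[LHS](fmap_comp F) -[RHS](fmap_comp F); congr (fmap F _).
    exact: H1.
  + rewrite -[LHS](fmap_comp F) -[RHS](fmap_comp F); congr (fmap F _).
    exact: H2.
Qed.

Context {C D : FrobeniusCat k} {L : Functor D C} {R : Functor C D}.

Lemma right_adjoint_injective : Adjunction L R -> exact_functor L ->
  forall J : C, injective_obj J -> @injective_obj k D (R J).
Proof.
move=> adj HL J HJ X Y i [Z [p Hc]] f.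
pose f' : @hom C (L X) J := counit_of adj J ∘ fmap L (f : @hom D X (R J)).
have [|g Hg] := HJ (L X) (L Y) (fmap L (i : @hom D X Y)) _ f'.
  by exists (L Z), (fmap L (p : @hom D Y Z)); exact: exf_conflation.
exists (fmap R (g : @hom C (L Y) J) ∘ unit_of adj Y).
suff : (fmap R (g : @hom C (L Y) J) ∘ unit_of adj Y) ∘ (i : @hom D X Y) ≈ f.
  by [].
have Hi : unit_of adj Y ∘ (i : @hom D X Y)
  ≈ fmap R (fmap L (i : @hom D X Y)) ∘ unit_of adj X := nt_nat (unit_of adj) _.
have Hf : unit_of adj (R J) ∘ (f : @hom D X (R J))
    ≈ fmap R (fmap L (f : @hom D X (R J))) ∘ unit_of adj X :=
  nt_nat (unit_of adj) _.
rewrite -compA Hi compA -(fmap_comp R (g : @hom C (L Y) J)).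
have -> : (g : @hom C (L Y) J) ∘ fmap L (i : @hom D X Y) ≈ f' by exact: Hg.
by rewrite fmap_comp -compA -Hf compA triangle_R comp1f.
Qed.

Lemma left_adjoint_projective : Adjunction L R -> exact_functor R ->
  forall P : D, projective_obj P -> @projective_obj k C (L P).
Proof.
move=> adj HR P HP Y Z p [X [i Hc]] f.
pose f' : @hom D P (R Z) := fmap R (f : @hom C (L P) Z) ∘ unit_of adj P.
have [|g Hg] := HP (R Y) (R Z) (fmap R (p : @hom C Y Z)) _ f'.
  by exists (R X), (fmap R (i : @hom C X Y)); exact: exf_conflation.
exists (counit_of adj Y ∘ fmap L (g : @hom D P (R Y))).
suff : (p : @hom C Y Z) ∘ (counit_of adj Y ∘ fmap L (g : @hom D P (R Y))) ≈ f.
  by [].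
have Hp : counit_of adj Z ∘ fmap L (fmap R (p : @hom C Y Z))
  ≈ (p : @hom C Y Z) ∘ counit_of adj Y := nt_nat (counit_of adj) _.
have Hf : counit_of adj Z ∘ fmap L (fmap R (f : @hom C (L P) Z))
  ≈ (f : @hom C (L P) Z) ∘ counit_of adj (L P) := nt_nat (counit_of adj) _.
rewrite compA -Hp -compA -(fmap_comp L (fmap R (p : @hom C Y Z))).
have -> : fmap R (p : @hom C Y Z) ∘ (g : @hom D P (R Y)) ≈ f' by exact: Hg.
by rewrite fmap_comp compA Hf -compA triangle_L compf1.
Qed.

Context (adj : Adjunction L R) (HL : exact_functor L) (HR : exact_functor R).

Lemma left_adjoint_injective (J : D) : injective_obj J -> @injective_obj k C (L J).
Proof.
by move=> /fr_inj_proj HJ; apply/fr_inj_proj; exact: left_adjoint_projective.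
Qed.

Lemma stable_class_R (r : Resolutions C) : stable_class r (stable_iso_class R).
Proof. exact/stable_iso_stable_class/right_adjoint_injective. Qed.

Lemma stable_class_L (r : Resolutions D) : stable_class r (stable_iso_class L).
Proof. exact/stable_iso_stable_class/left_adjoint_injective. Qed.

End AdjointClasses.

(** * Model structures *)

Definition lifting (C : Category) (A B X Y : C) (i : hom A B) (p : hom X Y)
  : Prop :=
  forall (u : hom A X) (v : hom B Y), p ∘ u ≈ v ∘ i ->
    exists h : hom B X, h ∘ i ≈ u /\ p ∘ h ≈ v.

Definition retract_of (C : Category) (X Y A B : C) (f : hom X Y) (g : hom A B)
  : Prop :=
  exists (s : hom X A) (r : hom A X) (s' : hom Y B) (r' : hom B Y),
    [/\ r ∘ s ≈ idm X, r' ∘ s' ≈ idm Y, g ∘ s ≈ s' ∘ f & f ∘ r ≈ r' ∘ g].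

Definition two_out_of_three (C : Category) (W : MorClass C) : Prop :=
  forall (X Y Z : C) (f : hom X Y) (g : hom Y Z),
    [/\ W _ _ f -> W _ _ g -> W _ _ (g ∘ f),
        W _ _ f -> W _ _ (g ∘ f) -> W _ _ g &
        W _ _ g -> W _ _ (g ∘ f) -> W _ _ f].

Definition retract_closed (C : Category) (S : MorClass C) : Prop :=
  forall (X Y A B : C) (f : hom X Y) (g : hom A B),
    retract_of f g -> S _ _ g -> S _ _ f.

Record model_structure (C : Category) (W Cof Fib : MorClass C) : Prop := {
  ms_two_of_three : two_out_of_three W;
  ms_retract_W : retract_closed W;
  ms_retract_Cof : retract_closed Cof;
  ms_retract_Fib : retract_closed Fib;
  ms_lift_trivial_cof : forall (A B X Y : C) (i : hom A B) (p : hom X Y),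
    Cof _ _ i -> W _ _ i -> Fib _ _ p -> lifting i p;
  ms_lift_trivial_fib : forall (A B X Y : C) (i : hom A B) (p : hom X Y),
    Cof _ _ i -> Fib _ _ p -> W _ _ p -> lifting i p;
  ms_factor_trivial_cof : forall (X Y : C) (f : hom X Y),
    exists (Z : C) (i : hom X Z) (p : hom Z Y),
      [/\ f ≈ p ∘ i, Cof _ _ i, W _ _ i & Fib _ _ p];
  ms_factor_trivial_fib : forall (X Y : C) (f : hom X Y),
    exists (Z : C) (i : hom X Z) (p : hom Z Y),
      [/\ f ≈ p ∘ i, Cof _ _ i, Fib _ _ p & W _ _ p] }.

Definition model_category (C : Category) (W Cof Fib : MorClass C) : Prop :=
  [/\ has_finite_limits C, has_finite_colimits C & model_structure W Cof Fib].

Definition fibrant (C : Category) (Fib : MorClass C) (X : C) : Prop :=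
  exists (T : C) (f : hom X T), is_terminal T /\ Fib _ _ f.

Definition cofibrant (C : Category) (Cof : MorClass C) (X : C) : Prop :=
  exists (T : C) (f : hom T X), is_initial T /\ Cof _ _ f.

Record quillen_equivalence (C D : Category) (L : Functor D C) (R : Functor C D)
  (adj : Adjunction L R) (WC CofC FibC : MorClass C) (WD CofD FibD : MorClass D)
  : Prop := {
  qe_cof : preserves_class CofD CofC L;
  qe_trivial_cof : forall (X Y : D) (f : hom X Y),
    CofD _ _ f -> WD _ _ f -> CofC _ _ (fmap L f) /\ WC _ _ (fmap L f);
  qe_fib : preserves_class FibC FibD R;
  qe_trivial_fib : forall (X Y : C) (f : hom X Y),
    FibC _ _ f -> WC _ _ f -> FibD _ _ (fmap R f) /\ WD _ _ (fmap R f);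
  qe_transpose : forall (N : D) (M : C) (g : hom N (R M)),
    cofibrant CofD N -> fibrant FibC M ->
    (WC _ _ (counit_of adj M ∘ fmap L g) <-> WD _ _ g) }.

Section FrobeniusModel.
Context {k : comPzRingType} {C D : FrobeniusCat k}.
Context (L : Functor D C) (R : Functor C D).

(* The case of an inflation with cokernel LN is included: every morphism is a
   retract of itself. *)
Definition CofC : MorClass C := fun X Y f =>
  exists (A B : C) (i : ahom A B) (N : D) (p : ahom B (L N)),
    conflation i p /\ @retract_of C X Y A B f i.

Definition FibC (rC : Resolutions C) : MorClass C := fun X Y f =>
  forall N : D, @lifting C _ _ _ _ (0%R : ahom (zob C) (rP rC (L N))) f.

Definition FibD : MorClass D := fun X Y f =>
  exists (A B : D) (p : ahom A B) (M : C) (i : ahom (R M) A),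
    conflation i p /\ @retract_of D X Y A B f p.

Definition CofD (rD : Resolutions D) : MorClass D := fun X Y f =>
  forall M : C, @lifting D _ _ _ _ f (0%R : ahom (rI rD (R M)) (zob D)).

(* L(PN) is a projective presentation of LN and R(IM) an injective one of RM,
   so the fixed conflations can be chosen with PLN a direct summand of an
   object LN' and IRM a direct summand of an object RM'.  The classes FibC and
   CofD depend on this choice: if D = 0, W_C contains all morphisms and CofC
   consists of the isomorphisms, so that a nonzero P0 would make the morphism
   0 -> P0 have no factorization as a trivial cofibration followed by a
   fibration. *)
Definition direct_summand (E : Category) (X Y : E) : Prop :=
  exists (s : hom X Y) (r : hom Y X), r ∘ s ≈ idm X.

Definition adapted (rC : Resolutions C) (rD : Resolutions D) : Prop :=
  (forall N : D, exists N' : D, @direct_summand C (rP rC (L N)) (L N')) /\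
  (forall M : C, exists M' : C, @direct_summand D (rI rD (R M)) (R M')).

End FrobeniusModel.

(* The fixed conflations can always be chosen adapted. *)
Lemma adapted_exists (k : comPzRingType) (C D : FrobeniusCat k)
    (L : Functor D C) (R : Functor C D) :
  Adjunction L R -> exact_functor L -> exact_functor R ->
  exists (rC : Resolutions C) (rD : Resolutions D), adapted L R rC rD.
Proof.
move=> adj HL HR.
have HI (E : FrobeniusCat k) (X : E) : exists (J Z : E) (i : ahom X J)
    (p : ahom J Z), conflation i p /\ injective_obj J.
  by have [J [i [HJ [Z [p H]]]]] := fr_enough_inj X; exists J, Z, i, p.
have HP (E : FrobeniusCat k) (X : E) : exists (P K : E) (i : ahom K P)
    (p : ahom P X), conflation i p /\ projective_obj P.
  by have [P [p [HP' [K [i H]]]]] := fr_enough_proj X; exists P, K, i, p.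
have HPC (X : C) : exists (P K : C) (i : ahom K P) (p : ahom P X),
    (conflation i p /\ projective_obj P) /\
    forall N : D, L N = X -> exists N' : D, @direct_summand C P (L N').
  have [[N E]|H] := EM (exists N : D, L N = X).
    have [P [K [i [p [H1 H2]]]]] := HP D N; rewrite -E.
    exists (L P), (L K), (fmap L (i : @hom D K P)), (fmap L (p : @hom D P N)).
    split; first by split; [exact: exf_conflation|
      exact: (left_adjoint_projective adj HR)].
    by move=> _ _; exists P, (idm (L P)), (idm (L P)); rewrite comp1f.
  have [P [K [i [p HH]]]] := HP C X; exists P, K, i, p; split=> //.
  by move=> N E; case: H; exists N.
have HID (X : D) : exists (J Z : D) (i : ahom X J) (p : ahom J Z),
    (conflation i p /\ injective_obj J) /\
    forall M : C, R M = X -> exists M' : C, @direct_summand D J (R M').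
  have [[M E]|H] := EM (exists M : C, R M = X).
    have [J [Z [i [p [H1 H2]]]]] := HI C M; rewrite -E.
    exists (R J), (R Z), (fmap R (i : @hom C M J)), (fmap R (p : @hom C J Z)).
    split; first by split; [exact: exf_conflation|
      exact: (right_adjoint_injective adj HL)].
    by move=> _ _; exists J, (idm (R J)), (idm (R J)); rewrite comp1f.
  have [J [Z [i [p HH]]]] := HI D X; exists J, Z, i, p; split=> //.
  by move=> M E; case: H; exists M.
have mk (E : FrobeniusCat k) (SI SP : E -> E -> Prop) :
    (forall X, exists (J Z : E) (i : ahom X J) (p : ahom J Z),
      (conflation i p /\ injective_obj J) /\ SI X J) ->
    (forall X, exists (P K : E) (i : ahom K P) (p : ahom P X),
      (conflation i p /\ projective_obj P) /\ SP X P) ->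
    exists r : Resolutions E, forall X, SI X (rI r X) /\ SP X (rP r X).
  move=> H1 H2; move: (fun X => cid (H1 X)) => {H1} sI.
  pose sZ X := cid (projT2 (sI X)); pose si X := cid (projT2 (sZ X)).
  pose sp X := cid (projT2 (si X)).
  move: (fun X => cid (H2 X)) => {H2} tP.
  pose tK X := cid (projT2 (tP X)); pose ti X := cid (projT2 (tK X)).
  pose tp X := cid (projT2 (ti X)).
  unshelve eexists (@Build_Resolutions _ E (fun X => projT1 (sI X))
    (fun X => projT1 (sZ X)) (fun X => projT1 (tP X)) (fun X => projT1 (tK X))
    (fun X => projT1 (si X)) (fun X => projT1 (sp X)) (fun X => projT1 (ti X))
    (fun X => projT1 (tp X)) _ _ _ _).
  - by move=> X; exact: (projT2 (sp X)).1.1.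
  - by move=> X; exact: (projT2 (tp X)).1.1.
  - by move=> X; exact: (projT2 (sp X)).1.2.
  - by move=> X; exact: (projT2 (tp X)).1.2.
  - by move=> X; split; [exact: (projT2 (sp X)).2|exact: (projT2 (tp X)).2].
have [|rC HC] := mk C (fun _ _ => True) (fun X P =>
    forall N : D, L N = X -> exists N' : D, @direct_summand C P (L N')) _ HPC.
  by move=> X; have [J [Z [i [p H]]]] := HI C X; exists J, Z, i, p.
have [|rD HD] := mk D (fun X J =>
    forall M : C, R M = X -> exists M' : C, @direct_summand D J (R M'))
    (fun _ _ => True) HID.
  by move=> X; have [P [K [i [p H]]]] := HP D X; exists P, K, i, p.
exists rC, rD; split=> [N|M].
- exact: (HC (L N)).2.
- exact: (HD (R M)).1.
Qed.

(** * Derivable categories *)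

Record left_derivable (C : Category) (W Fib : MorClass C) : Prop := {
  ld_final : exists T : C, is_terminal T /\ fibrant Fib T;
  ld_fibrant_iso : forall (X Y : C) (f : hom X Y),
    is_iso f -> fibrant Fib X -> fibrant Fib Y;
  ld_iso_W : forall (X Y : C) (f : hom X Y), is_iso f -> W _ _ f;
  ld_two_of_three : two_out_of_three W;
  ld_iso_Fib : forall (X Y : C) (f : hom X Y),
    fibrant Fib X -> fibrant Fib Y -> is_iso f -> Fib _ _ f;
  ld_comp : forall (X Y Z : C) (f : hom X Y) (g : hom Y Z),
    fibrant Fib X -> fibrant Fib Y -> fibrant Fib Z ->
    Fib _ _ f -> Fib _ _ g -> Fib _ _ (g ∘ f);
  ld_pullback_ex : forall (X Y Y' : C) (p : hom X Y) (v : hom Y' Y),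
    fibrant Fib X -> fibrant Fib Y -> fibrant Fib Y' -> Fib _ _ p ->
    exists (X' : C) (u : hom X' X) (p' : hom X' Y'), is_pullback p v u p';
  ld_pullback_Fib : forall (X Y Y' X' : C) (p : hom X Y) (v : hom Y' Y)
      (u : hom X' X) (p' : hom X' Y'),
    fibrant Fib X -> fibrant Fib Y -> fibrant Fib Y' -> Fib _ _ p ->
    is_pullback p v u p' -> Fib _ _ p';
  ld_pullback_trivial : forall (X Y Y' X' : C) (p : hom X Y) (v : hom Y' Y)
      (u : hom X' X) (p' : hom X' Y'),
    fibrant Fib X -> fibrant Fib Y -> fibrant Fib Y' ->
    Fib _ _ p -> W _ _ p -> is_pullback p v u p' -> Fib _ _ p' /\ W _ _ p';
  ld_factor : forall (X Y : C) (f : hom X Y), fibrant Fib Y ->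
    exists (Z : C) (w : hom X Z) (p : hom Z Y),
      [/\ f ≈ p ∘ w, W _ _ w & Fib _ _ p] }.

Definition right_derivable (C : Category) (W Cof : MorClass C) : Prop :=
  left_derivable (op_class W) (op_class Cof).

Record relevant_derivable (C : Category) (W Cof Fib : MorClass C) : Prop := {
  rd_left : left_derivable W Fib;
  rd_right : right_derivable W Cof;
  rd_lifting : forall (A B X Y : C) (i : hom A B) (p : hom X Y),
    Cof _ _ i -> cofibrant Cof A -> Fib _ _ p -> fibrant Fib Y ->
    W _ _ i \/ W _ _ p -> lifting i p }.

(** * Derivators *)

Inductive is_identity (I : Category) : forall x y : I, hom x y -> Prop :=
| Is_identity (x : I) (f : hom x x) : f ≈ idm x -> is_identity f.

(* The simplices of the nerve, up to equality of morphisms. *)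
Inductive chain (I : Category) : I -> I -> Type :=
| chain0 (x : I) : chain x x
| chainS (x y z : I) : hom x y -> chain y z -> chain x z.

Inductive chain_eq (I : Category) : forall x y : I, chain x y -> chain x y -> Prop :=
| chain_eq0 (x : I) : chain_eq (chain0 x) (chain0 x)
| chain_eqS (x y z : I) (f f' : hom x y) (c c' : chain y z) :
    f ≈ f' -> chain_eq c c' -> chain_eq (chainS f c) (chainS f' c').

Fixpoint nondegenerate (I : Category) (x y : I) (c : chain x y) : Prop :=
  match c with
  | chain0 _ => True
  | chainS _ _ _ f c' => ~ is_identity f /\ nondegenerate c'
  end.

Definition finite_direct (I : Category) : Prop :=
  exists (n : nat) (s : 'I_n -> {x : I & {y : I & @chain I x y}}),
    forall (x y : I) (c : chain x y), nondegenerate c ->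
      exists i (c' : chain x y),
        s i = existT _ x (existT _ y c') /\ chain_eq c c'.

Record FiniteDirect := {
  fd_cat :> Category;
  fd_finite : finite_direct fd_cat }.

(* A contravariant pseudofunctor on finite direct categories. A 2-cell u => v
   acts contravariantly as well: v^* => u^*. *)
Record Prederivator := {
  pd_cat :> FiniteDirect -> Category;
  pd_pull : forall I J : FiniteDirect,
    Functor I J -> Functor (pd_cat J) (pd_cat I);
  pd_cell : forall (I J : FiniteDirect) (u v : Functor I J),
    NatTrans u v -> NatTrans (pd_pull v) (pd_pull u);
  pd_unit : forall I : FiniteDirect, NatIso (@pd_pull I I (Fid I)) (Fid (pd_cat I));
  pd_mul : forall (I J K : FiniteDirect) (v : Functor J K) (u : Functor I J),
    NatIso (@pd_pull I K (v ∘F u)) (pd_pull u ∘F pd_pull v);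
  pd_cell_heq : forall (I J : FiniteDirect) (u v : Functor I J)
      (a b : NatTrans u v) (X : pd_cat J),
    (forall i, a i ≈ b i) -> pd_cell a X ≈ pd_cell b X;
  pd_cell_id : forall (I J : FiniteDirect) (u : Functor I J) (X : pd_cat J),
    pd_cell (nt_id u) X ≈ idm _;
  pd_cell_comp : forall (I J : FiniteDirect) (u v w : Functor I J)
      (b : NatTrans v w) (a : NatTrans u v) (X : pd_cat J),
    pd_cell (nt_comp b a) X ≈ pd_cell a X ∘ pd_cell b X;
  pd_mul_whiskerL : forall (I J K : FiniteDirect) (v : Functor J K)
      (u u' : Functor I J) (a : NatTrans u u') (X : pd_cat K),
    pd_mul v u X ∘ pd_cell (whiskerL v a) X
      ≈ pd_cell a (pd_pull v X) ∘ pd_mul v u' X;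
  pd_mul_whiskerR : forall (I J K : FiniteDirect) (v v' : Functor J K)
      (b : NatTrans v v') (u : Functor I J) (X : pd_cat K),
    pd_mul v u X ∘ pd_cell (whiskerR b u) X
      ≈ fmap (pd_pull u) (pd_cell b X) ∘ pd_mul v' u X;
  pd_assoc : forall (I J K M : FiniteDirect) (w : Functor K M)
      (v : Functor J K) (u : Functor I J) (X : pd_cat M),
    fmap (pd_pull u) (pd_mul w v X) ∘ pd_mul (w ∘F v) u X
        ∘ pd_cell (fassoc w v u) X
      ≈ pd_mul v u (pd_pull w X) ∘ pd_mul w (v ∘F u) X;
  pd_unit_r : forall (I J : FiniteDirect) (u : Functor I J) (X : pd_cat J),
    pd_unit I (pd_pull u X) ∘ pd_mul u (Fid I) X ∘ pd_cell (frunit u) X ≈ idm _;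
  pd_unit_l : forall (I J : FiniteDirect) (u : Functor I J) (X : pd_cat J),
    fmap (pd_pull u) (pd_unit J X) ∘ pd_mul (Fid J) u X ∘ pd_cell (flunit u) X
      ≈ idm _ }.

Arguments pd_pull {p I J} u.
Arguments pd_cell {p I J u v} a.
Arguments pd_unit p I : clear implicits.
Arguments pd_mul p {I J K} v u.

(* Pseudonatural transformations *)
Record PdMor (A B : Prederivator) := {
  pm_fun :> forall I, Functor (A I) (B I);
  pm_iso : forall (I J : FiniteDirect) (u : Functor I J),
    NatIso (pd_pull u ∘F pm_fun J) (pm_fun I ∘F pd_pull u);
  pm_cell : forall (I J : FiniteDirect) (u v : Functor I J) (a : NatTrans u v)
      (X : A J),
    pm_iso u X ∘ pd_cell a (pm_fun J X)
      ≈ fmap (pm_fun I) (pd_cell a X) ∘ pm_iso v X;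
  pm_unit : forall I (X : A I),
    fmap (pm_fun I) (pd_unit A I X) ∘ pm_iso (Fid I) X
      ≈ pd_unit B I (pm_fun I X);
  pm_mul : forall (I J K : FiniteDirect) (v : Functor J K) (u : Functor I J)
      (X : A K),
    fmap (pm_fun I) (pd_mul A v u X) ∘ pm_iso (v ∘F u) X
      ≈ pm_iso u (pd_pull v X) ∘ fmap (pd_pull u) (pm_iso v X)
          ∘ pd_mul B v u (pm_fun K X) }.

Arguments pm_iso {A B} p {I J} u.

Lemma pm_nat (A B : Prederivator) (M : PdMor A B) (I J : FiniteDirect)
    (u : Functor I J) (X Y : A J) (f : hom X Y) :
  pm_iso M u Y ∘ fmap (pd_pull u) (fmap (M J) f)
    ≈ fmap (M I) (fmap (pd_pull u) f) ∘ pm_iso M u X.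
Proof. exact: (nt_nat (pm_iso M u) f). Qed.

(* Invertible modifications *)
Record PdIso (A B : Prederivator) (M N : PdMor A B) := {
  pi_iso :> forall I, NatIso (M I) (N I);
  pi_pull : forall (I J : FiniteDirect) (u : Functor I J) (X : A J),
    pm_iso N u X ∘ fmap (pd_pull u) (pi_iso J X)
      ≈ pi_iso I (pd_pull u X) ∘ pm_iso M u X }.

Definition pull_id (A : Prederivator) (I J : FiniteDirect) (u : Functor I J) :
  NatIso (pd_pull u ∘F Fid (A J)) (Fid (A I) ∘F pd_pull u).
Proof.
refine (@Build_NatIso _ _ _ _ (@Build_NatTrans _ _
  (pd_pull u ∘F Fid (A J)) (Fid (A I) ∘F pd_pull u)
  (fun X => idm (pd_pull u X)) _) (fun X => is_iso_id (pd_pull u X))).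
abstract (by move=> X Y f /=; rewrite comp1f compf1).
Defined.

Definition pm_id (A : Prederivator) : PdMor A A.
Proof.
refine (@Build_PdMor A A (fun I => Fid (A I)) (@pull_id A) _ _ _).
- by move=> I J u v a X /=; rewrite comp1f compf1.
- by move=> I X /=; rewrite compf1.
- by move=> I J K v u X /=; rewrite compf1 fmap_id !comp1f.
Defined.

Definition pull_comp (A B C : Prederivator) (N : PdMor B C) (M : PdMor A B)
  (I J : FiniteDirect) (u : Functor I J) :
  NatIso (pd_pull u ∘F (N J ∘F M J)) ((N I ∘F M I) ∘F pd_pull u).
Proof.
refine (@Build_NatIso _ _ _ _ (@Build_NatTrans _ _
  (pd_pull u ∘F (N J ∘F M J)) ((N I ∘F M I) ∘F pd_pull u)
  (fun X => fmap (N I) (pm_iso M u X) ∘ pm_iso N u (M J X)) _)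
  (fun X => is_iso_comp (is_iso_fmap (N I) (ni_iso (pm_iso M u) X))
    (ni_iso (pm_iso N u) (M J X)))).
abstract (move=> X Y f /=;
  rewrite -compA (pm_nat N u (fmap (M J) f)) !compA -!fmap_comp;
  by rewrite (pm_nat M u f)).
Defined.

Definition pm_comp (A B C : Prederivator) (N : PdMor B C) (M : PdMor A B) :
  PdMor A C.
Proof.
refine (@Build_PdMor A C (fun I => N I ∘F M I) (pull_comp N M) _ _ _).
- move=> I J u v a X /=.
  rewrite -compA (pm_cell N a (M J X)) !compA -!fmap_comp.
  by rewrite (pm_cell M a X).
- move=> I X /=.
  by rewrite compA -fmap_comp (pm_unit M X) (pm_unit N (M I X)).
- move=> I J K v u X /=.
  rewrite compA -fmap_comp (pm_mul M v u X) !fmap_comp -!compA.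
  rewrite (pm_mul N v u (M K X)) !compA.
  have H := @pm_nat _ _ N _ _ u (pd_pull v (M K X)) (M J (pd_pull v X))
    (pm_iso M v X).
  by rewrite -(compA _ _ (pm_iso N u _)) -H !compA.
Defined.

Section LocalizedDerivator.
Context {E : Category} (W : MorClass E).

Definition objectwise (I : Category) : MorClass (Fun (op I) E) :=
  fun F G a => forall i, W (a i).
Arguments objectwise I : clear implicits.

Definition dia (I : Category) : Category := Loc (objectwise I).

Definition precomp (I J : Category) (u : Functor I J) :
  Functor (Fun (op J) E) (Fun (op I) E).
Proof.
refine (@Build_Functor (Fun (op J) E) (Fun (op I) E)
  (fun X => X ∘F Fop u) (fun X Y a => whiskerR a (Fop u)) _ _ _).
- abstract (by move=> X Y a b H i; exact: H).
- abstract (by move=> X i).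
- abstract (by move=> X Y Z b a i).
Defined.

Lemma precomp_class (I J : Category) (u : Functor I J) :
  preserves_class (objectwise J) (objectwise I) (precomp u).
Proof. by move=> X Y a H i; exact: H. Qed.

Definition dia_pull (I J : Category) (u : Functor I J) :
  Functor (dia J) (dia I) := loc_map (precomp_class u).

Definition fun_cell (I J : Category) (u v : Functor I J) (a : NatTrans u v)
  (X : Functor (op J) E) : NatTrans (X ∘F Fop v) (X ∘F Fop u).
Proof.
refine (@Build_NatTrans _ _ (X ∘F Fop v) (X ∘F Fop u)
  (fun i => @fmap _ _ X (v i) (u i) (a i)) _).
abstract (move=> i j f /=; rewrite -!fmap_comp; apply: fmap_heq => /=;
  by symmetry; exact: nt_nat).
Defined.

Lemma locQ_square (C : Category) (S : MorClass C) (X Y Y' Z : C)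
    (b : hom Y Z) (a : hom X Y) (d : hom Y' Z) (c : hom X Y') :
  b ∘ a ≈ d ∘ c ->
  fmap (locQ S) b ∘ fmap (locQ S) a ≈ fmap (locQ S) d ∘ fmap (locQ S) c.
Proof. by move=> H; rewrite -!fmap_comp; apply: fmap_heq. Qed.

Lemma locQ_square3 (C : Category) (S : MorClass C) (X Y Y' Z T : C)
    (c : hom Z T) (b : hom Y Z) (a : hom X Y) (e : hom Y' T) (d : hom X Y') :
  c ∘ b ∘ a ≈ e ∘ d ->
  fmap (locQ S) c ∘ fmap (locQ S) b ∘ fmap (locQ S) a
    ≈ fmap (locQ S) e ∘ fmap (locQ S) d.
Proof. by move=> H; rewrite -!fmap_comp; apply: fmap_heq. Qed.

Definition dia_cell (I J : Category) (u v : Functor I J) (a : NatTrans u v) :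
  NatTrans (dia_pull v) (dia_pull u).
Proof.
apply: (@loc_nat _ _ (dia I) (dia_pull v) (dia_pull u)
  (fun X => fmap (locQ (objectwise I))
     (fun_cell a X : @hom (Fun (op I) E) (X ∘F Fop v) (X ∘F Fop u)))).
abstract (move=> X Y f; apply: (@locQ_square (Fun (op I) E) (objectwise I));
  by move=> i /=; rewrite nt_nat).
Defined.

(* The comparison morphisms between diagrams X ∘ (id)^op and X, and between
   X ∘ (v ∘ u)^op and (X ∘ v^op) ∘ u^op, have identity components. *)
Definition fun_unit (I : Category) (X : Functor (op I) E) :
  @hom (Fun (op I) E) (precomp (Fid I) X) X.
Proof.
refine (@Build_NatTrans _ _ (X ∘F Fop (Fid I)) X (fun i => idm (X i)) _).
abstract (by move=> i j f /=; rewrite comp1f compf1).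
Defined.

Definition fun_mul (I J K : Category) (v : Functor J K) (u : Functor I J)
  (X : Functor (op K) E) :
  @hom (Fun (op I) E) (precomp (v ∘F u) X) (precomp u (precomp v X)).
Proof.
refine (@Build_NatTrans _ _ (X ∘F Fop (v ∘F u)) ((X ∘F Fop v) ∘F Fop u)
  (fun i => idm (X (v (u i)))) _).
abstract (by move=> i j f /=; rewrite comp1f compf1).
Defined.

Lemma fun_unit_iso (I : Category) (X : Functor (op I) E) : is_iso (fun_unit X).
Proof.
unshelve eexists.
  refine (@Build_NatTrans _ _ X (X ∘F Fop (Fid I)) (fun i => idm (X i)) _).
  by move=> i j f /=; rewrite comp1f compf1.
by split=> i /=; rewrite comp1f.
Qed.

Lemma fun_mul_iso (I J K : Category) (v : Functor J K) (u : Functor I J)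
  (X : Functor (op K) E) : is_iso (fun_mul v u X).
Proof.
unshelve eexists.
  refine (@Build_NatTrans _ _ ((X ∘F Fop v) ∘F Fop u) (X ∘F Fop (v ∘F u))
    (fun i => idm (X (v (u i)))) _).
  by move=> i j f /=; rewrite comp1f compf1.
by split=> i /=; rewrite comp1f.
Qed.

Definition dia_unit (I : Category) : NatIso (dia_pull (Fid I)) (Fid (dia I)).
Proof.
refine (@Build_NatIso _ _ _ _ (@loc_nat _ _ _ (dia_pull (Fid I)) (Fid (dia I))
  (fun X => fmap (locQ (objectwise I)) (fun_unit X)) _)
  (fun X => is_iso_fmap (locQ (objectwise I)) (fun_unit_iso X))).
abstract (move=> X Y f; apply: (@locQ_square (Fun (op I) E) (objectwise I));
  by move=> i /=; rewrite comp1f compf1).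
Defined.

Definition dia_mul (I J K : Category) (v : Functor J K) (u : Functor I J) :
  NatIso (dia_pull (v ∘F u)) (dia_pull u ∘F dia_pull v).
Proof.
refine (@Build_NatIso _ _ _ _ (@loc_nat _ _ _ (dia_pull (v ∘F u))
    (dia_pull u ∘F dia_pull v)
  (fun X => @fmap _ _ (locQ (objectwise I)) (precomp (v ∘F u) X)
    (precomp u (precomp v X)) (fun_mul v u X)) _)
  (fun X => @is_iso_fmap _ _ (locQ (objectwise I)) (precomp (v ∘F u) X)
    (precomp u (precomp v X)) (fun_mul v u X) (fun_mul_iso v u X))).
abstract (move=> X Y f; apply: (@locQ_square (Fun (op I) E) (objectwise I)
    _ _ _ _ (fun_mul v u Y) (fmap (precomp (v ∘F u)) f)
    (fmap (precomp u) (fmap (precomp v) f)) (fun_mul v u X));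
  by move=> i /=; rewrite comp1f compf1).
Defined.

Lemma dia_pullE (I J : Category) (u : Functor I J) (X Y : Fun (op J) E)
    (a : hom X Y) :
  fmap (dia_pull u) (fmap (locQ (objectwise J)) a)
  = fmap (locQ (objectwise I)) (fmap (precomp u) a).
Proof. by []. Qed.

Lemma dia_cellE (I J : Category) (u v : Functor I J) (a : NatTrans u v)
    (X : Functor (op J) E) :
  dia_cell a X = @fmap _ _ (locQ (objectwise I)) (precomp v X) (precomp u X)
    (fun_cell a X).
Proof. by []. Qed.

Lemma dia_unitE (I : Category) (X : Functor (op I) E) :
  dia_unit I X = @fmap _ _ (locQ (objectwise I)) (precomp (Fid I) X) X
    (fun_unit X).
Proof. by []. Qed.

Lemma dia_mulE (I J K : Category) (v : Functor J K) (u : Functor I J)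
    (X : Functor (op K) E) :
  dia_mul v u X = @fmap _ _ (locQ (objectwise I)) (precomp (v ∘F u) X)
    (precomp u (precomp v X)) (fun_mul v u X).
Proof. by []. Qed.

(* The prederivator of a category with weak equivalences:
   I |-> Fun(I^op, E)[W_I^-1] *)
Definition derivator : Prederivator.
Proof.
refine (@Build_Prederivator dia dia_pull dia_cell dia_unit dia_mul
  _ _ _ _ _ _ _ _).
- move=> I J u v a b X H; rewrite !dia_cellE.
  by apply: (fmap_heq (locQ (objectwise I))) => i /=; apply: fmap_heq; exact: H.
- move=> I J u X; rewrite !dia_cellE -(fmap_id (locQ (objectwise I))).
  by apply: (fmap_heq (locQ (objectwise I))) => i /=; exact: fmap_id.
- move=> I J u v w b a X; rewrite !dia_cellE.
  rewrite -(fmap_comp (locQ (objectwise I))).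
  apply: (fmap_heq (locQ (objectwise I))) => i /=.
  by rewrite -fmap_comp.
- move=> I J K v u u' a X; rewrite !dia_cellE !dia_mulE.
  by apply: (@locQ_square _ (objectwise I)) => i /=; rewrite comp1f compf1.
- move=> I J K v v' b u X; rewrite !dia_cellE !dia_mulE dia_pullE.
  by apply: (@locQ_square _ (objectwise I)) => i /=; rewrite comp1f compf1.
- move=> I J K M w v u X; rewrite !dia_cellE !dia_mulE dia_pullE.
  by apply: (@locQ_square3 _ (objectwise I)) => i /=; rewrite fmap_id !comp1f.
- move=> I J u X; rewrite !dia_cellE !dia_mulE dia_unitE.
  rewrite -!(fmap_comp (locQ (objectwise I))).
  rewrite -(fmap_id (locQ (objectwise I))).
  by apply: (fmap_heq (locQ (objectwise I))) => i /=; rewrite fmap_id !comp1f.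
- move=> I J u X; rewrite !dia_cellE !dia_mulE dia_unitE dia_pullE.
  rewrite -!(fmap_comp (locQ (objectwise I))).
  rewrite -(fmap_id (locQ (objectwise I))).
  by apply: (fmap_heq (locQ (objectwise I))) => i /=; rewrite fmap_id !comp1f.
Defined.
End LocalizedDerivator.

Arguments objectwise {E} W I _ _ _.
Arguments derivator {E} W.

Definition diaQ (E : Category) (W : MorClass E) (I : FiniteDirect) :
  Functor (Fun (op I) E) (derivator W I) := locQ (objectwise W I).
Arguments diaQ {E} W I.

(** ** Derived functors *)

Definition is_right_derived (A B A' B' : Category) (QA : Functor A A')
  (QB : Functor B B') (F : Functor A B) (RF : Functor A' B')
  (rho : NatTrans (QB ∘F F) (RF ∘F QA)) : Prop :=
  forall (G : Functor A' B') (s : NatTrans (QB ∘F F) (G ∘F QA)),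
    exists t : NatTrans RF G,
      (forall X : A, t (QA X) ∘ rho X ≈ s X) /\
      forall t' : NatTrans RF G,
        (forall X : A, t' (QA X) ∘ rho X ≈ s X) -> forall X, t' X ≈ t X.

Definition is_left_derived (A B A' B' : Category) (QA : Functor A A')
  (QB : Functor B B') (F : Functor A B) (LF : Functor A' B')
  (lam : NatTrans (LF ∘F QA) (QB ∘F F)) : Prop :=
  forall (G : Functor A' B') (s : NatTrans (G ∘F QA) (QB ∘F F)),
    exists t : NatTrans G LF,
      (forall X : A, lam X ∘ t (QA X) ≈ s X) /\
      forall t' : NatTrans G LF,
        (forall X : A, lam X ∘ t' (QA X) ≈ s X) -> forall X, t' X ≈ t X.

Definition postcomp (I E E' : Category) (F : Functor E E') :
  Functor (Fun (op I) E) (Fun (op I) E').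
Proof.
refine (@Build_Functor (Fun (op I) E) (Fun (op I) E')
  (fun X => F ∘F X) (fun X Y a => whiskerL F a) _ _ _).
- abstract (by move=> X Y a b H i /=; apply: fmap_heq; exact: H).
- abstract (by move=> X i /=; exact: fmap_id).
- abstract (by move=> X Y Z b a i /=; exact: fmap_comp).
Defined.

(* The comparison of F ∘ (X ∘ u^op) with (F ∘ X) ∘ u^op; its components are
   identities. *)
Definition postcomp_pull (I J E E' : Category) (F : Functor E E')
  (u : Functor I J) (X : Functor (op J) E) :
  @hom (Fun (op I) E') ((F ∘F X) ∘F Fop u) (F ∘F (X ∘F Fop u)) :=
  fassoc F X (Fop u).

Section DerivedMorphisms.
Context {E E' : Category} (W : MorClass E) (W' : MorClass E') (F : Functor E E').

(* RF is the total right derived functor of F at the level of derivators: on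
   each I the functor RF I is the total right derived functor of
   Fun(I^op, F), and the universal transformations are compatible with the
   inverse images u^*. *)
Definition is_right_derived_mor (RF : PdMor (derivator W) (derivator W'))
  : Prop :=
  exists rho : forall I : FiniteDirect,
      NatTrans (diaQ W' I ∘F postcomp I F)
        (RF I ∘F diaQ W I),
    (forall I, is_right_derived (rho I)) /\
    (forall (I J : FiniteDirect) (u : Functor I J) (X : Functor (op J) E),
      pm_iso RF u X ∘ fmap (@pd_pull (derivator W') I J u) (rho J X)
        ≈ rho I (X ∘F Fop u)
          ∘ fmap (diaQ W' I) (postcomp_pull F u X)).

Definition is_left_derived_mor (LF : PdMor (derivator W) (derivator W'))
  : Prop :=
  exists lam : forall I : FiniteDirect,
      NatTrans (LF I ∘F diaQ W I)
        (diaQ W' I ∘F postcomp I F),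
    (forall I, is_left_derived (lam I)) /\
    (forall (I J : FiniteDirect) (u : Functor I J) (X : Functor (op J) E),
      fmap (diaQ W' I) (postcomp_pull F u X)
          ∘ fmap (@pd_pull (derivator W') I J u) (lam J X)
        ≈ lam I (X ∘F Fop u) ∘ pm_iso LF u X).

End DerivedMorphisms.

(* Main.v *)
From mathcomp Require Import all_boot all_algebra.
From mathcomp Require Import boolp.
Require Import Defs.

Set Implicit Arguments.
Unset Strict Implicit.
Unset Printing Implicit Defensive.

Local Open Scope cat_scope.

(** The hypotheses say that the units and counits are weak equivalences: the
    morphism $R(\delta_M)$ has the strict section $\eta_{RM}$ and an injective
    kernel, hence it is a stable isomorphism, and dually for $L(\eta_N)$
    ([counit_stable_iso], [unit_stable_iso]). Both $L$ and $R$ are exact and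
    preserve projective-injective objects, so they preserve stable isomorphisms
    and therefore weak equivalences ([preserves_L], [preserves_R]).

    This already gives the first assertion and the equivalence of derivators. The
    functors $L$ and $R$ extend to the localizations, of the categories and of
    their diagram categories, without any replacement, and the extensions are the
    total derived functors; the unit and the counit become natural isomorphisms
    there. The triangulated structure is transported by the comparison
    $FS \to SF$ of the chosen injective embeddings ([shift_comparison]), which
    is natural, invertible and compatible with the unit and the counit, because
    morphisms of conflations with injective middle terms are determined stably by
    their first component ([triangle_equivalence]).

    For the model structure on $\mathcal C$, cofibrations lift against trivial
    fibrations because, for a deflation with kernel $K$ which is a weak
    equivalence, $RK$ is injective, so that by adjunction the obstruction to a
    lifting with cokernel $LN$ vanishes ([lifting_conflation]). To factor
    $f : X \to Y$ into a cofibration and a trivial fibration, embed $X$ into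
    $Y \oplus IX$ with cokernel $Q$ and pull this conflation back along a weak
    equivalence $L(RQ \oplus P(RY)) \to Q$ ([factor_trivial_fib]). The functor $R$
    preserves pullbacks, and a stable isomorphism with a strict section remains
    one after base change ([stable_iso_pullback]). Fibrations are first taken in
    the weaker sense of lifting against $0 \to LN$ for all projective $LN$
    ([FibL]); this class coincides with the one of the statement when the chosen
    presentations are adapted, and contains it in general. Derivability then follows from
    lifting properties ([left_derivable_lifting]); kernels provide the pullbacks and, by splitting
    idempotents, the pushouts of retracts of inflations ([cofibration_pushout]).
    The functor $R$ sends fibrations to retracts of deflations with kernel $RM$
    since it sends the canonical fibration $X \oplus LP(RY) \to Y$ to a deflation
    and preserves kernels ([FibD_amap]). The statements on $\mathcal D$ are those on
    $\mathcal C$ for the opposite categories, with $L$ and $R$ exchanged. *)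

(** * Isomorphisms, retracts and liftings *)

Lemma mor_class_ext (C : Category) (S T : MorClass C) :
  (forall X Y (f : hom X Y), S X Y f <-> T X Y f) -> S = T.
Proof.
move=> H; apply: functional_extensionality_dep => X.
apply: functional_extensionality_dep => Y.
by apply: functional_extensionality_dep => f; apply/propext.
Qed.

Section Isomorphisms.
Context {C : Category}.
Implicit Types X Y Z : C.

Lemma is_iso_heq X Y (f g : hom X Y) : f ≈ g -> is_iso f -> is_iso g.
Proof. by move=> H [h [H1 H2]]; exists h; rewrite -H. Qed.

Lemma is_iso_cancelr X Y Z (g : hom Y Z) (f : hom X Y) :
  is_iso f -> is_iso (g ∘ f) -> is_iso g.
Proof.
move=> [f' [F1 F2]] Hgf; apply: (@is_iso_heq _ _ ((g ∘ f) ∘ f')).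
  by rewrite -compA F2 compf1.
by apply: is_iso_comp => //; exists f.
Qed.

Lemma is_iso_cancell X Y Z (g : hom Y Z) (f : hom X Y) :
  is_iso g -> is_iso (g ∘ f) -> is_iso f.
Proof.
move=> [g' [G1 G2]] Hgf; apply: (@is_iso_heq _ _ (g' ∘ (g ∘ f))).
  by rewrite compA G1 comp1f.
by apply: is_iso_comp => //; exists g.
Qed.

Lemma is_iso_retract X Y A B (f : hom X Y) (g : hom A B) :
  retract_of f g -> is_iso g -> is_iso f.
Proof.
move=> [s [r [s' [r' [H1 H2 H3 H4]]]]] [g' [G1 G2]].
exists (r ∘ g' ∘ s'); split.
- by rewrite -compA -H3 compA -(compA r) G1 compf1.
- by rewrite !compA H4 -(compA r') G2 compf1.
Qed.

End Isomorphisms.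

Lemma retract_trans (C : Category) (X Y X' Y' X'' Y'' : C) (f : hom X Y)
    (g : hom X' Y') (h : hom X'' Y'') :
  retract_of f g -> retract_of g h -> retract_of f h.
Proof.
move=> [s [r [s' [r' [H1 H2 H3 H4]]]]] [t [q [t' [q' [K1 K2 K3 K4]]]]].
exists (t ∘ s), (r ∘ q), (t' ∘ s'), (r' ∘ q'); split.
- by rewrite -compA (compA q) K1 comp1f.
- by rewrite -compA (compA q') K2 comp1f.
- by rewrite compA K3 -compA H3 compA.
- by rewrite compA H4 -compA K4 compA.
Qed.

Lemma retract_refl (C : Category) (X Y : C) (f : hom X Y) : retract_of f f.
Proof.
by exists (idm X), (idm X), (idm Y), (idm Y); split; rewrite ?comp1f ?compf1.
Qed.

Section IsoClass.
Context {C E : Category} (G : Functor C E).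

Lemma iso_class_two_of_three :
  two_out_of_three (fun X Y (f : hom X Y) => is_iso (fmap G f)).
Proof.
move=> X Y Z f g; split=> H K.
- by apply: is_iso_heq (is_iso_comp K H); rewrite fmap_comp.
- by apply: is_iso_cancelr H _; apply: is_iso_heq K; rewrite fmap_comp.
- by apply: is_iso_cancell H _; apply: is_iso_heq K; rewrite fmap_comp.
Qed.

Lemma iso_class_retract :
  retract_closed (fun X Y (f : hom X Y) => is_iso (fmap G f)).
Proof.
move=> X Y A B f g [s [r [s' [r' [H1 H2 H3 H4]]]]].
apply: is_iso_retract; exists (fmap G s), (fmap G r), (fmap G s'), (fmap G r').
by split; rewrite -!fmap_comp -?fmap_id; apply: fmap_heq.
Qed.

End IsoClass.

Section Lifting.
Context {C : Category}.

Lemma lifting_retract_l (A B A' B' X Y : C) (i : hom A B) (j : hom A' B')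
    (p : hom X Y) :
  retract_of i j -> lifting j p -> lifting i p.
Proof.
move=> [s [r [s' [r' [H1 H2 H3 H4]]]]] Hj u v Huv.
have [|h [K1 K2]] := Hj (u ∘ r) (v ∘ r').
  by rewrite compA Huv -!compA H4.
exists (h ∘ s'); split.
- by rewrite -compA -H3 compA K1 -compA H1 compf1.
- by rewrite compA K2 -compA H2 compf1.
Qed.

Lemma lifting_iso (A B X Y : C) (i : hom A B) (p : hom X Y) :
  is_iso p -> lifting i p.
Proof.
move=> [q [H1 H2]] u v Huv; exists (q ∘ v); split.
- by rewrite -compA -Huv compA H1 comp1f.
- by rewrite compA H2 comp1f.
Qed.

Lemma lifting_comp (A B X Y Z : C) (i : hom A B) (p : hom X Y) (q : hom Y Z) :
  lifting i p -> lifting i q -> lifting i (q ∘ p).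
Proof.
move=> Hp Hq u v Huv; have [|h [H1 H2]] := Hq (p ∘ u) v; first by rewrite compA.
have [|h' [H1' H2']] := Hp u h; first by rewrite H1.
by exists h'; split=> //; rewrite -compA H2'.
Qed.

Lemma lifting_pullback (A B X Y Y' X' : C) (i : hom A B) (p : hom X Y)
    (v : hom Y' Y) (u : hom X' X) (p' : hom X' Y') :
  is_pullback p v u p' -> lifting i p -> lifting i p'.
Proof.
move=> [E U] Hp a b Hab; have [|h [H1 H2]] := Hp (u ∘ a) (v ∘ b).
  by rewrite compA E -!compA Hab.
have [h' [[K1 K2] _]] := U _ h b H2; exists h'; split=> //.
have E' : p ∘ (u ∘ a) ≈ v ∘ (p' ∘ a) by rewrite !compA E.
have [w [_ Hw]] := U _ _ _ E'; transitivity w; first apply: Hw.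
- by rewrite compA K1 H1.
- by rewrite compA K2 Hab.
- by symmetry; apply: Hw.
Qed.

(** The retraction is a filler of the square with top side $i$ and the identity
    at the bottom. *)
Lemma retract_argument_l (X Y Z : C) (f : hom X Y) (i : hom X Z) (p : hom Z Y) :
  f ≈ p ∘ i -> lifting f p -> retract_of f i.
Proof.
move=> E H; have [|h [H1 H2]] := H i (idm Y); first by rewrite comp1f E.
exists (idm X), (idm X), h, p; split; rewrite ?comp1f ?compf1 ?H1 ?H2 //.
Qed.

Lemma retract_argument_r (X Y Z : C) (f : hom X Y) (i : hom X Z) (p : hom Z Y) :
  f ≈ p ∘ i -> lifting i f -> retract_of f p.
Proof.
move=> E H; have [|h [H1 H2]] := H (idm X) p; first by rewrite compf1 E.
by exists i, h, (idm Y), (idm Y); split; rewrite ?comp1f ?E -?E ?H1 ?H2.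
Qed.

End Lifting.

(** * Formal consequences of a model structure *)

Section ModelStructure.
Context {C : Category} {W Cof Fib : MorClass C}.
Hypothesis M : model_structure W Cof Fib.

Lemma model_cof (X Y : C) (f : hom X Y) :
  (forall A B (p : hom A B), Fib p -> W p -> lifting f p) -> Cof f.
Proof.
move=> H; have [Z [i [p [E Ci Fp Wp]]]] := ms_factor_trivial_fib M f.
by apply: (ms_retract_Cof M _ Ci); apply: retract_argument_l E (H _ _ _ Fp Wp).
Qed.

Lemma model_trivial_fib (X Y : C) (f : hom X Y) :
  (forall A B (i : hom A B), Cof i -> lifting i f) -> W f.
Proof.
move=> H; have [Z [i [p [E Ci Fp Wp]]]] := ms_factor_trivial_fib M f.
by apply: (ms_retract_W M _ Wp); apply: retract_argument_r E (H _ _ _ Ci).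
Qed.

Lemma model_structure_op :
  @model_structure (op C) (op_class W) (op_class Fib) (op_class Cof).
Proof.
have Hr (S : MorClass C) : retract_closed S -> @retract_closed (op C) (op_class S).
  move=> HS X Y A B f g [s [r [s' [r' [H1 H2 H3 H4]]]]]; apply: HS.
  by exists r', s', r, s; split=> //=; symmetry.
have Hl (A B X Y : C) (i : hom A B) (p : hom X Y) :
    lifting i p -> @lifting (op C) Y X B A p i.
  move=> H u v Huv; have [|h [H1 H2]] := H v u; first exact: hsym Huv.
  by exists h.
split.
- move=> X Y Z f g; have [H1 H2 H3] := ms_two_of_three M g f.
  by split=> Hf Hg; [exact: H1|exact: H3|exact: H2].
- exact: Hr (ms_retract_W M).
- exact: Hr (ms_retract_Fib M).
- exact: Hr (ms_retract_Cof M).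
- by move=> A B X Y i p Fi Wi Cp; apply: Hl; exact: (ms_lift_trivial_fib M).
- by move=> A B X Y i p Fi Cp Wp; apply: Hl; exact: (ms_lift_trivial_cof M).
- move=> X Y f; have [Z [i [p [E H1 H2 H3]]]] := ms_factor_trivial_fib M f.
  by exists Z, p, i.
- move=> X Y f; have [Z [i [p [E H1 H2 H3]]]] := ms_factor_trivial_cof M f.
  by exists Z, p, i.
Qed.

(** The axioms on isomorphisms, composition and base change hold because the
    fibrations in question are defined by a lifting property; trivial fibrations
    are moreover those morphisms which lift against all cofibrations. *)
Lemma left_derivable_lifting (Fib' S : MorClass C) (T : C) :
  is_terminal T ->
  (forall X Y (f : hom X Y), is_iso f -> W f) ->
  (forall X Y (p : hom X Y), Fib' _ _ p -> Fib p) ->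
  (forall X Y (p : hom X Y),
    Fib' _ _ p <-> forall A B (i : hom A B), S _ _ i -> lifting i p) ->
  (forall (X Y Y' : C) (p : hom X Y) (v : hom Y' Y), Fib' _ _ p ->
    exists (X' : C) (u : hom X' X) (p' : hom X' Y'), is_pullback p v u p') ->
  (forall X Y (f : hom X Y), exists (Z : C) (w : hom X Z) (p : hom Z Y),
    [/\ f ≈ p ∘ w, W w & Fib' _ _ p]) ->
  left_derivable W Fib'.
Proof.
move=> HT isoW sub FP pb fac.
have isoF (X Y : C) (f : hom X Y) : is_iso f -> Fib' _ _ f.
  by move=> Hf; apply/FP => A B i _; exact: lifting_iso.
have compF (X Y Z : C) (f : hom X Y) (g : hom Y Z) :
    Fib' _ _ f -> Fib' _ _ g -> Fib' _ _ (g ∘ f).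
  move=> /FP Hf /FP Hg; apply/FP => A B i Si.
  by apply: lifting_comp; [exact: Hf|exact: Hg].
have pbF (X Y Y' X' : C) (p : hom X Y) (v : hom Y' Y) (u : hom X' X)
    (p' : hom X' Y') : is_pullback p v u p' -> Fib' _ _ p -> Fib' _ _ p'.
  by move=> Hp /FP H; apply/FP => A B i /H; apply: lifting_pullback Hp.
split.
- exists T; split=> //; exists T, (idm T); split=> //.
  exact/isoF/is_iso_id.
- move=> X Y f [g [G1 G2]] [T' [h [HT' Hh]]]; exists T', (h ∘ g); split=> //.
  by apply: compF Hh; apply: isoF; exists f.
- exact: isoW.
- exact: ms_two_of_three M.
- by move=> X Y f _ _; exact: isoF.
- by move=> X Y Z f g _ _ _; exact: compF.
- by move=> X Y Y' p v _ _ _; exact: pb.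
- by move=> X Y Y' X' p v u p' _ _ _ Hp Hpb; exact: pbF Hpb Hp.
- move=> X Y Y' X' p v u p' _ _ _ Hp Wp Hpb; split; first exact: pbF Hpb Hp.
  apply: model_trivial_fib => A B i Ci; apply: lifting_pullback Hpb _.
  by apply: (ms_lift_trivial_fib M) => //; exact: sub.
- by move=> X Y f _; exact: fac.
Qed.

End ModelStructure.

(** * Equalizers from finite limits *)

Section Equalizers.

Definition parallel_hom (x y : bool) : Type :=
  match x, y with
  | false, true => bool
  | true, false => Empty_set
  | _, _ => unit
  end.

Definition parallel_id (x : bool) : parallel_hom x x :=
  match x with true => tt | false => tt end.

Definition parallel_comp (x y z : bool) :
  parallel_hom y z -> parallel_hom x y -> parallel_hom x z :=
  match x, y, z with
  | false, false, true => fun g _ => g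
  | false, true, true => fun _ f => f
  | true, true, true => fun _ _ => tt
  | false, false, false => fun _ _ => tt
  | true, false, _ => fun _ f => match f with end
  | _, true, false => fun g _ => match g with end
  end.

Definition parallel_pair : Category.
Proof.
refine (@Build_Category bool parallel_hom (fun x y => @eq (parallel_hom x y))
  parallel_id parallel_comp _ _ _ _ _).
- by move=> x y z g g' f f' -> ->.
- by case; case; case; case => // [] [] [] [].
- by case; case => // [] [].
- by case; case => // [] [].
Defined.

Lemma parallel_pair_finite : finite_category parallel_pair.
Proof.
pose T := {X : parallel_pair & {Y : parallel_pair & @hom parallel_pair X Y}}.
pose m X Y (f : @hom parallel_pair X Y) : T := existT _ X (existT _ Y f).
exists 4, (fun i => nth (m false false tt)
  [:: m false false tt; m true true tt; m false true true; m false true false] i).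
case; case=> // f.
- by exists (Ordinal (isT : 1 < 4)%N), f; case: f.
- case: f; first by exists (Ordinal (isT : 2 < 4)%N), true.
  by exists (Ordinal (isT : 3 < 4)%N), false.
- by exists (Ordinal (isT : 0 < 4)%N), f; case: f.
Qed.

Definition parallel_functor (E : Category) (X Y : E) (f g : hom X Y) :
  Functor parallel_pair E.
Proof.
refine (@Build_Functor parallel_pair E (fun b : bool => if b then Y else X)
  (fun a b => match a, b return parallel_hom a b ->
      hom (if a then Y else X) (if b then Y else X) with
    | false, false => fun _ => idm X
    | true, true => fun _ => idm Y
    | false, true => fun u : bool => if u then f else g
    | true, false => fun u => match u with end
    end) _ _ _).
- by move=> a b u v ->.
- by case.
- case; case; case => // u v; try by [case: u | case: v].
  + by rewrite comp1f.
  + by rewrite comp1f.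
  + by rewrite compf1.
  + by rewrite comp1f.
Defined.

Lemma finite_limits_equalizer (E : Category) (X Y : E) (f g : hom X Y) :
  has_finite_limits E ->
  exists (K : E) (i : hom K X), f ∘ i ≈ g ∘ i /\
    forall (A : E) (a : hom A X), f ∘ a ≈ g ∘ a ->
      exists b : hom A K, i ∘ b ≈ a /\ forall b', i ∘ b' ≈ a -> b' ≈ b.
Proof.
move=> HE; have [c Hc] := HE _ (parallel_functor f g) parallel_pair_finite.
have leg_true (d : Cone (parallel_functor f g)) (u : bool) :
  (if u then f else g) ∘ leg d false ≈ leg d true := leg_nat d (u : parallel_hom false true).
exists c, (leg c false); split.
  by rewrite (leg_true c true) (leg_true c false).
move=> A a Ha.
have Hd (i j : parallel_pair) (u : hom i j) :
  fmap (parallel_functor f g) u ∘ (match i with true => f ∘ a | false => a end :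
     hom A (parallel_functor f g i)) ≈ match j with true => f ∘ a | false => a end.
  case: i j u => [] [] // u /=.
  - by rewrite comp1f.
  - by case: u => /=; [|symmetry].
  - by rewrite comp1f.
pose d := @Build_Cone _ _ (parallel_functor f g) A _ Hd.
have [b [B1 B2]] := Hc d; exists b; split; first exact: (B1 false).
move=> b' Hb'; apply: B2; case; last exact: Hb'.
by rewrite -(leg_true c true) -compA Hb'.
Qed.

End Equalizers.

Import GRing.Theory.
Local Open Scope ring_scope.

(** * Opposite Frobenius categories *)

Section Opposite.
Context {k : comPzRingType}.

Definition op_add (C : AdditiveCat k) : AdditiveCat k.
Proof.
refine (@Build_AdditiveCat k C (fun X Y => @ahom k C Y X) (fun X => aidm X)
  (fun X Y Z g f => f ⋅ g) _ _ _ _ _ (zob C) (zobP C) _).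
- abstract (by move=> *; rewrite acompA).
- abstract (by move=> *; rewrite acompf1).
- abstract (by move=> *; rewrite acomp1f).
- abstract (by move=> *; rewrite acomp_linr).
- abstract (by move=> *; rewrite acomp_linl).
- abstract (move=> X Y; have [B [i1 [i2 [p1 [p2 [E1 E2 E3 E4 E5]]]]]] :=
    biprod X Y; by exists B, p1, p2, i1, i2).
Defined.

Lemma op_conflation_iso (C : AdditiveCat k) (E : ConflationClass C) :
  exact_structure E ->
  forall (X Y Z X' Y' Z' : C) (i : ahom X Y) (p : ahom Y Z) (i' : ahom X' Y')
    (p' : ahom Y' Z') (x : ahom X' X) (y : ahom Y' Y) (z : ahom Z' Z),
  E X Y Z i p -> @is_iso C _ _ x -> @is_iso C _ _ y -> @is_iso C _ _ z ->
  p ⋅ y = z ⋅ p' -> i ⋅ x = y ⋅ i' -> E X' Y' Z' i' p'.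
Proof.
move=> H X Y Z X' Y' Z' i p i' p' x y z Hc [x' [X1 X2]] [y' [Y1 Y2]] [z' [Z1 Z2]].
rewrite /= in X1 X2 Y1 Y2 Z1 Z2; move=> Hp Hi.
apply: (ex_iso H (x := x') (y := y') (z := z') Hc).
- by exists x.
- by exists y.
- by exists z.
- by rewrite -[LHS]acompf1 -X2 !acompA -(acompA y') Hi !acompA Y1 acomp1f.
- by rewrite -[LHS]acompf1 -Y2 !acompA -(acompA z') Hp !acompA Z1 acomp1f.
Qed.

Lemma op_exact_structure (C : AdditiveCat k) (E : ConflationClass C) :
  exact_structure E ->
  @exact_structure k (op_add C) (fun X Y Z i p => E Z Y X p i).
Proof.
move=> H; split.
- move=> X Y Z i p Hc; exact: (ex_cokernel H Hc).
- move=> X Y Z i p Hc; exact: (ex_kernel H Hc).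
- move=> X Y Z i p X' Y' Z' i' p' x y z Hc.
  move=> [x' [X1 X2]] [y' [Y1 Y2]] [z' [Z1 Z2]] Hi Hp.
  apply: (@op_conflation_iso C E H Z Y X Z' Y' X' p i p' i' z y x Hc).
  + by exists z'.
  + by exists y'.
  + by exists x'.
  + exact: Hi.
  + exact: Hp.
- by move=> X; have [Z [i Hc]] := ex_defl_id H X; exists Z, i.
- by move=> X; have [Z [i Hc]] := ex_infl_id H X; exists Z, i.
- move=> X Y Z j i Hi Hj; exact: (ex_defl_comp H Hj Hi).
- move=> X Y Z q p Hp Hq; exact: (ex_infl_comp H Hq Hp).
- move=> X Y X' i f Hi; exact: (ex_defl_pullback H f Hi).
- move=> X Y X' i f Hi; exact: (ex_infl_pushout H f Hi).
Qed.

Definition op_ex (C : ExactCat k) : ExactCat k :=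
  Build_ExactCat (op_exact_structure (ex_str C)).

Lemma op_injective (C : ExactCat k) (J : C) :
  @injective_obj k (op_ex C) J <-> projective_obj J.
Proof. by split=> H X Y i; exact: H. Qed.

Lemma op_projective (C : ExactCat k) (P : C) :
  @projective_obj k (op_ex C) P <-> injective_obj P.
Proof. by split=> H X Y i; exact: H. Qed.

Definition op_fr (C : FrobeniusCat k) : FrobeniusCat k.
Proof.
refine (@Build_FrobeniusCat k (op_ex C) _ _ _).
- abstract (move=> X; have [P [p [HP Hp]]] := @fr_enough_proj k C X;
    by exists P, p; split=> //; apply/op_injective).
- abstract (move=> X; have [J [i [HJ Hi]]] := @fr_enough_inj k C X;
    by exists J, i; split=> //; apply/op_projective).
- abstract (by move=> X; rewrite op_injective op_projective; split=> /fr_inj_proj).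
Defined.

Definition op_res (C : FrobeniusCat k) (r : Resolutions C) :
  Resolutions (op_fr C).
Proof.
refine (@Build_Resolutions k (op_fr C) (rP r) (rSV r) (rI r) (rS r)
  (@rP_out _ _ r) (@rP_in _ _ r) (@rI_out _ _ r) (@rI_in _ _ r) _ _ _ _).
- by move=> X; exact: (rP_conf r X).
- by move=> X; exact: (rI_conf r X).
- abstract (by move=> X; apply/op_injective; exact: rP_proj).
- abstract (by move=> X; apply/op_projective; exact: rI_inj).
Defined.

Definition op_fun (C D : AdditiveCat k) (F : Functor C D) :
  Functor (op_add C) (op_add D).
Proof.
refine (@Build_Functor (op_add C) (op_add D) F
  (fun X Y f => @fmap C D F Y X f) _ _ _).
- by move=> X Y f g; apply: (@fmap_heq C D F).
- exact: (fmap_id F).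
- by move=> X Y Z g f; exact: (@fmap_comp C D F).
Defined.

Lemma op_exact_functor (C D : ExactCat k) (F : Functor C D) :
  exact_functor F -> @exact_functor k (op_ex C) (op_ex D) (op_fun F).
Proof.
move=> HF; split=> [X Y f g|X Y Z i p]; first exact: (exf_add HF).
exact: (@exf_conflation k C D F HF Z Y X p i).
Qed.

Definition op_adj (C D : AdditiveCat k) (L : Functor D C) (R : Functor C D)
  (adj : Adjunction L R) : Adjunction (op_fun R) (op_fun L).
Proof.
unshelve refine (@Build_Adjunction (op_add D) (op_add C) (op_fun R) (op_fun L)
  (@Build_NatTrans (op_add C) (op_add C) (Fid _) (op_fun L ∘F op_fun R)
    (fun M => counit_of adj M) _)
  (@Build_NatTrans (op_add D) (op_add D) (op_fun R ∘F op_fun L) (Fid _)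
    (fun N => unit_of adj N) _) _ _).
- move=> X Y f; exact: (hsym (nt_nat (counit_of adj) (f : @hom C Y X))).
- move=> X Y f; exact: (hsym (nt_nat (unit_of adj) (f : @hom D Y X))).
- by move=> M; exact: (triangle_R adj M).
- by move=> N; exact: (triangle_L adj N).
Defined.

Lemma op_stable_iso (C : FrobeniusCat k) (X Y : C) (f : ahom X Y) :
  @stable_iso k (op_fr C) Y X f <-> stable_iso f.
Proof.
have H (C' : FrobeniusCat k) (A B : C') (a b : ahom A B) :
    stably_eq a b -> @stably_eq k (op_fr C') B A a b.
  move=> [J [u [v [[H1 H2] E]]]]; exists J, v, u; split=> //.
  by split; [apply/op_injective|apply/op_projective].
have K (C' : FrobeniusCat k) (A B : C') (a b : ahom A B) :
    @stably_eq k (op_fr C') B A a b -> stably_eq a b.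
  move=> [J [u [v [[H1 H2] E]]]]; exists J, v, u; split=> //.
  by split; [apply/op_projective|apply/op_injective].
split=> [[g [G1 G2]]|[g [G1 G2]]]; exists g; split.
- exact: K G2.
- exact: K G1.
- exact: H G2.
- exact: H G1.
Qed.

End Opposite.

(** * Additive and exact categories *)

Section Additive.
Context {k : comPzRingType} {C : AdditiveCat k}.
Implicit Types X Y Z : C.

Definition is_biproduct X Y B (i1 : ahom X B) (i2 : ahom Y B) (p1 : ahom B X)
    (p2 : ahom B Y) : Prop :=
  [/\ p1 ⋅ i1 = aidm X, p2 ⋅ i2 = aidm Y, p1 ⋅ i2 = 0, p2 ⋅ i1 = 0 &
      i1 ⋅ p1 + i2 ⋅ p2 = aidm B].

Lemma biproduct_sym X Y B (i1 : ahom X B) (i2 : ahom Y B) (p1 : ahom B X)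
    (p2 : ahom B Y) : is_biproduct i1 i2 p1 p2 -> is_biproduct i2 i1 p2 p1.
Proof. by move=> [E1 E2 E3 E4 E5]; split; rewrite // addrC. Qed.

Lemma pullback_hom_eq X Y Z P (f : ahom X Z) (g : ahom Y Z) (p : ahom P X)
    (q : ahom P Y) : @is_pullback C _ _ _ _ f g p q ->
  forall A (h h' : ahom A P), p ⋅ h = p ⋅ h' -> q ⋅ h = q ⋅ h' -> h = h'.
Proof.
move=> [E U] A h h' H1 H2; have [|w [_ Hw]] := U A (p ⋅ h) (q ⋅ h).
  by rewrite /= !acompA; congr (_ ⋅ _); exact: E.
by rewrite (Hw h) // (Hw h').
Qed.

Lemma pullback_lift X Y Z P (f : ahom X Z) (g : ahom Y Z) (p : ahom P X)
    (q : ahom P Y) : @is_pullback C _ _ _ _ f g p q ->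
  forall A (a : ahom A X) (b : ahom A Y), f ⋅ a = g ⋅ b ->
  exists h : ahom A P, p ⋅ h = a /\ q ⋅ h = b.
Proof. by move=> [_ U] A a b /U [h [H _]]; exists h. Qed.

Lemma kernel_hom_eq X Y Z (i : ahom X Y) (p : ahom Y Z) : is_kernel i p ->
  forall A (h h' : ahom A X), i ⋅ h = i ⋅ h' -> h = h'.
Proof.
move=> [E U] A h h' H; have [|w [_ Hw]] := U A (i ⋅ h).
  by rewrite acompA E acomp0f.
by rewrite (Hw h) // (Hw h').
Qed.

Lemma kernel_lift X Y Z (i : ahom X Y) (p : ahom Y Z) : is_kernel i p ->
  forall A (a : ahom A Y), p ⋅ a = 0 -> exists b : ahom A X, i ⋅ b = a.
Proof. by move=> [_ U] A a /U [b [H _]]; exists b. Qed.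

Lemma cokernel_hom_eq X Y Z (i : ahom X Y) (p : ahom Y Z) : is_cokernel i p ->
  forall A (h h' : ahom Z A), h ⋅ p = h' ⋅ p -> h = h'.
Proof.
move=> [E U] A h h' H; have [|w [_ Hw]] := U A (h ⋅ p).
  by rewrite -acompA E acompf0.
by rewrite (Hw h) // (Hw h').
Qed.

Lemma cokernel_lift X Y Z (i : ahom X Y) (p : ahom Y Z) : is_cokernel i p ->
  forall A (a : ahom Y A), a ⋅ i = 0 -> exists b : ahom Z A, b ⋅ p = a.
Proof. by move=> [_ U] A a /U [b [H _]]; exists b. Qed.

Lemma kernel_iso X X' Y Z (i : ahom X Y) (i' : ahom X' Y) (p : ahom Y Z) :
  is_kernel i p -> is_kernel i' p ->
  exists x : ahom X X', @is_iso C _ _ x /\ i' ⋅ x = i.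
Proof.
move=> Hi Hi'; have [x Hx] := kernel_lift Hi' Hi.1.
have [x' Hx'] := kernel_lift Hi Hi'.1.
exists x; split=> //; exists x'; split=> /=.
- by apply: (kernel_hom_eq Hi); rewrite acompA Hx' Hx acompf1.
- by apply: (kernel_hom_eq Hi'); rewrite acompA Hx Hx' acompf1.
Qed.

Lemma pullback_kernel X Y Z P K (f : ahom X Z) (g : ahom Y Z) (p : ahom P X)
    (q : ahom P Y) (i : ahom K X) :
  @is_pullback C _ _ _ _ f g p q -> is_kernel i f ->
  exists j : ahom K P, [/\ p ⋅ j = i, q ⋅ j = 0 & is_kernel j q].
Proof.
move=> Hp Hi.
have [|j [J1 J2]] := pullback_lift Hp (a := i) (b := (0 : ahom K Y)).
  by rewrite Hi.1 acompf0.
exists j; split=> //; split=> // A a Ha.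
have [|b Hb] := kernel_lift Hi (a := p ⋅ a).
  have E : f ⋅ p = g ⋅ q := Hp.1.
  by rewrite acompA E -acompA Ha acompf0.
exists b; split.
- by apply: (pullback_hom_eq Hp); rewrite acompA ?J1 ?J2 // acomp0f Ha.
- move=> b' Hb'; apply: (kernel_hom_eq Hi).
  by rewrite Hb -J1 -acompA Hb'.
Qed.

Lemma kernel_biproduct X Y B (i1 : ahom X B) (i2 : ahom Y B) (p1 : ahom B X)
    (p2 : ahom B Y) : is_biproduct i1 i2 p1 p2 -> is_kernel i1 p2.
Proof.
move=> [E1 E2 E3 E4 E5]; split=> // A a Ha; exists (p1 ⋅ a); split.
- by rewrite -[RHS]acomp1f -E5 acompDl -!acompA Ha acompf0 addr0.
- by move=> b' <-; rewrite acompA E1 acomp1f.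
Qed.

Lemma zero_object (Z : C) : aidm Z = 0 ->
  forall X (f : ahom X Z), f = 0.
Proof. by move=> E X f; rewrite -[f]acomp1f E acomp0f. Qed.

Lemma zob_terminal : @is_terminal C (zob C).
Proof. by move=> X; exists (0 : ahom X (zob C)) => g; exact/zero_object/zobP. Qed.

(** Splitting $1 - e$ by its kernel splits $e$. *)
Lemma kernels_split_idempotents : has_kernels C ->
  forall X (e : ahom X X), e ⋅ e = e ->
  exists (Y : C) (s : ahom Y X) (r : ahom X Y), r ⋅ s = aidm Y /\ s ⋅ r = e.
Proof.
move=> HK X e He; have [Y [s Hs]] := HK _ _ (aidm X - e).
have [|r Hr] := kernel_lift Hs (a := e).
  by rewrite acompBl acomp1f He subrr.
exists Y, s, r; split=> //; apply: (kernel_hom_eq Hs).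
rewrite acompA Hr acompf1; have := Hs.1.
by rewrite acompBl acomp1f => /eqP; rewrite subr_eq0 => /eqP.
Qed.

(** The kernel of $(f, -g) : X \oplus Y \to Z$ *)
Lemma kernels_pullbacks : has_kernels C ->
  forall (X Y Z : C) (f : ahom X Z) (g : ahom Y Z),
  exists (P : C) (p : ahom P X) (q : ahom P Y), @is_pullback C _ _ _ _ f g p q.
Proof.
move=> HK X Y Z f g.
have [B [i1 [i2 [p1 [p2 [E1 E2 E3 E4 E5]]]]]] := biprod X Y.
have [P [j Hj]] := HK _ _ (f ⋅ p1 - g ⋅ p2).
exists P, (p1 ⋅ j), (p2 ⋅ j); split.
  by rewrite /=; apply/eqP; rewrite -subr_eq0 !acompA -acompBl Hj.1.
move=> A a b /= Hab; have [|h Hh] := kernel_lift Hj (a := i1 ⋅ a + i2 ⋅ b).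
  rewrite acompBl !acompDr -!acompA !(acompA p1) !(acompA p2) E1 E2 E3 E4.
  by rewrite !acomp1f !acomp0f !acompf0 addr0 add0r Hab subrr.
exists h; split.
  rewrite -!acompA Hh !acompDr !acompA E1 E2 E3 E4.
  by rewrite !acomp1f !acomp0f addr0 add0r.
move=> h' H1 H2; apply: (kernel_hom_eq Hj); rewrite Hh.
by rewrite -[LHS]acomp1f -E5 acompDl -!acompA !(acompA _ j) H1 H2.
Qed.

End Additive.

Lemma op_has_kernels (k : comPzRingType) (C : AdditiveCat k) :
  has_cokernels C -> has_kernels (op_add C).
Proof. by move=> H Y Z p; exact: (H Z Y p). Qed.

Lemma finite_limits_kernels (k : comPzRingType) (C : AdditiveCat k) :
  has_finite_limits C -> has_kernels C.
Proof.
move=> HC Y Z p.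
have [K [i [E U]]] := finite_limits_equalizer (p : @hom C Y Z) (0 : ahom Y Z) HC.
exists K, i; split; first by move: E => /= ->; exact: acomp0f.
by move=> A a Ha; apply: U; rewrite /= Ha acomp0f.
Qed.

Lemma finite_colimits_cokernels (k : comPzRingType) (C : AdditiveCat k) :
  has_finite_colimits C -> has_cokernels C.
Proof.
move=> HC X Y i.
have [K [p [E U]]] :=
  finite_limits_equalizer (i : @hom (op C) Y X) (0 : ahom X Y) HC.
exists K, p; split; first by move: E => /= ->; exact: acompf0.
by move=> A a Ha; apply: U; rewrite /= Ha acompf0.
Qed.

Section Pushout.
Context {k : comPzRingType} {C : AdditiveCat k}.
Context {X Y Z P : C} {f : ahom Z X} {g : ahom Z Y} {p : ahom X P} {q : ahom Y P}.
Hypothesis Hp : @is_pushout C _ _ _ _ f g p q.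

Lemma pushout_hom_eq A (h h' : ahom P A) :
  h ⋅ p = h' ⋅ p -> h ⋅ q = h' ⋅ q -> h = h'.
Proof. exact: (@pullback_hom_eq k (op_add C) X Y Z P f g p q Hp A h h'). Qed.

Lemma pushout_lift A (a : ahom X A) (b : ahom Y A) : a ⋅ f = b ⋅ g ->
  exists h : ahom P A, h ⋅ p = a /\ h ⋅ q = b.
Proof. exact: (@pullback_lift k (op_add C) X Y Z P f g p q Hp A a b). Qed.

End Pushout.

Section Exact.
Context {k : comPzRingType} {C : ExactCat k}.
Implicit Types X Y Z : C.

Lemma conflation_kernel X Y Z (i : ahom X Y) (p : ahom Y Z) :
  conflation i p -> is_kernel i p.
Proof. exact: (ex_kernel (ex_str C)). Qed.

Lemma conflation_cokernel X Y Z (i : ahom X Y) (p : ahom Y Z) :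
  conflation i p -> is_cokernel i p.
Proof. exact: (ex_cokernel (ex_str C)). Qed.

Lemma kernel_conflation X Y Z (i : ahom X Y) (p : ahom Y Z) :
  deflation p -> is_kernel i p -> conflation i p.
Proof.
move=> [X' [i' Hc]] Hi.
have [x [Ix Hx]] := kernel_iso (conflation_kernel Hc) Hi.
apply: (ex_iso (ex_str C) (x := x) (y := aidm Y) (z := aidm Z) Hc Ix).
- exact: is_iso_id.
- exact: is_iso_id.
- by rewrite acomp1f.
- by rewrite acomp1f acompf1.
Qed.

Lemma deflation_iso X Y Z (p : ahom Y Z) (y : ahom X Y) :
  deflation p -> @is_iso C _ _ y -> deflation (p ⋅ y).
Proof.
move=> [K [i Hc]] [y' [Y1 Y2]]; exists K, (y' ⋅ i).
apply: (ex_iso (ex_str C) (x := aidm K) (y := y') (z := aidm Z) Hc).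
- exact: is_iso_id.
- by exists y.
- exact: is_iso_id.
- by rewrite acompf1.
- by rewrite acomp1f -acompA; rewrite /= in Y2; rewrite Y2 acompf1.
Qed.

Lemma pullback_deflation (Y Z Z' P : C) (p : ahom Y Z) (f : ahom Z' Z)
    (g : ahom P Y) (p' : ahom P Z') :
  @is_pullback C _ _ _ _ p f g p' -> deflation p -> deflation p'.
Proof.
move=> Hp Hd; have [P0 [g0 [p0 [H0 D0]]]] := ex_defl_pullback (ex_str C) f Hd.
have [x [X1 X2]] := pullback_lift H0 (Hp.1 : p ⋅ g = f ⋅ p').
have [x' [X1' X2']] := pullback_lift Hp (H0.1 : p ⋅ g0 = f ⋅ p0).
rewrite -X2; apply: deflation_iso => //; exists x'; split=> /=.
- by apply: (pullback_hom_eq Hp); rewrite acompA ?X1' ?X2' ?X1 ?X2 acompf1.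
- by apply: (pullback_hom_eq H0); rewrite acompA ?X1 ?X2 ?X1' ?X2' acompf1.
Qed.

(** A projection of a biproduct is the base change of a deflation to zero. *)
Lemma biproduct_conflation X Y B (i1 : ahom X B) (i2 : ahom Y B)
    (p1 : ahom B X) (p2 : ahom B Y) :
  is_biproduct i1 i2 p1 p2 -> conflation i1 p2.
Proof.
move=> HB; have [E1 E2 E3 E4 E5] := HB.
apply: kernel_conflation (kernel_biproduct HB).
have [Z [p Hc]] := ex_infl_id (ex_str C) X.
have Hp : p = 0 by have [+ _] := conflation_cokernel Hc; rewrite acompf1.
have Z0 : aidm Z = 0.
  by apply: (cokernel_hom_eq (conflation_cokernel Hc)); rewrite Hp !acompf0.
apply: (@pullback_deflation X Z Y B p 0 p1 p2); last by exists X, (aidm X).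
split; first by rewrite /= Hp !acomp0f.
move=> A a b _; exists (i1 ⋅ a + i2 ⋅ b); rewrite /= !acompDr !acompA E1 E2 E3 E4.
rewrite !acomp1f !acomp0f addr0 add0r; split=> // h' H1 H2.
by rewrite -[LHS]acomp1f -E5 acompDl -!acompA H1 H2.
Qed.

(** The morphism is composed of $1 \oplus q$, a base change of $q$, and of
    $(f, 1)$, which an automorphism turns into a projection. *)
Lemma deflation_row X P Y B (i1 : ahom X B) (i2 : ahom P B) (p1 : ahom B X)
    (p2 : ahom B P) (f : ahom X Y) (q : ahom P Y) :
  is_biproduct i1 i2 p1 p2 -> deflation q -> deflation (f ⋅ p1 + q ⋅ p2).
Proof.
move=> [E1 E2 E3 E4 E5] Hq.
have [B' [j1 [j2 [q1 [q2 HB']]]]] := biprod X Y; have [F1 F2 F3 F4 F5] := HB'.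
pose m := j1 ⋅ p1 + j2 ⋅ q ⋅ p2.
have Hq1 : q1 ⋅ m = p1.
  by rewrite acompDr !acompA F1 F3 !acomp0f addr0 acomp1f.
have Hq2 : q2 ⋅ m = q ⋅ p2.
  by rewrite acompDr !acompA F2 F4 !acomp0f add0r acomp1f.
have Dm : deflation m.
  apply: (pullback_deflation (g := p2) (p := q) (f := q2)) => //.
  split=> [|A a b /= Hab]; first by rewrite /= Hq2.
  exists (i1 ⋅ (q1 ⋅ b) + i2 ⋅ a); split.
    split.
      by rewrite acompDr !acompA E2 E4 !acomp0f add0r acomp1f.
    rewrite acompDl !acompDr -!acompA !(acompA p1) !(acompA p2) E1 E2 E3 E4.
    rewrite !acomp1f !acomp0f !acompf0 addr0 add0r Hab !acompA -acompDl.
    by rewrite F5 acomp1f.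
  move=> h' H1 H2; rewrite -[LHS]acomp1f -E5 acompDl -!acompA H1.
  by rewrite -Hq1 -(acompA q1) H2.
have Dr : deflation (q2 ⋅ (aidm B' + j2 ⋅ f ⋅ q1)).
  apply: deflation_iso.
    by exists X, j1; exact: biproduct_conflation HB'.
  exists (aidm B' - j2 ⋅ f ⋅ q1); split=> /=.
  - rewrite acompBl acompDr acompf1 acomp1f acompDr acompf1 -!acompA.
    by rewrite (acompA q1) F3 acomp0f !acompf0 addr0 addrK.
  - rewrite acompDl acompBr acompf1 acomp1f acompBr acompf1 -!acompA.
    by rewrite (acompA q1) F3 acomp0f !acompf0 subr0 subrK.
have -> : f ⋅ p1 + q ⋅ p2 = q2 ⋅ (aidm B' + j2 ⋅ f ⋅ q1) ⋅ m.
  rewrite acompDr acompf1 !acompA F2 acomp1f acompDl Hq2 -acompA Hq1.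
  by rewrite addrC.
exact: (ex_defl_comp (ex_str C) Dm Dr).
Qed.

(** When $J$ is injective, this reduces lifting problems for the deflation $q$ to
    lifting problems for $J \to Q$. Given $y : T \to Y$ and $b : T \to J$, the base
    change of $q$ along $y$ gives a morphism to $Z$ on some $T'$ with a deflation
    $T' \to T$; corrected by a morphism $T' \to K$ it becomes compatible with $b$
    and then descends to $T$. *)
Lemma conflation_pullback K Z Y J Q (i : ahom K Z) (q : ahom Z Y)
    (j : ahom K J) (r : ahom J Q) (a : ahom Z J) (t : ahom Y Q) :
  conflation i q -> conflation j r -> a ⋅ i = j -> t ⋅ q = r ⋅ a ->
  @is_pullback C _ _ _ _ r t a q.
Proof.
move=> Hi Hj Ha Ht; split; first by rewrite /= Ht.
have Ki := conflation_kernel Hi; have Kj := conflation_kernel Hj.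
have uniq A (h h' : ahom A Z) : a ⋅ h = a ⋅ h' -> q ⋅ h = q ⋅ h' -> h = h'.
  move=> H1 H2; apply/eqP; rewrite -subr_eq0; apply/eqP.
  have [|n Hn] := kernel_lift Ki (a := h - h').
    by rewrite acompBr H2 subrr.
  have n0 : n = 0.
    apply: (kernel_hom_eq Kj).
    by rewrite -Ha -acompA Hn acompBr H1 subrr acompf0.
  by rewrite -Hn n0 acompf0.
move=> T b y /= Hby.
have Dq : deflation q by exists K, i.
have [T' [z [d [Hp [N [n Hd]]]]]] := ex_defl_pullback (ex_str C) y Dq.
have Hz : q ⋅ z = y ⋅ d := Hp.1.
have [|m Hm] := kernel_lift Kj (a := a ⋅ z - b ⋅ d).
  by rewrite acompBr !acompA -Ht Hby -!acompA Hz subrr.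
pose z' := z - i ⋅ m.
have H1 : a ⋅ z' = b ⋅ d.
  by rewrite acompBr acompA Ha Hm opprB addrC subrK.
have H2 : q ⋅ z' = y ⋅ d.
  by rewrite acompBr acompA Ki.1 acomp0f subr0.
have Kd := conflation_kernel Hd; have Cd := conflation_cokernel Hd.
have [|h Hh] := cokernel_lift Cd (a := z').
  apply: uniq.
  - by rewrite acompA H1 -acompA Kd.1 !acompf0.
  - by rewrite acompA H2 -acompA Kd.1 !acompf0.
have K1 : a ⋅ h = b by apply: (cokernel_hom_eq Cd); rewrite -acompA Hh H1.
have K2 : q ⋅ h = y by apply: (cokernel_hom_eq Cd); rewrite -acompA Hh H2.
by exists h; split=> // h' H1' H2'; apply: uniq; rewrite ?H1' ?H2'.
Qed.

End Exact.

Lemma inflation_col (k : comPzRingType) (C : ExactCat k) (X P Y B : C)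
    (i1 : ahom X B) (i2 : ahom P B) (p1 : ahom B X) (p2 : ahom B P)
    (f : ahom Y X) (j : ahom Y P) :
  is_biproduct i1 i2 p1 p2 -> inflation j -> inflation (i1 ⋅ f + i2 ⋅ j).
Proof.
move=> [E1 E2 E3 E4 E5] Hj.
by apply: (@deflation_row k (op_ex C) X P Y B p1 p2 i1 i2 f j).
Qed.

(** Splitting turns the kernel sequence into a biproduct. *)
Lemma split_deflation (k : comPzRingType) (C : ExactCat k) (X Y K : C)
    (p : ahom X Y) (s : ahom Y X) (i : ahom K X) :
  p ⋅ s = aidm Y -> is_kernel i p -> deflation p.
Proof.
move=> Hs Hi; have [|r Hr] := kernel_lift Hi (a := aidm X - s ⋅ p).
  by rewrite acompBr acompA Hs acomp1f acompf1 subrr.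
exists K, i; apply: (@biproduct_conflation k C K Y X i s r p); split=> //.
- apply: (kernel_hom_eq Hi).
  by rewrite acompA Hr acompBl -acompA Hi.1 acompf0 subr0 acomp1f acompf1.
- apply: (kernel_hom_eq Hi).
  by rewrite acompA Hr acompBl -acompA Hs acomp1f acompf1 subrr acompf0.
- exact: Hi.1.
- by rewrite Hr subrK.
Qed.

(** * Stable isomorphisms *)

Section StableIso.
Context {k : comPzRingType} {C : FrobeniusCat k}.
Implicit Types X Y Z : C.

Lemma stably_zero_injective X Y J (u : ahom X J) (v : ahom J Y) :
  injective_obj J -> stably_zero (v ⋅ u).
Proof.
by move=> HJ; exists J, u, v; split=> //; split=> //; exact/fr_inj_proj.
Qed.

Lemma stable_iso_id X : stable_iso (aidm X).
Proof. exact: (@is_iso_id (Stable C) X). Qed.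

Lemma stable_iso_section X Y (p : ahom X Y) (s : ahom Y X) :
  p ⋅ s = aidm Y -> stably_eq (s ⋅ p) (aidm X) -> stable_iso p /\ stable_iso s.
Proof.
move=> H K; have H' := eq_stably_eq H.
by split; [exists s|exists p].
Qed.

Lemma injective_retract (J J' : C) (s : ahom J J') (r : ahom J' J) :
  r ⋅ s = aidm J -> injective_obj J' -> injective_obj J.
Proof.
move=> E H X Y i Hi f; have [g Hg] := H _ _ _ Hi (s ⋅ f).
by exists (r ⋅ g); rewrite -acompA Hg acompA E acomp1f.
Qed.

Lemma split_stable_iso X Y K (p : ahom X Y) (s : ahom Y X) (i : ahom K X) :
  p ⋅ s = aidm Y -> is_kernel i p -> injective_obj K ->
  stable_iso p /\ stable_iso s.
Proof.
move=> E Hi HK; apply: stable_iso_section => //.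
have [|r Hr] := kernel_lift Hi (a := s ⋅ p - aidm X).
  by rewrite acompBr acompA E acomp1f acompf1 subrr.
by rewrite /stably_eq -Hr; exact: stably_zero_injective.
Qed.

Lemma biproduct_stable_iso X J B (i1 : ahom X B) (i2 : ahom J B)
    (p1 : ahom B X) (p2 : ahom B J) :
  is_biproduct i1 i2 p1 p2 -> injective_obj J -> stable_iso p1 /\ stable_iso i1.
Proof.
move=> HB HJ; have [E1 _ _ _ _] := HB.
exact: split_stable_iso E1 (kernel_biproduct (biproduct_sym HB)) HJ.
Qed.

Lemma conflation_injective_split K Y Z (i : ahom K Y) (p : ahom Y Z) :
  conflation i p -> injective_obj K -> exists s : ahom Z Y, p ⋅ s = aidm Z.
Proof.
move=> Hc HK; have [|r Hr] := HK _ _ i _ (aidm K); first by exists Z, p.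
have Hp := conflation_cokernel Hc.
have [|s Hs] := cokernel_lift Hp (a := aidm Y - i ⋅ r).
  by rewrite acompBl acomp1f -acompA Hr acompf1 subrr.
exists s; apply: (cokernel_hom_eq Hp).
by rewrite -acompA Hs acompBr acompA Hp.1 acomp0f acompf1 acomp1f subr0.
Qed.

(** A stable inverse of a deflation can be corrected to a strict section, since
    its defect factors through a projective object; the kernel is then a direct
    summand of an object through which the complementary idempotent factors. *)
Lemma stable_iso_kernel K X Y (i : ahom K X) (p : ahom X Y) :
  conflation i p -> stable_iso p -> injective_obj K.
Proof.
move=> Hc [g [[J' [u' [v' [[HJ' _] E']]]] [J [u [v [[_ HJ] E]]]]]].
rewrite /= in E E'.
have [|w Hw] := HJ _ _ p _ v; first by exists K, i.
(* $p g - 1 = v u$ and $p w = v$, so subtracting $w u$ makes $g$ a section. *)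
pose s := g - w ⋅ u.
have Hs : p ⋅ s = aidm Y by rewrite acompBr acompA Hw -E opprB addrC subrK.
have Hi := conflation_kernel Hc.
have [|r Hr] := kernel_lift Hi (a := aidm X - s ⋅ p).
  by rewrite acompBr acompA Hs acomp1f acompf1 subrr.
have Hri : r ⋅ i = aidm K.
  apply: (kernel_hom_eq Hi).
  by rewrite acompA Hr acompBl -acompA Hi.1 acompf0 subr0 acomp1f acompf1.
apply: (@injective_retract K J' (u' ⋅ i) (- (r ⋅ v'))) => //.
rewrite acompNl -!acompA (acompA v') -E' acompBl -acompA Hi.1 acompf0 sub0r.
by rewrite acomp1f acompNr opprK.
Qed.

(** The complementary idempotent of a stably trivial split epimorphism factors
    through an injective object mapping to its kernel, and the kernel does not
    change under base change. *)
Lemma stable_iso_pullback X Y Y' P (p : ahom X Y) (v : ahom Y' Y)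
    (u : ahom P X) (p' : ahom P Y') (s : ahom Y X) :
  @is_pullback C _ _ _ _ p v u p' -> p ⋅ s = aidm Y -> stable_iso p ->
  stable_iso p'.
Proof.
move=> Hp Hs [g [G1 G2]].
have Hsp : stably_eq (aidm X) (s ⋅ p).
  have eqv := stably_eq_equiv X X.
  transitivity (g ⋅ p); first by symmetry.
  have -> : g ⋅ p = g ⋅ p ⋅ (s ⋅ p).
    by rewrite -!acompA (acompA p) Hs acomp1f.
  rewrite -[X in stably_eq _ X]acomp1f.
  by apply: stably_eq_comp => //; exact: eq_stably_eq.
have [J [a [b [[HJ _] E]]]] := Hsp; set e := aidm X - s ⋅ p in E.
have He : p ⋅ e = 0 by rewrite acompBr acompA Hs acomp1f acompf1 subrr.
have Hee : e ⋅ e = e by rewrite {1}/e acompBl -acompA He acompf0 subr0 acomp1f.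
have [|s' [S1 S2]] := pullback_lift Hp (a := s ⋅ v) (b := aidm Y').
  by rewrite acompA Hs acomp1f acompf1.
have [|j [J1 J2]] := pullback_lift Hp (a := e ⋅ b) (b := 0 : ahom J Y').
  by rewrite acompA He acomp0f acompf0.
have Hpu : p ⋅ u = v ⋅ p' := Hp.1.
suff Hj : s' ⋅ p' - aidm P = j ⋅ - (a ⋅ u).
  apply: (stable_iso_section S2 _).1.
  by rewrite /stably_eq Hj; exact: stably_zero_injective.
apply: (pullback_hom_eq Hp).
  have Hj : (e ⋅ b) ⋅ (a ⋅ u) = e ⋅ u by rewrite -acompA (acompA b) -E acompA Hee.
  rewrite acompBr acompf1 (acompA u s') S1 -(acompA s v) -Hpu (acompA u j) J1.
  by rewrite acompNr Hj /e acompBl acomp1f opprB -!acompA.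
by rewrite acompBr acompf1 !acompA S2 J2 acomp0f acomp1f subrr.
Qed.

End StableIso.

(** * Exact functors and adjunctions *)

(** [fmap] between modules of morphisms, the form to which the additive
    identities apply by rewriting. *)
Definition amap (k : comPzRingType) (C D : AdditiveCat k) (F : Functor C D)
  (X Y : C) (f : ahom X Y) : ahom (F X) (F Y) := @fmap C D F X Y f.

Section ExactFunctor.
Context {k : comPzRingType} {C D : ExactCat k} {F : Functor C D}.
Implicit Types X Y Z : C.

Lemma amap_comp X Y Z (g : ahom Y Z) (f : ahom X Y) :
  amap F (g ⋅ f) = amap F g ⋅ amap F f.
Proof. exact: (@fmap_comp C D F X Y Z g f). Qed.

Lemma amap_id X : amap F (aidm X) = aidm (F X).
Proof. exact: (@fmap_id C D F X). Qed.

Hypothesis HF : exact_functor F.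

Lemma amapD X Y (f g : ahom X Y) : amap F (f + g) = amap F f + amap F g.
Proof. exact: (exf_add HF). Qed.

Lemma amap0 X Y : amap F (0 : ahom X Y) = 0.
Proof.
by apply: (addrI (amap F (0 : ahom X Y))); rewrite -amapD !addr0.
Qed.

Lemma amap_conflation X Y Z (i : ahom X Y) (p : ahom Y Z) :
  conflation i p -> conflation (amap F i) (amap F p).
Proof. exact: (exf_conflation HF). Qed.

Lemma amap_inflation X Y (i : ahom X Y) : inflation i -> inflation (amap F i).
Proof.
by move=> [Z [p /amap_conflation H]]; exists (F Z), (amap F p).
Qed.

Lemma amap_deflation Y Z (p : ahom Y Z) : deflation p -> deflation (amap F p).
Proof.
by move=> [X [i /amap_conflation H]]; exists (F X), (amap F i).
Qed.

Lemma amap_biproduct X Y B (i1 : ahom X B) (i2 : ahom Y B) (p1 : ahom B X)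
    (p2 : ahom B Y) : is_biproduct i1 i2 p1 p2 ->
  is_biproduct (amap F i1) (amap F i2) (amap F p1) (amap F p2).
Proof.
by move=> [E1 E2 E3 E4 E5]; split;
  rewrite -!amap_comp -?amapD ?E1 ?E2 ?E3 ?E4 ?E5 ?amap_id ?amap0.
Qed.

End ExactFunctor.

Section AdjunctionTheory.
Context {k : comPzRingType} {C D : ExactCat k} {L : Functor D C} {R : Functor C D}.
Variable adj : Adjunction L R.

Definition adj_counit (M : C) : ahom (L (R M)) M := counit_of adj M.
Definition adj_unit (N : D) : ahom N (R (L N)) := unit_of adj N.

Lemma counit_nat (M M' : C) (f : ahom M M') :
  adj_counit M' ⋅ amap L (amap R f) = f ⋅ adj_counit M.
Proof. exact: (@nt_nat _ _ _ _ (counit_of adj) M M' f). Qed.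

Lemma unit_nat (N N' : D) (g : ahom N N') :
  adj_unit N' ⋅ g = amap R (amap L g) ⋅ adj_unit N.
Proof. exact: (@nt_nat _ _ _ _ (unit_of adj) N N' g). Qed.

Lemma counit_unit_L (N : D) : adj_counit (L N) ⋅ amap L (adj_unit N) = aidm (L N).
Proof. exact: (triangle_L adj N). Qed.

Lemma counit_unit_R (M : C) : amap R (adj_counit M) ⋅ adj_unit (R M) = aidm (R M).
Proof. exact: (triangle_R adj M). Qed.

Lemma transposeK (N : D) (M : C) (g : ahom N (R M)) :
  amap R (adj_counit M ⋅ amap L g) ⋅ adj_unit N = g.
Proof.
by rewrite amap_comp -acompA -unit_nat acompA counit_unit_R acomp1f.
Qed.

Lemma untransposeK (N : D) (M : C) (f : ahom (L N) M) :
  adj_counit M ⋅ amap L (amap R f ⋅ adj_unit N) = f.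
Proof.
by rewrite amap_comp acompA counit_nat -acompA counit_unit_L acompf1.
Qed.

Lemma right_adjoint_pullback (X Y Z P : C) (f : ahom X Z) (g : ahom Y Z)
    (p : ahom P X) (q : ahom P Y) :
  @is_pullback C _ _ _ _ f g p q ->
  @is_pullback D _ _ _ _ (amap R f) (amap R g) (amap R p) (amap R q).
Proof.
move=> Hp; split.
  by rewrite /= -!amap_comp; congr (amap R _); exact: Hp.1.
move=> A a b /= Hab.
have [|h [H1 H2]] := pullback_lift Hp (a := adj_counit X ⋅ amap L a)
    (b := adj_counit Y ⋅ amap L b).
  by rewrite !acompA -!counit_nat -!acompA -!amap_comp Hab.
exists (amap R h ⋅ adj_unit A); split.
  by rewrite !acompA -!amap_comp H1 H2 !transposeK.
move=> h' H1' H2'; rewrite -[LHS]transposeK; congr (amap R _ ⋅ _).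
by apply: (pullback_hom_eq Hp);
  rewrite acompA -counit_nat -acompA -amap_comp ?H1' ?H2' ?H1 ?H2.
Qed.

Hypothesis HL : exact_functor L.
Hypothesis HR : exact_functor R.

Lemma right_adjoint_kernel (X Y Z : C) (i : ahom X Y) (p : ahom Y Z) :
  is_kernel i p -> is_kernel (amap R i) (amap R p).
Proof.
move=> Hi; split; first by rewrite -amap_comp Hi.1 amap0.
move=> A a Ha.
have [|h Hh] := kernel_lift Hi (a := adj_counit Y ⋅ amap L a).
  by rewrite acompA -counit_nat -acompA -amap_comp Ha amap0 // acompf0.
exists (amap R h ⋅ adj_unit A); split.
  by rewrite acompA -amap_comp Hh transposeK.
move=> h' Hh'; rewrite -[LHS]transposeK; congr (amap R _ ⋅ _).
by apply: (kernel_hom_eq Hi); rewrite acompA -counit_nat -acompA -amap_comp Hh' Hh.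
Qed.

End AdjunctionTheory.

(** * The model structure defined by a left adjoint *)

(** The hypotheses used here only say that $R(\delta_M)$ is a stable isomorphism
    and a deflation. Together with their duals for $L(\eta_N)$ they are invariant
    under passing to opposite categories and exchanging $L$ and $R$. *)

Section Model.
Context {k : comPzRingType} {C D : FrobeniusCat k}.
Context {L : Functor D C} {R : Functor C D} (adj : Adjunction L R).
Hypotheses (HL : exact_functor L) (HR : exact_functor R).
Context (rC : Resolutions C) (rD : Resolutions D).
Hypothesis counit_iso : forall M : C, stable_iso (amap R (adj_counit adj M)).
Hypothesis counit_defl : forall M : C, deflation (amap R (adj_counit adj M)).

Let WC : MorClass C := stable_iso_class R.

Lemma amap_stable_iso_R (X Y : C) (f : ahom X Y) :
  stable_iso f -> stable_iso (amap R f).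
Proof. exact: (sc_iso (stable_class_R adj HL HR rC)). Qed.

Lemma amap_stable_iso_L (X Y : D) (f : ahom X Y) :
  stable_iso f -> stable_iso (amap L f).
Proof. exact: (sc_iso (stable_class_L adj HL HR rD)). Qed.

Lemma stable_class_two_of_three : two_out_of_three WC.
Proof. exact: (@iso_class_two_of_three _ _ (stableQ D ∘F R)). Qed.

Lemma stable_class_retract : retract_closed WC.
Proof. exact: (@iso_class_retract _ _ (stableQ D ∘F R)). Qed.

Lemma stable_class_comp (X Y Z : C) (g : ahom Y Z) (f : ahom X Y) :
  WC f -> WC g -> WC (g ⋅ f : @hom C X Z).
Proof. by have [H _ _] := stable_class_two_of_three f g. Qed.

Lemma stable_class_cancelr (X Y Z : C) (g : ahom Y Z) (f : ahom X Y) :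
  WC f -> WC (g ⋅ f : @hom C X Z) -> WC g.
Proof. by have [_ H _] := stable_class_two_of_three f g. Qed.

Lemma injective_L (J : D) : injective_obj J -> @injective_obj k C (L J).
Proof. exact: (left_adjoint_injective adj HR). Qed.

(** The right lifting property with respect to all $0 \to LN$ with $LN$
    projective. In contrast to the class defined by the objects $PLN$, this one
    does not depend on the choice of projective presentations; it contains the
    latter, and the weak equivalences and cofibrations form a model structure
    with it for every choice. *)
Definition FibL : MorClass C := fun X Y f =>
  forall (N : D), @projective_obj k C (L N) ->
  forall v : ahom (L N) Y, exists h : ahom (L N) X, acomp (C := C) f h = v.

Lemma FibL_retract : retract_closed FibL.
Proof.
move=> X Y A B f g [s [r [s' [r' [H1 H2 H3 H4]]]]] Hg N HN v.
rewrite /= in H1 H2 H3 H4.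
have [h Hh] := Hg N HN (acomp (C := C) s' v).
by exists (acomp (C := C) r h); rewrite acompA H4 -acompA Hh acompA H2 acomp1f.
Qed.

Lemma FibC_lift (X Y : C) (f : ahom X Y) :
  FibC L rC f <->
  forall (N : D) (v : ahom (rP rC (L N)) Y), exists h, f ⋅ h = v.
Proof.
have H0 (Z : C) (a b : ahom (zob C) Z) : a = b.
  by rewrite -[a]acompf1 -[b]acompf1 zobP !acompf0.
split=> H N.
- move=> v; have [|h [_ Hh]] := H N 0 v; last by exists h.
  exact: H0.
- move=> u v _; have [h Hh] := H N v; exists h; split=> //; exact: H0.
Qed.

Lemma FibC_sub (X Y : C) (f : @hom C X Y) : FibC L rC f -> FibL f.
Proof.
move=> /FibC_lift H N HN v.
have [|s Hs] := HN _ _ (rP_out rC (L N)) _ (aidm _).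
  by exists (rSV rC (L N)), (rP_in rC (L N)); exact: rP_conf.
have [h Hh] := H N (v ⋅ rP_out rC (L N)); exists (h ⋅ s).
by rewrite acompA Hh -acompA Hs acompf1.
Qed.

(** If $PLN$ is a direct summand of $LN'$, then it is also one of $LIN'$, which
    is projective. *)
Lemma FibC_adapted :
  (forall N : D, exists N' : D, @direct_summand C (rP rC (L N)) (L N')) ->
  FibC L rC = FibL.
Proof.
move=> HN; apply: mor_class_ext => X Y f; split; first exact: FibC_sub.
move=> Hf; apply/FibC_lift => N v.
have [N' [s [r Hr]]] := HN N; rewrite /= in Hr.
have HP : injective_obj (rP rC (L N)) by apply/fr_inj_proj; exact: rP_proj.
have [|r' Hr'] := HP _ _ (amap L (rI_in rD N')) _ r.
  by apply: amap_inflation => //; exists (rS rD N'), (rI_out rD N'); exact: rI_conf.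
have [|h Hh] := Hf (rI rD N') _ (v ⋅ r').
  by apply/fr_inj_proj; apply: injective_L; exact: rI_inj.
exists (h ⋅ (amap L (rI_in rD N') ⋅ s)).
by rewrite acompA Hh -acompA (acompA r') Hr' Hr acompf1.
Qed.

(** A morphism from a projective $LN$ to $Y$ extends to $LIN$, because $LN$ is also
    injective, and the transpose $IN \to RY$ of the extension lifts along
    $P(RY) \to RY$. Thus one test object suffices for the fibrations with target
    $Y$. *)
Lemma FibL_cover (Y : C) :
  let t := adj_counit adj Y ⋅ amap L (rP_out rD (R Y)) in
  forall N : D, @projective_obj k C (L N) ->
  forall v : ahom (L N) Y, exists m, v = t ⋅ m.
Proof.
move=> t N HN v.
have HI : @injective_obj k C (L N) by apply/fr_inj_proj.
have [|r Hr] := HI _ _ (amap L (rI_in rD N)) _ (aidm (L N)).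
  by apply: amap_inflation => //; exists (rS rD N), (rI_out rD N); exact: rI_conf.
pose w : ahom (rI rD N) (R Y) := amap R (v ⋅ r) ⋅ adj_unit adj (rI rD N).
have [|m Hm] := (fr_inj_proj (rI rD N)).1 (@rI_inj _ _ rD N) _ _
    (rP_out rD (R Y)) _ w.
  by exists (rSV rD (R Y)), (rP_in rD (R Y)); exact: rP_conf.
exists (amap L m ⋅ amap L (rI_in rD N)).
rewrite acompA /t -(acompA (adj_counit adj Y)) -amap_comp Hm untransposeK.
by rewrite -acompA Hr acompf1.
Qed.

Lemma FibL_of_cover (X Y : C) (f : ahom X Y)
    (h : ahom (L (rP rD (R Y))) X) :
  f ⋅ h = adj_counit adj Y ⋅ amap L (rP_out rD (R Y)) -> FibL f.
Proof.
move=> Hh N HN v; have [m ->] := FibL_cover HN v.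
by exists (h ⋅ m); rewrite acompA Hh.
Qed.

Lemma cover_injective (Y : C) : @injective_obj k C (L (rP rD (R Y))).
Proof. by apply: injective_L; apply/fr_inj_proj; exact: rP_proj. Qed.

(** Let $K$ be the kernel of $q$ and $j : K \to J$ an inflation with $J$ injective
    and cokernel $r : J \to Q$. Since $q$ is a base change of $r$, it is enough to
    lift $i$ against $r$. The morphism $A \to J$ extends to $B$, and what remains to
    be lifted is a morphism $x : LN \to Q$. Its transpose $N \to RQ$ lifts to $RJ$,
    as $RK$ is injective and the conflation $RK \to RJ \to RQ$ splits. *)
Lemma lifting_conflation (A B Z Y : C) (N : D) (i : ahom A B)
    (c : ahom B (L N)) (q : ahom Z Y) :
  conflation i c -> deflation q -> WC q -> @lifting C _ _ _ _ i q.
Proof.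
move=> Hc [K [n Hn]] Wq u v /= Huv.
have HK : @injective_obj k D (R K).
  exact: stable_iso_kernel (amap_conflation HR Hn) Wq.
have Hj := rI_conf rC K; set j := rI_in rC K in Hj; set r := rI_out rC K in Hj.
have HJ : injective_obj (rI rC K) by exact: rI_inj.
have [|a Ha] := HJ _ _ n _ j; first by exists Y, q.
have Cn := conflation_cokernel Hn; have Cj := conflation_cokernel Hj.
have Cc := conflation_cokernel Hc.
have [|t Ht] := cokernel_lift Cn (a := r ⋅ a); first by rewrite -acompA Ha Cj.1.
have Hp := conflation_pullback Hn Hj Ha Ht.
have [|w Hw] := HJ _ _ i _ (a ⋅ u); first by exists (L N), c.
have [|x Hx] := cokernel_lift Cc (a := t ⋅ v - r ⋅ w).
  by rewrite acompBl -!acompA Hw -Huv !acompA Ht subrr.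
have [s Hs] := conflation_injective_split (amap_conflation HR Hj) HK.
pose y : ahom (L N) (rI rC K) :=
  adj_counit adj (rI rC K) ⋅ amap L (s ⋅ (amap R x ⋅ adj_unit adj N)).
have Hy : r ⋅ y = x.
  rewrite /y acompA -counit_nat -acompA -amap_comp (acompA _ s) Hs acomp1f.
  exact: untransposeK.
have [|h [H1 H2]] := pullback_lift Hp (a := w + y ⋅ c) (b := v).
  by rewrite acompDr acompA Hy Hx addrC subrK.
exists h; split=> //=; apply: (pullback_hom_eq Hp).
- by rewrite acompA H1 acompDl Hw -acompA Cc.1 acompf0 addr0.
- by rewrite acompA H2 Huv.
Qed.

(** Adding a projective object to the source makes $p$ a deflation; the component
    of the resulting lifting on this object is zero on $A$ and hence factors
    through $LN$ and $LIN$, so that it can be moved to $X$. *)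
Lemma lifting_cof_trivial_fib (A B X Y : C) (i : @hom C A B) (p : @hom C X Y) :
  CofC L i -> FibL p -> WC p -> lifting i p.
Proof.
move=> [A' [B' [i' [N [c [Hc Hr]]]]]] Fp Wp; apply: lifting_retract_l Hr _.
move=> u v /= Huv.
have [Z [i1 [i2 [p1 [p2 HZ]]]]] := biprod X (rP rC Y).
have [E1 E2 E3 E4 E5] := HZ.
pose pi := rP_out rC Y; pose q := acomp (C := C) p p1 + pi ⋅ p2.
have Dq : deflation q.
  apply: deflation_row HZ _; exists (rSV rC Y), (rP_in rC Y); exact: rP_conf.
have Wi1 : WC i1.
  apply: amap_stable_iso_R; apply: (biproduct_stable_iso HZ _).2.
  by apply/fr_inj_proj; exact: rP_proj.
have Hqi : q ⋅ i1 = p.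
  by rewrite acompDl -!acompA E1 E4 acompf0 acompf1 addr0.
have Wq : WC q by apply: (stable_class_cancelr Wi1); rewrite Hqi.
have Hl : @lifting C _ _ _ _ i' q := lifting_conflation Hc Dq Wq.
have [|h [/= H1 H2]] := Hl (i1 ⋅ u) v.
  by rewrite /= acompA Hqi.
have Cc := conflation_cokernel Hc.
have [|g Hg] := cokernel_lift Cc (a := p2 ⋅ h).
  by rewrite -acompA H1 acompA E4 acomp0f.
have HP : injective_obj (rP rC Y) by apply/fr_inj_proj; exact: rP_proj.
have [|g' Hg'] := HP _ _ (amap L (rI_in rD N)) _ g.
  by apply: amap_inflation => //; exists (rS rD N), (rI_out rD N); exact: rI_conf.
have [|m Hm] := Fp (rI rD N) _ (pi ⋅ g').
  by apply/fr_inj_proj; apply: injective_L; exact: rI_inj.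
exists (p1 ⋅ h + m ⋅ (amap L (rI_in rD N) ⋅ c)); split=> /=.
- rewrite acompDl -!acompA H1 Cc.1 !acompf0 addr0.
  by rewrite acompA E1 acomp1f.
- rewrite acompDr !acompA Hm -!acompA (acompA g') Hg' Hg -H2 acompDl.
  by rewrite !acompA.
Qed.

(** In $X \to X \oplus LP(RY) \to Y$ the second morphism is a fibration because
    $LP(RY) \to Y$ is the test object for $Y$; the first one lifts against all
    fibrations because $LP(RY)$ is projective. *)
Lemma factor_trivial_cof_split (X Y : C) (f : ahom X Y) :
  exists (Z : C) (i : ahom X Z) (p : ahom Z Y),
    [/\ f = p ⋅ i, CofC L i, WC i, FibL p &
        forall A B (q : @hom C A B), FibL q -> @lifting C _ _ _ _ i q].
Proof.
have [Z [i1 [i2 [p1 [p2 HZ]]]]] := biprod X (L (rP rD (R Y)) : C).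
have [E1 E2 E3 E4 E5] := HZ.
have [t Ht] : exists t, t = adj_counit adj Y ⋅ amap L (rP_out rD (R Y)) by eexists.
exists Z, i1, (f ⋅ p1 + t ⋅ p2); split.
- by rewrite acompDl -!acompA E1 E4 !acompf0 acompf1 addr0.
- exists X, Z, i1, (rP rD (R Y)), p2; split; last exact: retract_refl.
  exact: biproduct_conflation HZ.
- apply: amap_stable_iso_R; apply: (biproduct_stable_iso HZ _).2.
  exact: cover_injective.
- apply: (@FibL_of_cover _ _ _ i2); rewrite -Ht.
  by rewrite acompDl -!acompA E2 E3 !acompf0 acompf1 add0r.
- move=> A B q Fq u v /= Huv.
  have [|h Hh] := Fq (rP rD (R Y)) _ (v ⋅ i2).
    by apply/fr_inj_proj; exact: cover_injective.
  exists (acomp (C := C) u p1 + h ⋅ p2); split=> /=.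
    by rewrite acompDl -!acompA E1 E4 !acompf0 acompf1 addr0.
  by rewrite acompDr !acompA Hh Huv -!acompA -acompDr E5 acompf1.
Qed.

(** A trivial cofibration is a retract of the canonical one in the
    factorization above. *)
Lemma lifting_trivial_cof_fib (A B X Y : C) (i : @hom C A B) (p : @hom C X Y) :
  CofC L i -> WC i -> FibL p -> lifting i p.
Proof.
move=> Ci Wi Fp.
have [Z [j [q [E Cj Wj Fq Hj]]]] := factor_trivial_cof_split i.
have Wq : WC q by apply: (stable_class_cancelr Wj); rewrite -E.
apply: lifting_retract_l (Hj _ _ _ Fp).
by apply: (@retract_argument_l C _ _ _ i j q E); exact: lifting_cof_trivial_fib.
Qed.

(** Embed $X$ into $Y \oplus IX$ with cokernel $Q$ and pull the resulting
    conflation back along $L(RQ \oplus P(RY)) \to Q$, which is a weak equivalence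
    as $\delta_Q$ is one. The summand $P(RY)$ makes the resulting morphism to $Y$ a
    fibration. *)
Lemma factor_trivial_fib (X Y : C) (f : ahom X Y) :
  exists (Z : C) (i : ahom X Z) (p : ahom Z Y),
    [/\ f = p ⋅ i, CofC L i, FibL p & WC p].
Proof.
have [M [j1 [j2 [q1 [q2 HM]]]]] := biprod Y (rI rC X).
have [F1 F2 F3 F4 F5] := HM.
have [|Q [c Hc]] := inflation_col f (j := rI_in rC X) HM.
  by exists (rS rC X), (rI_out rC X); exact: rI_conf.
set i := _ + _ in Hc.
have [N [b1 [b2 [p1 [p2 HN]]]]] := biprod (R Q : D) (rP rD (R Y)).
have [E1 E2 E3 E4 E5] := HN.
have [t Ht] : exists t, t = adj_counit adj Y ⋅ amap L (rP_out rD (R Y)) by eexists.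
pose e := adj_counit adj Q ⋅ amap L p1 + c ⋅ j1 ⋅ t ⋅ amap L p2.
have He1 : e ⋅ amap L b1 = adj_counit adj Q.
  rewrite acompDl -!acompA -!amap_comp E1 E4 amap_id (amap0 HL).
  by rewrite !acompf0 acompf1 addr0.
have He2 : e ⋅ amap L b2 = c ⋅ (j1 ⋅ t).
  rewrite acompDl -!acompA -!amap_comp E2 E3 amap_id (amap0 HL).
  by rewrite !acompf0 acompf1 add0r.
have We : WC e.
  apply: (@stable_class_cancelr _ _ _ e (amap L b1)).
    apply: amap_stable_iso_R; apply: amap_stable_iso_L.
    by apply: (biproduct_stable_iso HN _).2; apply/fr_inj_proj; exact: rP_proj.
  rewrite He1; exact: counit_iso.
have Se : amap R e ⋅ (amap R (amap L b1) ⋅ adj_unit adj (R Q)) = aidm (R Q).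
  by rewrite acompA -amap_comp He1 counit_unit_R.
have Dc : deflation c by exists X, i.
have [Z [g [p' [Hp Dp]]]] := ex_defl_pullback (ex_str C) e Dc.
have [l [L1 L2 L3]] := pullback_kernel Hp (conflation_kernel Hc).
have Hp' : @is_pullback C _ _ _ _ e c p' g.
  split; first by symmetry; exact: Hp.1.
  move=> T a b /= Hab; have [|h [[K1 K2] U]] := Hp.2 T b a; first by symmetry.
  by exists h; split=> // h' K1' K2'; exact: U.
have Wg : WC g.
  exact: stable_iso_pullback (right_adjoint_pullback adj Hp') Se We.
exists Z, l, (q1 ⋅ g); split.
- by rewrite -acompA L1 /i acompDr !acompA F1 F3 acomp0f acomp1f addr0.
- exists X, Z, l, N, p'; split; last exact: retract_refl.
  exact: kernel_conflation Dp L3.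
- have [|z [Z1 Z2]] := pullback_lift Hp (a := j1 ⋅ t) (b := amap L b2).
    by rewrite He2.
  by apply: (@FibL_of_cover _ _ _ z); rewrite -Ht -acompA Z1 acompA F1 acomp1f.
- apply: stable_class_comp Wg _; apply: amap_stable_iso_R.
  by apply: (biproduct_stable_iso HM _).1; exact: rI_inj.
Qed.

Theorem model_structure_L : model_structure WC (CofC L) FibL.
Proof.
split.
- exact: stable_class_two_of_three.
- exact: stable_class_retract.
- move=> X Y A B f g Hfg [A' [B' [i [N [p [Hc Hr]]]]]].
  exists A', B', i, N, p; split=> //; exact: retract_trans Hfg Hr.
- exact: FibL_retract.
- exact: lifting_trivial_cof_fib.
- exact: lifting_cof_trivial_fib.
- move=> X Y f; have [Z [i [p [E H1 H2 H3 _]]]] := factor_trivial_cof_split f.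
  by exists Z, i, p.
- exact: factor_trivial_fib.
Qed.

(** A fibration $p : X \to Y$ is a retract of $q : X \oplus LP(RY) \to Y$. As
    $R(q)$ is a deflation and $R$ preserves kernels, the kernel of $R(q)$ has the
    form $RK$ with $K$ the kernel of $q$. *)
Lemma FibD_amap (HK : has_kernels C) (X Y : C) (p : @hom C X Y) :
  FibL p -> FibD R (fmap R p).
Proof.
move=> Fp.
have [Z [i1 [i2 [p1 [p2 HZ]]]]] := biprod X (L (rP rD (R Y)) : C).
have [E1 E2 E3 E4 E5] := HZ.
have [t Ht] : exists t, t = adj_counit adj Y ⋅ amap L (rP_out rD (R Y)) by eexists.
have [|h Hh] := Fp (rP rD (R Y)) _ t.
  by apply/fr_inj_proj; exact: cover_injective.
pose q := acomp (C := C) p p1 + t ⋅ p2.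
have [K [j Hj]] := HK _ _ q.
have Dt : deflation (amap R t).
  rewrite Ht amap_comp; apply: (ex_defl_comp (ex_str D)) (counit_defl Y).
  do 2!apply: amap_deflation => //.
  by exists (rSV rD (R Y)), (rP_in rD (R Y)); exact: rP_conf.
have Dq : deflation (amap R q).
  rewrite /q amapD // !amap_comp.
  exact: deflation_row (amap_biproduct HR HZ) Dt.
exists (R Z), (R Y), (amap R q), K, (amap R j); split.
  by apply: kernel_conflation Dq _; exact: (right_adjoint_kernel adj HL HR).
exists (amap R i1), (amap R (p1 + h ⋅ p2)), (idm (R Y)), (idm (R Y)).
split=> /=.
- rewrite -amap_comp -amap_id; congr amap.
  by rewrite acompDl -!acompA E1 E4 acompf0 addr0.
- by rewrite acomp1f.
- rewrite acomp1f -amap_comp; congr amap.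
  by rewrite acompDl -!acompA E1 E4 acompf0 acompf1 addr0.
- rewrite acomp1f; apply: etrans (esym (amap_comp _ _)) _; congr amap.
  by rewrite acompDr acompA Hh.
Qed.

(** * Derivability *)

(** Pushing out along the retraction of sources makes $i$ a retract of an
    inflation under the same source; the retraction induces an idempotent of a
    pushout of that inflation, and an object splitting it is a pushout of $i$. *)
Lemma cofibration_pushout (HK : has_kernels C) (A B A' : C) (i : ahom A B)
    (v : ahom A A') : CofC L i ->
  exists (B' : C) (g : ahom B B') (i' : ahom A' B'),
    @is_pushout C _ _ _ _ i v g i'.
Proof.
move=> [A0 [B0 [j [N [c [Hc [s [r [s' [r' [H1 H2 H3 H4]]]]]]]]]]].
rewrite /= in H1 H2 H3 H4.
have Ij : inflation j by exists (L N), c.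
have [B1 [g1 [j1 [P1 I1]]]] := ex_infl_pushout (ex_str C) r Ij.
have E1 : g1 ⋅ j = j1 ⋅ r := P1.1.
have [|r1 [R1 R1']] := pushout_lift P1 (a := r') (b := i); first by rewrite -H4.
pose s1 := g1 ⋅ s'.
have S1 : s1 ⋅ i = j1 by rewrite /s1 -acompA -H3 acompA E1 -acompA H1 acompf1.
have RS : r1 ⋅ s1 = aidm B by rewrite /s1 acompA R1.
clearbody s1.
have [B2 [g2 [j2 [P2 _]]]] := ex_infl_pushout (ex_str C) v I1.
have E2 : g2 ⋅ j1 = j2 ⋅ v := P2.1.
have [|e [G1 G2]] := pushout_lift P2 (a := g2 ⋅ (s1 ⋅ r1)) (b := j2).
  by rewrite -!acompA R1' S1 E2.
have He : e ⋅ e = e.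
  apply: (pushout_hom_eq P2).
  - by rewrite -acompA G1 acompA G1 -!acompA (acompA r1) RS acomp1f.
  - by rewrite -acompA !G2.
have [B' [t [q [Q1 Q2]]]] := kernels_split_idempotents HK He.
exists B', (q ⋅ (g2 ⋅ s1)), (q ⋅ j2); split.
  by rewrite /= -!acompA S1 E2.
move=> T a b /= Hab.
have [|h [K1 K2]] := pushout_lift P2 (a := a ⋅ r1) (b := b).
  by rewrite -acompA R1'.
have Hhe : h ⋅ e = h.
  apply: (pushout_hom_eq P2); last by rewrite -acompA G2.
  by rewrite -acompA G1 acompA K1 -!acompA (acompA r1) RS acomp1f.
exists (h ⋅ t); split.
  rewrite !acompA -(acompA h t q) Q2 Hhe K2 K1 -acompA RS acompf1.
  by split.
move=> h' H1' H2'; suff -> : h = h' ⋅ q by rewrite -acompA Q1 acompf1.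
apply: (pushout_hom_eq P2); last by rewrite K2 -H2' acompA.
rewrite K1 -H1' -!acompA; congr (_ ⋅ _).
by rewrite -G1 acompA -Q2 acompA Q1 acomp1f.
Qed.

Lemma relevant_derivable_L : has_kernels C -> relevant_derivable WC (CofC L) (FibC L rC).
Proof.
move=> HK; have M := model_structure_L.
have isoW (X Y : C) (f : @hom C X Y) : is_iso f -> WC f.
  exact: (@is_iso_fmap _ _ (stableQ D ∘F R)).
split.
(* The fibrations are the right lifting class of their own left lifting class. *)
- apply: (left_derivable_lifting M (T := zob C)
    (S := fun A B i => forall X Y (p : @hom C X Y), FibC L rC p -> lifting i p)).
  + exact: zob_terminal.
  + exact: isoW.
  + exact: FibC_sub.
  + move=> X Y p; split; first by move=> Hp A B i; apply.
    by move=> Hp N; apply: Hp => X' Y' q; apply.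
  + by move=> X Y Y' p v _; exact: kernels_pullbacks.
  + move=> X Y f.
    have [Z [i1 [i2 [p1 [p2 HZ]]]]] := biprod X (rP rC Y).
    have [E1 E2 E3 E4 E5] := HZ.
    have HP : injective_obj (rP rC Y) by apply/fr_inj_proj; exact: rP_proj.
    exists Z, i1, (acomp (C := C) f p1 + rP_out rC Y ⋅ p2); split.
    * by rewrite /= acompDl -!acompA E1 E4 acompf0 acompf1 addr0.
    * by apply: amap_stable_iso_R; exact: (biproduct_stable_iso HZ HP).2.
    * apply/FibC_lift => N v.
      have [|h Hh] := @rP_proj _ _ rC (L N) _ _ (rP_out rC Y) _ v.
        by exists (rSV rC Y), (rP_in rC Y); exact: rP_conf.
      exists (i2 ⋅ h).
      rewrite acompDl -!acompA (acompA p1) (acompA p2) E2 E3 acomp0f acompf0.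
      by rewrite add0r acomp1f Hh.
- apply: (left_derivable_lifting (model_structure_op M) (T := zob C)
    (S := op_class (fun A B p => FibL p /\ WC p))).
  + exact: (@zob_terminal k (op_add C)).
  + by move=> X Y f [g [G1 G2]]; apply: isoW; exists g.
  + by [].
  + move=> X Y f; split.
      move=> Cf A B p [Fp Wp] u v Huv.
      have [|h [H1 H2]] := ms_lift_trivial_fib M Cf Fp Wp (u := v) (v := u).
        exact: hsym Huv.
      by exists h.
    move=> Hf; apply: (model_cof M) => A B p Fp Wp u v Huv.
    have [|h [H1 H2]] := Hf _ _ _ (conj Fp Wp) v u; first exact: hsym Huv.
    by exists h.
  + by move=> X Y Y' p v; exact: cofibration_pushout.
  + move=> X Y f; have [Z [i [p [E Ci Fp Wp]]]] := ms_factor_trivial_fib M f.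
    by exists Z, p, i.
- move=> A B X Y i p Ci _ /FibC_sub Fp _ [Wi|Wp].
  + exact: lifting_trivial_cof_fib.
  + exact: lifting_cof_trivial_fib.
Qed.

End Model.

(** * Transfer along duality *)

(** Passing twice to the opposite gives a category with the same data but other
    proofs of the axioms, so that structures are transferred axiom by axiom. *)

Section Duality.
Context {k : comPzRingType}.

Lemma left_derivable_unop (C : AdditiveCat k) (W Fib : MorClass (cat_of (op_add C))) :
  left_derivable W Fib -> @left_derivable (op C) W Fib.
Proof. by case; split; assumption. Qed.

Lemma left_derivable_opop (C : AdditiveCat k) (W Fib : MorClass C) :
  @left_derivable (op (cat_of (op_add C))) W Fib -> left_derivable W Fib.
Proof. by case; split; assumption. Qed.

Lemma model_structure_opop (C : AdditiveCat k) (W Cof Fib : MorClass C) :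
  @model_structure (cat_of (op_add C)) (op_class W) (op_class Fib)
    (op_class Cof) -> model_structure W Cof Fib.
Proof. by move=> /model_structure_op; case; split; assumption. Qed.

Lemma relevant_derivable_opop (C : AdditiveCat k) (W Cof Fib : MorClass C) :
  @relevant_derivable (cat_of (op_add C)) (op_class W) (op_class Fib)
    (op_class Cof) -> relevant_derivable W Cof Fib.
Proof.
case=> H1 H2 H3; split.
- exact: left_derivable_opop.
- exact: left_derivable_unop.
- move=> A B X Y i p Ci HA Fp HY HW u v Huv.
  have [|h [K1 K2]] := H3 _ _ _ _ p i Fp HY Ci HA _ v u (hsym Huv).
    by case: HW; [right|left].
  by exists h.
Qed.

Context {C D : FrobeniusCat k}.

Lemma stable_iso_class_op (F : Functor C D) :
  @stable_iso_class k (op_fr C) (op_fr D) (op_fun F)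
  = op_class (stable_iso_class F) :> MorClass (op_fr C).
Proof.
by apply: mor_class_ext => X Y f; exact: op_stable_iso.
Qed.

Lemma retract_of_op (E : AdditiveCat k) (X Y A B : E) (f : @hom E X Y)
    (g : @hom E A B) :
  @retract_of (cat_of (op_add E)) Y X B A f g <-> retract_of f g.
Proof.
by split=> [] [s [r [s' [r' [H1 H2 H3 H4]]]]]; exists r', s', r, s; split;
  rewrite //= (H3, H4).
Qed.

Lemma CofC_op (F : Functor C D) :
  @CofC k (op_fr D) (op_fr C) (op_fun F) = op_class (FibD F) :> MorClass (op_fr D).
Proof.
apply: mor_class_ext => X Y f; split.
- move=> [A [B [i [N [p [Hc Hr]]]]]]; exists B, A, i, N, p; split=> //.
  exact/retract_of_op.
- move=> [A [B [p [M [i [Hc Hr]]]]]]; exists B, A, p, M, i; split=> //.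
  exact/retract_of_op.
Qed.

Lemma FibD_op (F : Functor D C) :
  @FibD k (op_fr D) (op_fr C) (op_fun F) = op_class (CofC F) :> MorClass (op_fr C).
Proof.
apply: mor_class_ext => X Y f; split.
- move=> [A [B [p [M [i [Hc Hr]]]]]]; exists B, A, p, M, i; split=> //.
  exact/retract_of_op.
- move=> [A [B [i [N [p [Hc Hr]]]]]]; exists B, A, i, N, p; split=> //.
  exact/retract_of_op.
Qed.

Lemma FibC_op (F : Functor C D) (rD : Resolutions D) :
  @FibC k (op_fr D) (op_fr C) (op_fun F) (op_res rD) = op_class (CofD F rD)
  :> MorClass (op_fr D).
Proof.
by apply: mor_class_ext => X Y f; split=> H N u v Huv;
  have [h [H1 H2]] := H N v u (hsym Huv); exists h.
Qed.

End Duality.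

(** * The two model structures and the Quillen equivalence *)

Section QuillenEquivalence.
Context {k : comPzRingType} {C D : FrobeniusCat k}.
Context {L : Functor D C} {R : Functor C D} (adj : Adjunction L R).
Hypotheses (HL : exact_functor L) (HR : exact_functor R).
Context (rC : Resolutions C) (rD : Resolutions D).
Hypothesis Hcounit : forall M : C, exists (K : D) (i : ahom K (R (L (R M)))),
  is_kernel i (fmap R (counit_of adj M) : ahom (R (L (R M))) (R M)) /\
  injective_obj K.
Hypothesis Hunit : forall N : D, exists (K : C) (p : ahom (L (R (L N))) K),
  is_cokernel (fmap L (unit_of adj N) : ahom (L N) (L (R (L N)))) p /\
  projective_obj K.

Let WC := stable_iso_class R.
Let WD := stable_iso_class L.

(** $\eta_{RM}$ is a strict section of $R(\delta_M)$. *)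
Lemma counit_stable_iso (M : C) : stable_iso (amap R (adj_counit adj M)).
Proof.
have [K [i [Hi HK]]] := Hcounit M.
exact: (split_stable_iso (counit_unit_R adj M) Hi HK).1.
Qed.

Lemma counit_deflation (M : C) : deflation (amap R (adj_counit adj M)).
Proof.
have [K [i [Hi HK]]] := Hcounit M.
exact: split_deflation (counit_unit_R adj M) Hi.
Qed.

Lemma unit_stable_iso (N : D) : stable_iso (amap L (adj_unit adj N)).
Proof.
have [K [p [Hp HK]]] := Hunit N; apply/op_stable_iso.
apply: (@split_stable_iso k (op_fr C) (L (R (L N))) (L N) K
  (amap L (adj_unit adj N)) (adj_counit adj (L N)) p _ Hp _).1.
  exact: counit_unit_L.
exact/op_injective.
Qed.

Lemma unit_inflation (N : D) : inflation (amap L (adj_unit adj N)).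
Proof.
have [K [p [Hp HK]]] := Hunit N.
apply: (@split_deflation k (op_ex C) (L (R (L N))) (L N) K
  (amap L (adj_unit adj N)) (adj_counit adj (L N)) p _ Hp).
exact: counit_unit_L.
Qed.

Lemma preserves_L : preserves_class WD WC L.
Proof. by move=> X Y f; exact: (amap_stable_iso_R adj HL HR rC). Qed.

Lemma preserves_R : preserves_class WC WD R.
Proof. by move=> X Y f; exact: (amap_stable_iso_L adj HL HR rD). Qed.

Lemma model_structure_C : adapted L R rC rD -> model_structure WC (CofC L) (FibC L rC).
Proof.
move=> [HN _]; rewrite (FibC_adapted adj HL HR rD HN).
exact: model_structure_L counit_stable_iso.
Qed.

Lemma op_counit_stable_iso (N : op_fr D) :
  @stable_iso k (op_fr C) _ _ (@amap k (op_fr D) (op_fr C) (op_fun L) _ _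
    (@adj_counit k (op_fr D) (op_fr C) (op_fun R) (op_fun L) (op_adj adj) N)).
Proof. by apply/op_stable_iso; exact: unit_stable_iso. Qed.

Lemma op_counit_deflation (N : op_fr D) :
  @deflation k (op_fr C) _ _ (@amap k (op_fr D) (op_fr C) (op_fun L) _ _
    (@adj_counit k (op_fr D) (op_fr C) (op_fun R) (op_fun L) (op_adj adj) N)).
Proof. exact: unit_inflation. Qed.

Lemma model_structure_D : adapted L R rC rD -> model_structure WD (CofD R rD) (FibD R).
Proof.
move=> [_ HM]; apply: (@model_structure_opop k D).
have M := @model_structure_L k (op_fr D) (op_fr C) (op_fun R) (op_fun L)
  (op_adj adj) (op_exact_functor HR) (op_exact_functor HL) (op_res rD)
  (op_res rC) op_counit_stable_iso.
rewrite -(@FibC_adapted k (op_fr D) (op_fr C) (op_fun R) (op_fun L)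
  (op_adj adj) (op_exact_functor HR) (op_exact_functor HL) (op_res rD)
  (op_res rC)) in M.
  by rewrite stable_iso_class_op FibC_op CofC_op in M.
by move=> M'; have [M'' [s [r Hsr]]] := HM M'; exists M'', r, s.
Qed.

Lemma relevant_derivable_C : has_kernels C -> relevant_derivable WC (CofC L) (FibC L rC).
Proof. exact: (relevant_derivable_L HL HR rC rD counit_stable_iso). Qed.

Lemma relevant_derivable_D : has_cokernels D -> relevant_derivable WD (CofD R rD) (FibD R).
Proof.
move=> HK; apply: (@relevant_derivable_opop k D).
have M := @relevant_derivable_L k (op_fr D) (op_fr C) (op_fun R) (op_fun L)
  (op_adj adj) (op_exact_functor HR) (op_exact_functor HL) (op_res rD)
  (op_res rC) op_counit_stable_iso (op_has_kernels HK).
by rewrite stable_iso_class_op FibC_op CofC_op in M.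
Qed.

Lemma adjunction_quillen_equivalence : has_kernels C -> has_cokernels D ->
  quillen_equivalence adj WC (CofC L) (FibC L rC) WD (CofD R rD) (FibD R).
Proof.
move=> HKC HKD.
have fibR : preserves_class (FibC L rC) (FibD R) R.
  move=> X Y f /FibC_sub.
  exact: (FibD_amap HL HR rD counit_deflation HKC).
have cofL : preserves_class (CofD R rD) (CofC L) L.
  move=> X Y f Hf.
  have : @FibC k (op_fr D) (op_fr C) (op_fun R) (op_res rD) Y X f
    by rewrite FibC_op.
  move/FibC_sub.
  move/(@FibD_amap k (op_fr D) (op_fr C) (op_fun R) (op_fun L) (op_adj adj)
    (op_exact_functor HR) (op_exact_functor HL) (op_res rC) op_counit_deflation
    (op_has_kernels HKD)).
  by rewrite FibD_op.
split=> //.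
- by move=> X Y f Cf Wf; split; [exact: cofL|exact: preserves_L].
- by move=> X Y f Ff Wf; split; [exact: fibR|exact: preserves_R].
move=> N M g _ _.
have Wc : WC (counit_of adj M) := counit_stable_iso M.
have Wu (X : D) : WD (unit_of adj X) := unit_stable_iso X.
have [H1 _ H2] := @stable_class_two_of_three k C D R _ _ _ (fmap L g) (counit_of adj M).
split; last by move=> Wg; apply: H1 Wc; exact: preserves_L.
move=> H; have /preserves_R WRLg := H2 Wc H.
have [K1 _ _] := @stable_class_two_of_three k D C L _ _ _
  (unit_of adj N) (fmap R (fmap L g)).
have [_ _ K2] := @stable_class_two_of_three k D C L _ _ _ g (unit_of adj (R M)).
apply: (K2 (Wu _)); have E := unit_nat adj (g : ahom N (R M)).
exact: (eq_ind_r (fun h : @hom D N (R (L (R M))) => stable_iso_class L h)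
  (K1 (Wu N) WRLg) E).
Qed.

End QuillenEquivalence.

(** * Morphisms of derivators *)

Lemma locQ_triangle (C : Category) (S : MorClass C) (X Y Z : C)
    (b : hom Y Z) (a : hom X Y) (c : hom X Z) :
  b ∘ a ≈ c -> fmap (locQ S) b ∘ fmap (locQ S) a ≈ fmap (locQ S) c.
Proof. by move=> H; rewrite -fmap_comp; apply: fmap_heq. Qed.

Section LocalizedMorphism.
Context {E E' : Category} {W : MorClass E} {W' : MorClass E'} {F : Functor E E'}.
Hypothesis HF : preserves_class W W' F.

Lemma postcomp_class (I : Category) :
  preserves_class (@objectwise E W I) (@objectwise E' W' I) (postcomp I F).
Proof. by move=> X Y a H i; exact: HF. Qed.

Definition dia_postcomp (I : Category) : Functor (dia W I) (dia W' I) :=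
  loc_map (@postcomp_class I).

Lemma postcomp_pull_iso (I J : Category) (u : Functor I J)
  (X : Functor (op J) E) : is_iso (postcomp_pull F u X).
Proof.
unshelve eexists.
  refine (@Build_NatTrans _ _ (F ∘F (X ∘F Fop u)) ((F ∘F X) ∘F Fop u)
    (fun i => idm (F (X (u i)))) _).
  by move=> i j f /=; rewrite comp1f compf1.
by split=> i /=; rewrite comp1f.
Qed.

Definition dia_postcomp_pull (I J : Category) (u : Functor I J) :
  NatIso (dia_pull W' u ∘F dia_postcomp J) (dia_postcomp I ∘F dia_pull W u).
Proof.
refine (@Build_NatIso _ _ _ _ (@loc_nat _ _ _ (dia_pull W' u ∘F dia_postcomp J)
    (dia_postcomp I ∘F dia_pull W u)
  (fun X => @fmap _ _ (locQ (@objectwise E' W' I)) ((F ∘F X) ∘F Fop u)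
    (F ∘F (X ∘F Fop u)) (postcomp_pull F u X)) _)
  (fun X => @is_iso_fmap _ _ (locQ (@objectwise E' W' I)) ((F ∘F X) ∘F Fop u)
    (F ∘F (X ∘F Fop u)) _ (postcomp_pull_iso u X))).
abstract (move=> X Y f; apply: (@locQ_square (Fun (op I) E') (@objectwise E' W' I)
    _ _ _ _ (postcomp_pull F u Y) (fmap (precomp u) (fmap (postcomp J F) f))
    (fmap (postcomp I F) (fmap (precomp u) f)) (postcomp_pull F u X));
  by move=> i /=; rewrite comp1f compf1).
Defined.

(** A functor which preserves weak equivalences induces a morphism of
    derivators without any replacement. *)
Definition derivator_map : PdMor (derivator W) (derivator W').
Proof.
refine (@Build_PdMor (derivator W) (derivator W') (fun I => dia_postcomp I)
  (fun I J u => dia_postcomp_pull u) _ _ _).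
- move=> I J u v a X.
  by apply: (@locQ_square (Fun (op I) E') (@objectwise E' W' I)) => i /=;
    rewrite comp1f compf1.
- move=> I X.
  by apply: (@locQ_triangle (Fun (op I) E') (@objectwise E' W' I)) => i /=;
    rewrite fmap_id comp1f.
- move=> I J K v u X; symmetry.
  by apply: (@locQ_square3 (Fun (op I) E') (@objectwise E' W' I)) => i /=;
    rewrite fmap_id !comp1f.
Defined.

Lemma derivator_map_pull (I J : FiniteDirect) (u : Functor I J)
    (X : Functor (op J) E) :
  pm_iso derivator_map u X = fmap (diaQ W' I) (postcomp_pull F u X).
Proof. by []. Qed.

Definition dia_postcompQ (I : FiniteDirect) :
  NatTrans (diaQ W' I ∘F postcomp I F) (derivator_map I ∘F diaQ W I).
Proof.
refine (@Build_NatTrans _ _ (diaQ W' I ∘F postcomp I F)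
  (derivator_map I ∘F diaQ W I) (fun X => idm _) _).
abstract (by move=> X Y f; rewrite comp1f compf1).
Defined.

Definition dia_postcompQ_inv (I : FiniteDirect) :
  NatTrans (derivator_map I ∘F diaQ W I) (diaQ W' I ∘F postcomp I F).
Proof.
refine (@Build_NatTrans _ _ (derivator_map I ∘F diaQ W I)
  (diaQ W' I ∘F postcomp I F) (fun X => idm _) _).
abstract (by move=> X Y f; rewrite comp1f compf1).
Defined.

(** The objects of a localization are those of the original category, so that a
    transformation out of the extended functor is the same as one out of the
    given functor. *)
Lemma derivator_map_right_derived : is_right_derived_mor F derivator_map.
Proof.
exists dia_postcompQ; split.
- move=> I G s.
  pose t X : hom (derivator_map I X) (G X) := s X.
  have Ht (X Y : Fun (op I) E) (f : hom X Y) :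
      t Y ∘ fmap (derivator_map I) (fmap (diaQ W I) f)
        ≈ fmap G (fmap (diaQ W I) f) ∘ t X by exact: (nt_nat s f).
  exists (@loc_nat _ _ _ (derivator_map I) G t Ht); split.
    by move=> X; exact: compf1.
  by move=> t' H X; rewrite -(H X); symmetry; exact: compf1.
- move=> I J u X; rewrite derivator_map_pull.
  transitivity (fmap (diaQ W' I) (postcomp_pull F u X)).
    apply: htrans (compf1 _); apply: comp_heq => //.
    exact: (fmap_id (@pd_pull (derivator W') I J u)).
  by symmetry; exact: comp1f.
Qed.

Lemma derivator_map_left_derived : is_left_derived_mor F derivator_map.
Proof.
exists dia_postcompQ_inv; split.
- move=> I G s.
  pose t X : hom (G X) (derivator_map I X) := s X.
  have Ht (X Y : Fun (op I) E) (f : hom X Y) :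
      t Y ∘ fmap G (fmap (diaQ W I) f)
        ≈ fmap (derivator_map I) (fmap (diaQ W I) f) ∘ t X by exact: (nt_nat s f).
  exists (@loc_nat _ _ _ G (derivator_map I) t Ht); split.
    by move=> X; exact: comp1f.
  by move=> t' H X; rewrite -(H X); symmetry; exact: comp1f.
- move=> I J u X; rewrite derivator_map_pull.
  transitivity (fmap (diaQ W' I) (postcomp_pull F u X)).
    apply: htrans (compf1 _); apply: comp_heq => //.
    exact: (fmap_id (@pd_pull (derivator W') I J u)).
  by symmetry; exact: comp1f.
Qed.

End LocalizedMorphism.

Section InverseIso.
Context {A B : Category} {F G : Functor A B} (a : NatIso F G).

Definition natiso_inv_map (X : A) : hom (G X) (F X) := projT1 (cid (ni_iso a X)).

Lemma natiso_invK (X : A) : natiso_inv_map X ∘ a X ≈ idm (F X).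
Proof. by rewrite /natiso_inv_map; case: cid => g []. Qed.

Lemma natiso_invVK (X : A) : a X ∘ natiso_inv_map X ≈ idm (G X).
Proof. by rewrite /natiso_inv_map; case: cid => g []. Qed.

Definition natiso_inv : NatIso G F.
Proof.
unshelve refine (@Build_NatIso _ _ G F (@Build_NatTrans _ _ G F natiso_inv_map _) _).
- abstract (move=> X Y f; rewrite -[X in X ≈ _]compf1 -(natiso_invVK X);
    rewrite !compA -(compA _ _ (a X)) -(nt_nat a f) !compA natiso_invK;
    by rewrite comp1f).
- abstract (by move=> X; exists (a X); rewrite natiso_invK natiso_invVK).
Defined.

End InverseIso.

Definition pd_iso_inv (A B : Prederivator) (M N : PdMor A B) (a : PdIso M N) :
  PdIso N M.
Proof.
refine (@Build_PdIso A B N M (fun I => natiso_inv (a I)) _).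
move=> I J u X; have H := pi_pull a u X.
rewrite -[X in X ≈ _]comp1f -(natiso_invK (a I)) -!compA.
apply: comp_heq => //; rewrite !compA -H -!compA -fmap_comp.
rewrite -[X in _ ≈ X]compf1; apply: comp_heq => //.
apply: htrans (fmap_id _ _); apply: fmap_heq; exact: (natiso_invVK (a J) X).
Qed.

Section LocalizedIso.
Context {E E' : Category} {W : MorClass E} {W' : MorClass E'}.
Context {F : Functor E E'} {G : Functor E' E}.
Hypotheses (HF : preserves_class W W' F) (HG : preserves_class W' W G).

Lemma locQ_square_r (C : Category) (S : MorClass C) (X Y Z T Y' : C)
    (d : hom Y' T) (c : hom X Y') (b : hom Z T) (a' : hom Y Z) (a : hom X Y) :
  d ∘ c ≈ b ∘ (a' ∘ a) ->
  fmap (locQ S) d ∘ fmap (locQ S) c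
    ≈ fmap (locQ S) b ∘ (fmap (locQ S) a' ∘ fmap (locQ S) a).
Proof. by move=> H; rewrite -!fmap_comp; apply: fmap_heq. Qed.

Definition diagram_counit (a : NatTrans (G ∘F F) (Fid E)) (I : Category)
  (X : Functor (op I) E) : @hom (Fun (op I) E) (G ∘F (F ∘F X)) X.
Proof.
refine (@Build_NatTrans _ _ (G ∘F (F ∘F X)) X (fun i => a (X i)) _).
abstract (by move=> i j f; exact: (nt_nat a (fmap X f))).
Defined.

Definition diagram_unit (b : NatTrans (Fid E) (G ∘F F)) (I : Category)
  (X : Functor (op I) E) : @hom (Fun (op I) E) X (G ∘F (F ∘F X)).
Proof.
refine (@Build_NatTrans _ _ X (G ∘F (F ∘F X)) (fun i => b (X i)) _).
abstract (by move=> i j f; exact: (nt_nat b (fmap X f))).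
Defined.

(** On a diagram the transformation is an objectwise weak equivalence, which the
    localization inverts. *)
Definition dia_counit (a : NatTrans (G ∘F F) (Fid E)) (Ha : forall X, W (a X))
  (I : Category) :
  NatIso (dia_postcomp HG I ∘F dia_postcomp HF I) (Fid (dia W I)).
Proof.
refine (@Build_NatIso _ _ _ _ (@loc_nat _ _ _
    (dia_postcomp HG I ∘F dia_postcomp HF I) (Fid (dia W I))
    (fun X => @fmap _ _ (locQ (@objectwise E W I)) (G ∘F (F ∘F X)) X
      (diagram_counit a X)) _)
  (fun X => @locQ_inverts _ (@objectwise E W I) (G ∘F (F ∘F X)) X
    (diagram_counit a X) (fun i => Ha (X i)))).
abstract (move=> X Y f; apply: (@locQ_square (Fun (op I) E) (@objectwise E W I)
    _ _ _ _ (diagram_counit a Y) (fmap (postcomp I G) (fmap (postcomp I F) f))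
    f (diagram_counit a X)); by move=> i; exact: (nt_nat a (f i))).
Defined.

Definition dia_unit_iso (b : NatTrans (Fid E) (G ∘F F)) (Hb : forall X, W (b X))
  (I : Category) :
  NatIso (Fid (dia W I)) (dia_postcomp HG I ∘F dia_postcomp HF I).
Proof.
refine (@Build_NatIso _ _ _ _ (@loc_nat _ _ _ (Fid (dia W I))
    (dia_postcomp HG I ∘F dia_postcomp HF I)
    (fun X => @fmap _ _ (locQ (@objectwise E W I)) X (G ∘F (F ∘F X))
      (diagram_unit b X)) _)
  (fun X => @locQ_inverts _ (@objectwise E W I) X (G ∘F (F ∘F X))
    (diagram_unit b X) (fun i => Hb (X i)))).
abstract (move=> X Y f; apply: (@locQ_square (Fun (op I) E) (@objectwise E W I)
    _ _ _ _ (diagram_unit b Y) f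
    (fmap (postcomp I G) (fmap (postcomp I F) f)) (diagram_unit b X));
  by move=> i; exact: (nt_nat b (f i))).
Defined.

Definition derivator_counit (a : NatTrans (G ∘F F) (Fid E)) 
  (Ha : forall X, W (a X)) :
  PdIso (pm_comp (derivator_map HG) (derivator_map HF)) (pm_id (derivator W)).
Proof.
refine (@Build_PdIso _ _ (pm_comp (derivator_map HG) (derivator_map HF))
  (pm_id (derivator W)) (fun I => dia_counit Ha I) _).
move=> I J u X.
apply: (@locQ_square_r (Fun (op I) E) (@objectwise E W I) _ _ _ _ _
  (idm (precomp u X)) (fmap (precomp u) (diagram_counit a X))
  (diagram_counit a (precomp u X)) (fmap (postcomp I G) (postcomp_pull F u X))
  (postcomp_pull G u (F ∘F X))).
by move=> i /=; rewrite fmap_id !compf1 comp1f.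
Defined.

Definition derivator_unit (b : NatTrans (Fid E) (G ∘F F)) 
  (Hb : forall X, W (b X)) :
  PdIso (pm_id (derivator W)) (pm_comp (derivator_map HG) (derivator_map HF)).
Proof.
refine (@Build_PdIso _ _ (pm_id (derivator W)) 
  (pm_comp (derivator_map HG) (derivator_map HF)) (fun I => dia_unit_iso Hb I) _).
move=> I J u X.
apply: (@locQ_square3 (Fun (op I) E) (@objectwise E W I) _ _ _ _ _
  (fmap (postcomp I G) (postcomp_pull F u X)) (postcomp_pull G u (F ∘F X))
  (fmap (precomp u) (diagram_unit b X))
  (diagram_unit b (precomp u X)) (idm (precomp u X))).
by move=> i /=; rewrite fmap_id !compf1 !comp1f.
Defined.

End LocalizedIso.

(** * Triangle equivalence *)

Section EquivalenceProducts.
Context {A B : Category} {F : Functor A B} {G : Functor B A}.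
Context (a : NatIso (G ∘F F) (Fid A)) (b : NatIso (F ∘F G) (Fid B)).

Lemma natiso_id_faithful (A' B' : Category) (F' : Functor A' B')
    (G' : Functor B' A') (c : NatIso (G' ∘F F') (Fid A')) (X Y : A')
    (f g : hom X Y) : fmap F' f ≈ fmap F' g -> f ≈ g.
Proof.
move=> H; have [c' [_ K]] := ni_iso c X.
have Hf : c Y ∘ fmap G' (fmap F' f) ≈ f ∘ c X := nt_nat c f.
have Hg : c Y ∘ fmap G' (fmap F' g) ≈ g ∘ c X := nt_nat c g.
have E : f ∘ c X ≈ g ∘ c X by rewrite -Hf H Hg.
apply: htrans (hsym (compf1 _)) _; apply: htrans (comp_heq (hrefl _) (hsym K)) _.
by rewrite compA E -compA K; exact: compf1.
Qed.

Lemma natiso_id_full (X Y : A) (u : hom (F X) (F Y)) :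
  exists v : hom X Y, fmap F v ≈ u.
Proof.
have [c' [K1 K2]] := ni_iso a X; have [d' [K3 _]] := ni_iso a Y.
pose v : hom X Y := a Y ∘ fmap G u ∘ c'.
exists v; apply: (natiso_id_faithful b).
have H : a Y ∘ fmap G (fmap F v) ≈ v ∘ a X := nt_nat a v.
have E : a Y ∘ fmap G (fmap F v) ≈ a Y ∘ fmap G u.
  apply: htrans H _; apply: htrans (hsym (compA _ _ _)) _.
  exact: htrans (comp_heq (hrefl _) K1) (compf1 _).
apply: htrans (hsym (comp1f _)) _; apply: htrans (comp_heq (hsym K3) (hrefl _)) _.
by rewrite -compA E compA K3; exact: comp1f.
Qed.

(** Products are defined by a universal property, so that every equivalence
    preserves them; this is how additivity on the localizations is obtained. *)
Lemma equivalence_finite_products : preserves_finite_products F.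
Proof.
have out (T : B) (X : A) (f : hom T (F X)) :
    exists f' : hom (G T) X, fmap F f' ≈ f ∘ b T := natiso_id_full (f ∘ b T).
have faith (X Y : A) (f g : hom X Y) : fmap F f ≈ fmap F g -> f ≈ g.
  exact: (natiso_id_faithful a).
split.
- move=> T HT X; have [t Ht] := HT (G X).
  have [b' [B1 B2]] := ni_iso b X.
  exists (fmap F t ∘ b') => g; have [g' Hg] := out X T g.
  rewrite -(fmap_heq F (Ht g')) Hg -compA B2; symmetry; exact: compf1.
- move=> X Y P p q HP T f g.
  have [b' [B1 B2]] := ni_iso b T.
  have [f' Hf] := out T X f; have [g' Hg] := out T Y g.
  have [h [[H1 H2] H3]] := HP (G T) f' g'.
  exists (fmap F h ∘ b'); split.
    split; rewrite compA -fmap_comp.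
      by rewrite H1 Hf -compA B2; exact: compf1.
    by rewrite H2 Hg -compA B2; exact: compf1.
  move=> k' K1 K2; have [k0 Hk] := out T P k'.
  have E : k0 ≈ h.
    apply: H3; apply: faith; rewrite fmap_comp Hk compA.
      by rewrite K1 Hf.
    by rewrite K2 Hg.
  rewrite -(fmap_heq F E) Hk -compA B2; symmetry; exact: compf1.
Qed.

End EquivalenceProducts.

Section TriangleFunctor.
Context {k : comPzRingType} {C D : FrobeniusCat k} {F : Functor C D}.
Hypothesis HF : exact_functor F.
Hypothesis HJ : forall J : C, injective_obj J -> @injective_obj k D (F J).
Context (rC : Resolutions C) (rD : Resolutions D).

Definition shift_comparison_spec (X : C) (t : ahom (F (rS rC X)) (rS rD (F X))) :
    Prop :=
  exists b : ahom (F (rI rC X)) (rI rD (F X)),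
    b ⋅ amap F (rI_in rC X) = rI_in rD (F X) /\
    t ⋅ amap F (rI_out rC X) = rI_out rD (F X) ⋅ b.

Lemma shift_comparison_ex (X : C) : exists t, @shift_comparison_spec X t.
Proof.
have Hc := amap_conflation HF (rI_conf rC X).
have [|b Hb] := @rI_inj _ _ rD (F X) _ _ (amap F (rI_in rC X)) _
    (rI_in rD (F X)).
  by exists (F (rS rC X)), (amap F (rI_out rC X)).
have [|t Ht] := cokernel_lift (conflation_cokernel Hc)
    (a := rI_out rD (F X) ⋅ b).
  by rewrite -acompA Hb (conflation_cokernel (rI_conf rD (F X))).1.
by exists t, b.
Qed.

(** The comparison $FS \to SF$ induced by the identity of $FX$ *)
Definition shift_comparison (X : C) : ahom (F (rS rC X)) (rS rD (F X)) :=
  projT1 (cid (shift_comparison_ex X)).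

Lemma shift_comparisonP (X : C) : shift_comparison_spec (shift_comparison X).
Proof. exact: projT2 (cid (shift_comparison_ex X)). Qed.

Lemma shift_comparison_iso (X : C) : stable_iso (shift_comparison X).
Proof.
have [b [B1 B2]] := shift_comparisonP X.
apply: (stable_iso_extension (amap_conflation HF (rI_conf rC X))
  (rI_conf rD (F X)) _ _ (a := aidm (F X)) (b := b)).
- exact/HJ/rI_inj.
- exact: rI_inj.
- by rewrite acompf1.
- exact: B2.
- exact: stable_iso_id.
Qed.

Lemma shift_comparison_nat (X Y : C) (f : ahom X Y) :
  stably_eq (shift_comparison Y ⋅ amap F (shift_map rC f))
    (shift_map rD (amap F f) ⋅ shift_comparison X).
Proof.
have [bX [X1 X2]] := shift_comparisonP X.
have [bY [Y1 Y2]] := shift_comparisonP Y.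
have [b [B1 B2]] := shift_mapP rC f.
have [b' [B1' B2']] := shift_mapP rD (amap F f).
apply: (stable_extension (amap_conflation HF (rI_conf rC X))
  (rI_conf rD (F Y)) _ (a1 := amap F f) (a2 := amap F f)
  (b1 := bY ⋅ amap F b) (b2 := b' ⋅ bX)).
- exact: rI_inj.
- by rewrite -acompA -amap_comp B1 amap_comp acompA Y1.
- by rewrite -acompA X1.
- by rewrite -acompA -amap_comp B2 amap_comp acompA Y2 acompA.
- by rewrite -acompA X2 acompA B2' acompA.
- exact: eq_stably_eq.
Qed.

Context {W : MorClass C} {W' : MorClass D}.
Hypotheses (HW : stable_class rC W) (HW' : stable_class rD W').
Hypothesis hF : preserves_class W W' F.

Lemma loc_stable_square (X Y Y' Z : D) (b : ahom Y Z) (a : ahom X Y)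
    (d : ahom Y' Z) (c : ahom X Y') :
  stably_eq (b ⋅ a) (d ⋅ c) ->
  @fmap _ _ (stable_loc HW') Y Z b ∘ @fmap _ _ (stable_loc HW') X Y a
    ≈ @fmap _ _ (stable_loc HW') Y' Z d ∘ @fmap _ _ (stable_loc HW') X Y' c.
Proof.
move=> H; apply: htrans (hsym (@fmap_comp _ _ (stable_loc HW') X Y Z b a)) _.
apply: htrans (@fmap_comp _ _ (stable_loc HW') X Y' Z d c).
exact: (@fmap_heq _ _ (stable_loc HW') X Z).
Qed.

Definition loc_shift_comparison :
  NatIso (loc_map hF ∘F loc_shift HW) (loc_shift HW' ∘F loc_map hF).
Proof.
refine (@Build_NatIso _ _ _ _ (@loc_nat _ _ _ (loc_map hF ∘F loc_shift HW)
    (loc_shift HW' ∘F loc_map hF)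
    (fun X => @fmap _ _ (stable_loc HW') (F (rS rC X)) (rS rD (F X))
      (shift_comparison X)) _)
  (fun X => @is_iso_fmap _ _ (stable_loc HW') (F (rS rC X)) (rS rD (F X))
      (shift_comparison X) (shift_comparison_iso X))).
abstract (move=> X Y f; exact: (loc_stable_square (shift_comparison_nat f))).
Defined.

Lemma loc_map_distinguished (X Y Z : Loc W) (f : hom X Y) (g : hom Y Z)
    (h : hom Z (loc_shift HW X)) :
  loc_distinguished f g h ->
  @loc_distinguished k D rD W' HW' (F X) (F Y) (F Z) (fmap (loc_map hF) f)
    (fmap (loc_map hF) g) (loc_shift_comparison X ∘ fmap (loc_map hF) h).
Proof.
move=> [X' [Y' [Z' [i [p [e [x [y [z [[Hc [a [A1 A2]]] [Ix Iy Iz] H1 H2 H3]]]]]]]]]].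
exists (F X'), (F Y'), (F Z'), (amap F i), (amap F p),
  (shift_comparison X' ⋅ amap F e), (fmap (loc_map hF) x),
  (fmap (loc_map hF) y), (fmap (loc_map hF) z).
have [b [B1 B2]] := shift_comparisonP X'.
split.
- split; first exact: amap_conflation.
  exists (b ⋅ amap F a); split.
    by rewrite -acompA -amap_comp A1.
  by rewrite -acompA -amap_comp A2 amap_comp acompA B2 acompA.
- by split; apply: (@is_iso_fmap _ _ (loc_map hF)).
- apply: htrans (hsym (fmap_comp (loc_map hF) _ _)) _.
  apply: htrans (fmap_heq (loc_map hF) H1) _.
  exact: (fmap_comp (loc_map hF)).
- apply: htrans (hsym (fmap_comp (loc_map hF) _ _)) _.
  apply: htrans (fmap_heq (loc_map hF) H2) _.
  exact: (fmap_comp (loc_map hF)).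
- have N := nt_nat loc_shift_comparison x.
  apply: htrans (compA _ _ _) _; apply: htrans (comp_heq (hsym N) (hrefl _)) _.
  apply: htrans (hsym (compA _ _ _)) _.
  apply: htrans (comp_heq (hrefl _) (hsym (fmap_comp (loc_map hF) _ _))) _.
  apply: htrans (comp_heq (hrefl _) (fmap_heq (loc_map hF) H3)) _.
  apply: htrans (comp_heq (hrefl _) (fmap_comp (loc_map hF) _ _)) _.
  apply: htrans (compA _ _ _) _; apply: comp_heq => //.
  exact: hsym (@fmap_comp _ _ (stable_loc HW') (F Z') (F (rS rC X')) (rS rD (F X'))
    (shift_comparison X') (amap F e)).
Qed.

Definition loc_tri_functor : preserves_finite_products (loc_map hF) ->
  @TriFunctor (loc_tri HW) (loc_tri HW') (loc_map hF).
Proof.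
move=> HP; refine (@Build_TriFunctor (loc_tri HW) (loc_tri HW') (loc_map hF)
  loc_shift_comparison HP _).
exact: loc_map_distinguished.
Defined.

End TriangleFunctor.

Definition tri_natiso_inv (A B : TriCat) (F G : Functor A B)
  (tF : TriFunctor F) (tG : TriFunctor G) (a : TriNatIso tF tG) :
  TriNatIso tG tF.
Proof.
refine (@Build_TriNatIso A B G F tG tF (natiso_inv a) _).
abstract (move=> X; have H := tn_shift a X;
  apply: htrans (hsym (compf1 _)) _;
  apply: htrans (comp_heq (hrefl _) (hsym (natiso_invVK a (tc_shift A X)))) _;
  apply: htrans (compA _ _ _) _; apply: comp_heq => //;
  apply: htrans (hsym (compA _ _ _)) _;
  apply: htrans (comp_heq (hrefl _) (hsym H)) _;
  apply: htrans (compA _ _ _) _; apply: htrans (comp1f _);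
  apply: comp_heq => //; apply: htrans (hsym (fmap_comp _ _ _)) _;
  apply: htrans (fmap_id _ _); apply: fmap_heq; exact: natiso_invK).
Defined.

Section TriangleEquivalence.
Context {k : comPzRingType} {C D : FrobeniusCat k}.
Context {L : Functor D C} {R : Functor C D} (adj : Adjunction L R).
Hypotheses (HL : exact_functor L) (HR : exact_functor R).
Context (rC : Resolutions C) (rD : Resolutions D).

Let WC := stable_iso_class R.
Let WD := stable_iso_class L.
Let HWC : stable_class rC WC := stable_class_R adj HL HR rC.
Let HWD : stable_class rD WD := stable_class_L adj HL HR rD.

Hypothesis counit_W : forall M : C, WC (counit_of adj M).
Hypothesis unit_W : forall N : D, WD (unit_of adj N).
Hypotheses (hL : preserves_class WD WC L) (hR : preserves_class WC WD R).

Definition loc_counit : NatIso (loc_map hL ∘F loc_map hR) (Fid (Loc WC)).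
Proof.
refine (@Build_NatIso _ _ _ _ (@loc_nat _ _ _ (loc_map hL ∘F loc_map hR)
  (Fid (Loc WC)) (fun X => fmap (locQ WC) (counit_of adj X)) _)
  (fun X => locQ_inverts (counit_W X))).
abstract (move=> X Y f; exact: (@locQ_square C WC _ _ _ _ _ _ _ _
  (nt_nat (counit_of adj) f))).
Defined.

Definition loc_unit : NatIso (Fid (Loc WD)) (loc_map hR ∘F loc_map hL).
Proof.
refine (@Build_NatIso _ _ _ _ (@loc_nat _ _ _ (Fid (Loc WD))
  (loc_map hR ∘F loc_map hL) (fun X => fmap (locQ WD) (unit_of adj X)) _)
  (fun X => locQ_inverts (unit_W X))).
abstract (move=> X Y f; exact: (@locQ_square D WD _ _ _ _ _ _ _ _
  (nt_nat (unit_of adj) f))).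
Defined.

Let HJL := left_adjoint_injective adj HR.
Let HJR := right_adjoint_injective adj HL.

(** Both sides are induced on cokernels by extensions of the counit to a morphism
    from $LR(X \to IX \to SX)$ to $X \to IX \to SX$. *)
Lemma counit_shift (X : C) :
  stably_eq
    (shift_map rC (adj_counit adj X) ⋅ (shift_comparison HL rD rC (R X) ⋅
       amap L (shift_comparison HR rC rD X)))
    (adj_counit adj (rS rC X)).
Proof.
have [b [B1 B2]] := shift_mapP rC (adj_counit adj X).
have [bL [L1 L2]] := shift_comparisonP HL rD rC (R X).
have [bR [R1 R2]] := shift_comparisonP HR rC rD X.
apply: (stable_extension
  (amap_conflation HL (amap_conflation HR (rI_conf rC X)))
  (rI_conf rC X) (@rI_inj _ _ rC X)
  (a1 := adj_counit adj X) (a2 := adj_counit adj X)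
  (b1 := b ⋅ (bL ⋅ amap L bR)) (b2 := adj_counit adj (rI rC X))).
- by rewrite -!acompA -amap_comp R1 L1 B1.
- exact: counit_nat.
- rewrite -!acompA -amap_comp R2 amap_comp (acompA _ (amap L _)) L2.
  by rewrite !acompA B2.
- exact: counit_nat.
- exact: eq_stably_eq.
Qed.

(** As for the counit, with morphisms from $X \to IX \to SX$ to the chosen
    conflation of $RLX$. *)
Lemma unit_shift (X : D) :
  stably_eq (shift_map rD (adj_unit adj X))
    (shift_comparison HR rC rD (L X) ⋅ amap R (shift_comparison HL rD rC X)
      ⋅ adj_unit adj (rS rD X)).
Proof.
have [b [B1 B2]] := shift_mapP rD (adj_unit adj X).
have [bL [L1 L2]] := shift_comparisonP HL rD rC X.
have [bR [R1 R2]] := shift_comparisonP HR rC rD (L X).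
apply: (stable_extension (rI_conf rD X) (rI_conf rD (R (L X)))
  (@rI_inj _ _ rD (R (L X))) (a1 := adj_unit adj X) (a2 := adj_unit adj X)
  (b1 := b) (b2 := bR ⋅ amap R bL ⋅ adj_unit adj (rI rD X))).
- exact: B1.
- by rewrite -!acompA unit_nat (acompA (amap R bL)) -amap_comp L1 acompA R1.
- exact: B2.
- rewrite -!acompA unit_nat (acompA (amap R (shift_comparison _ _ _ _))).
  by rewrite -amap_comp L2 amap_comp !acompA R2.
- exact: eq_stably_eq.
Qed.

Theorem triangle_equivalence :
  exists (tL : @TriFunctor (loc_tri HWD) (loc_tri HWC) (loc_map hL))
    (tR : @TriFunctor (loc_tri HWC) (loc_tri HWD) (loc_map hR)),
    inhabited (TriNatIso (tri_comp tL tR) (tri_id _)) /\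
    inhabited (TriNatIso (tri_comp tR tL) (tri_id _)).
Proof.
exists (loc_tri_functor HL HJL HWD HWC
  (equivalence_finite_products (natiso_inv loc_unit) loc_counit)).
exists (loc_tri_functor HR HJR HWC HWD
  (equivalence_finite_products loc_counit (natiso_inv loc_unit))).
split; constructor.
- refine (@Build_TriNatIso (loc_tri HWC) (loc_tri HWC) _ _ _ _ loc_counit _).
  move=> X; apply: htrans (hsym (comp1f _)).
  have H := @fmap_heq _ _ (stable_loc HWC) (L (R (rS rC X))) (rS rC X)
    _ _ (counit_shift X).
  apply: htrans H.
  apply: htrans (hsym (@fmap_comp _ _ (stable_loc HWC) _ _ _
    (shift_map rC (adj_counit adj X)) _)).
  apply: comp_heq => //.
  exact: hsym (@fmap_comp _ _ (stable_loc HWC) _ _ _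
    (shift_comparison HL rD rC (R X)) (amap L (shift_comparison HR rC rD X))).
- apply: tri_natiso_inv.
  refine (@Build_TriNatIso (loc_tri HWD) (loc_tri HWD) _ _ _ _ loc_unit _).
  move=> X; apply: htrans (compf1 _) _.
  have H := @fmap_heq _ _ (stable_loc HWD) (rS rD X) (rS rD (R (L X)))
    _ _ (unit_shift X).
  apply: htrans H _.
  apply: htrans (@fmap_comp _ _ (stable_loc HWD) _ _ _
    (shift_comparison HR rC rD (L X) ⋅ amap R (shift_comparison HL rD rC X)) 
    (adj_unit adj (rS rD X))) _.
  apply: comp_heq => //.
  exact: (@fmap_comp _ _ (stable_loc HWD) _ _ _
    (shift_comparison HR rC rD (L X)) (amap R (shift_comparison HL rD rC X))).
Qed.

End TriangleEquivalence.

(** * Localizations, model structures and derivators *)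

Theorem mainTheorem2 (k : comPzRingType) (C D : FrobeniusCat k)
  (rC : Resolutions C) (rD : Resolutions D)
  (L : Functor D C) (R : Functor C D) (adj : Adjunction L R)
  (HL : exact_functor L) (HR : exact_functor R)
  (Hcounit : forall M : C, exists (K : D) (i : ahom K (R (L (R M)))),
    is_kernel i (fmap R (counit_of adj M) : ahom (R (L (R M))) (R M)) /\
    injective_obj K)
  (Hunit : forall N : D, exists (K : C) (p : ahom (L (R (L N))) K),
    is_cokernel (fmap L (unit_of adj N) : ahom (L N) (L (R (L N)))) p /\
    projective_obj K) :
  let WC := stable_iso_class R in
  let WD := stable_iso_class L in
  [/\ (* 1 *)
      exists (hL : preserves_class WD WC L) (hR : preserves_class WC WD R)
        (tL : @TriFunctor (loc_tri (stable_class_L adj HL HR rD))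
                (loc_tri (stable_class_R adj HL HR rC)) (loc_map hL))
        (tR : @TriFunctor (loc_tri (stable_class_R adj HL HR rC))
                (loc_tri (stable_class_L adj HL HR rD)) (loc_map hR)),
        inhabited (TriNatIso (tri_comp tL tR) (tri_id _)) /\
        inhabited (TriNatIso (tri_comp tR tL) (tri_id _)),
      (* 2 *)
      adapted L R rC rD ->
      has_finite_limits C -> has_finite_colimits C ->
      has_finite_limits D -> has_finite_colimits D ->
      [/\ model_category WC (CofC L) (FibC L rC),
          model_category WD (CofD R rD) (FibD R) &
          quillen_equivalence adj WC (CofC L) (FibC L rC)
            WD (CofD R rD) (FibD R)] &
      (* 3 *)
      has_kernels C -> has_cokernels D ->
      [/\ relevant_derivable WC (CofC L) (FibC L rC),
          relevant_derivable WD (CofD R rD) (FibD R) &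
          exists (LL : PdMor (derivator WD) (derivator WC))
            (RR : PdMor (derivator WC) (derivator WD)),
            [/\ is_left_derived_mor L LL, is_right_derived_mor R RR,
                inhabited (PdIso (pm_comp LL RR) (pm_id (derivator WC))) &
                inhabited (PdIso (pm_comp RR LL) (pm_id (derivator WD)))]]].
Proof.
have hL : preserves_class (stable_iso_class L) (stable_iso_class R) L.
  exact: (preserves_L adj HL HR rC).
have hR : preserves_class (stable_iso_class R) (stable_iso_class L) R.
  exact: (preserves_R adj HL HR rD).
have cW (M : C) : stable_iso_class R (counit_of adj M).
  exact: (counit_stable_iso Hcounit M).
have uW (N : D) : stable_iso_class L (unit_of adj N).
  exact: (unit_stable_iso Hunit N).
move=> WC WD; split.
- exists hL, hR; exact: triangle_equivalence.
- move=> Had HlC HcC HlD HcD; split.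
  + by split=> //; exact: (model_structure_C HL HR Hcounit Had).
  + by split=> //; exact: (model_structure_D HL HR Hunit Had).
  + apply: (adjunction_quillen_equivalence HL HR rC rD Hcounit Hunit).
      exact: finite_limits_kernels.
    exact: finite_colimits_cokernels.
- move=> HKC HKD; split.
  + exact: (relevant_derivable_C HL HR rC rD Hcounit).
  + exact: (relevant_derivable_D HL HR rC rD Hunit).
  + exists (derivator_map hL), (derivator_map hR); split.
    * exact: derivator_map_left_derived.
    * exact: derivator_map_right_derived.
    * constructor; exact: (derivator_counit hR hL cW).
    * constructor; exact: (pd_iso_inv (derivator_unit hL hR uW)).
Qed.
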